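(* Let $A\in\mathbb R^{n\times n}$ be quasiseparable of order $r_a$ with $\mathcal W(A)\subset\mathbb C^-$, and let $F,Q\in\mathbb R^{n\times n}$ be symmetric positive semidefinite and quasiseparable of orders $r_f$ and $r_q$, respectively. Let $X\in\mathbb R^{n\times n}$ be the symmetric positive semidefinite stabilizing solution of $$A^\top X+XA-XFX+Q=0.$$ For $j=1,\dots,n$ let $A^{(j)},F^{(j)},Q^{(j)}$ be the principal submatrices of $A,F,Q$ corresponding to the first $j$ row and column indices, and for $j=1,\dots,n-1$ let $A_{(j)},F_{(j)},Q_{(j)}$ be those corresponding to the last $n-j$ indices. Let $X^{(j)}$ and $X_{(j)}$ be the symmetric positive semidefinite stabilizing solutions of $$(A^{(j)})^\top X^{(j)}+X^{(j)}A^{(j)}-X^{(j)}F^{(j)}X^{(j)}+Q^{(j)}=0,\qquad (A_{(j)})^\top X_{(j)}+X_{(j)}A_{(j)}-X_{(j)}F_{(j)}X_{(j)}+Q_{(j)}=0,$$ respectively. If $E\subset\mathbb C^-$ is such that $$\mathrm{convex\ hull}\left(\bigcup_{j=1}^{n}\mathcal W\big(A^{(j)}-F^{(j)}X^{(j)}\big)\ \cup\ \bigcup_{j=1}^{n-1}\mathcal W\big(A_{(j)}-F_{(j)}X_{(j)}\big)\right)\subset E,$$ then the singular values $\sigma_i(M)$ of any $M\in\mathrm{Off}(X)$ satisfy $$\frac{\sigma_{ht+1}(M)}{\|X\|_2}\le(1+\sqrt2)^2\,Z_h(E,-E),\qquad h=1,2,\dots,$$ where $t=4r_a+2r_f+2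r_q$.
   Context: $\mathbb C^-=\{z\in\mathbb C:\Re(z)<0\}$. The numerical range is $\mathcal W(A)=\{x^HAx:\ x\in\mathbb C^n,\ \|x\|_2=1\}$. For an $n\times n$ matrix $M$, $\mathrm{Off}(M):=\{M(s+1:n,1:s): s=1,\dots,n-1\}\cup\{M(1:s,s+1:n): s=1,\dots,n-1\}$ (Matlab-like notation). $M$ is quasiseparable of order $r$ if $\max_{\widetilde M\in\mathrm{Off}(M)}\mathrm{rank}(\widetilde M)=r$. If $\mathcal W(A)\subset\mathbb C^-$ and $F,Q$ are symmetric positive semidefinite, the equation $A^\top X+XA-XFX+Q=0$ has a unique real symmetric positive semidefinite solution, called the stabilizing solution since $A-FX$ is stable, i.e. has eigenvalues with nonpositive real parts. Singular values are in nonincreasing order, with $\sigma_i(M)=0$ when $i$ exceeds the number of singular values of $M$. $Z_h(E,F):=\min_{g\in\mathcal R_{h,h}}\dfrac{\max_{z\in E}|g(z)|}{\min_{z\in F}|g(z)|}$, where $\mathcal R_{h,h}$ is the set of rational functions with numerator and denominator of degree at most $h$ (max/min read as sup/inf if not attained); $-E=\{-z:z\in E\}$. *)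

(* Defs.v *)
From mathcomp Require Import all_boot all_order all_algebra.
From mathcomp Require Import spectral complex.
From mathcomp Require Import all_classical all_reals all_analysis.

Set Implicit Arguments.
Unset Strict Implicit.
Unset Printing Implicit Defensive.

Import Order.TTheory GRing.Theory Num.Theory.
Import ComplexField.Normc.

Local Open Scope classical_set_scope.
Local Open Scope sesquilinear_scope.
Local Open Scope ring_scope.
Local Open Scope complex_scope.

Notation cmx M := (map_mx (real_complex _) M).

Definition head_ord (n : nat) (s : 'I_n.+1) : 'I_s -> 'I_n :=
  widen_ord (leq_ord s).

Definition tail_ord (n : nat) (s : 'I_n.+1) (i : 'I_(n - s)) : 'I_n :=
  cast_ord (subnKC (leq_ord s)) (rshift s i).

(* M^(j) and M_(j) *)
Definition lead_mx (R : realType) (n : nat) (M : 'M[R]_n) (j : 'I_n.+1) :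
  'M[R]_j := mxsub (@head_ord n j) (@head_ord n j) M.

Definition trail_mx (R : realType) (n : nat) (M : 'M[R]_n) (j : 'I_n.+1) :
  'M[R]_(n - j) := mxsub (@tail_ord n j) (@tail_ord n j) M.

(* The elements of Off(M) have different sizes, so each one is packed with its
   dimensions. *)
Definition block (R : realType) : Type := {d : nat * nat & 'M[R]_(d.1, d.2)}.

Definition pack (R : realType) (p q : nat) (M : 'M[R]_(p, q)) : block R :=
  existT (fun d : nat * nat => 'M[R]_(d.1, d.2)) (p, q) M.

(* M(s+1:n,1:s) and M(1:s,s+1:n) for s = 1, ..., n - 1 *)
Definition Off (R : realType) (n : nat) (M : 'M[R]_n) : seq (block R) :=
  let cuts := [seq s : 'I_n.+1 <- enum 'I_n.+1 | (0 < s < n)%N] in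
  [seq pack (mxsub (@tail_ord n s) (@head_ord n s) M) | s <- cuts] ++
  [seq pack (mxsub (@head_ord n s) (@tail_ord n s) M) | s <- cuts].

(* For n <= 1 there are no off-diagonal blocks and the order is 0. *)
Definition quasiseparable (R : realType) (n r : nat) (M : 'M[R]_n) : Prop :=
  (\max_(B <- Off M) \rank (tagged B))%N = r.

Definition vnorm2 (R : realType) (n : nat) (x : 'cV[R[i]]_n) : R :=
  Num.sqrt (\sum_i normc (x i 0) ^+ 2).

Definition mxnorm2 (R : realType) (m n : nat) (M : 'M[R[i]]_(m, n)) : R :=
  sup [set vnorm2 (M *m x) | x in [set x : 'cV[R[i]]_n | vnorm2 x = 1]].

(* Square roots of the n eigenvalues of M^H M in nonincreasing order; when
   m < n this appends n - m zeros to the usual min(m, n) singular values. *)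
Definition singvals (R : realType) (m n : nat) (M : 'M[R[i]]_(m, n)) : seq R :=
  sort >=%O [seq Num.sqrt (complex.Re (spectral_diag (M ^t* *m M) 0 i))
               | i <- enum 'I_n].

(* sigma_i(M), with i counted from 1 *)
Definition singval (R : realType) (m n : nat) (M : 'M[R[i]]_(m, n)) (i : nat) :
  R := nth 0 (singvals M) i.-1.

Definition numrange (R : realType) (n : nat) (A : 'M[R[i]]_n) : set R[i] :=
  [set (x ^t* *m A *m x) 0 0 | x in [set x : 'cV[R[i]]_n | vnorm2 x = 1]].

Definition Cminus (R : realType) : set R[i] := [set z | complex.Re z < 0].

(* Rcomplex R is R[i] viewed as a real vector space. *)
Definition convex_hull (R : realType) (S : set R[i]) : set R[i] :=
  smallest (@convex_set R (Rcomplex R)) S.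

Definition psd (R : realType) (n : nat) (M : 'M[R]_n) : Prop :=
  M^T = M /\ forall x : 'cV[R]_n, 0 <= (x^T *m M *m x) 0 0.

Definition stable (R : realType) (n : nat) (M : 'M[R]_n) : Prop :=
  forall a : R[i], eigenvalue (cmx M) a -> complex.Re a <= 0.

Definition stabilizing_sol (R : realType) (n : nat) (A F Q X : 'M[R]_n) :
  Prop :=
  [/\ psd X,
      A^T *m X + X *m A - X *m F *m X + Q = 0 &
      stable (A - F *m X)].

(* p/q in lowest terms is an element of R_{h,h}; no pole of p/q is cancelled,
   so |p/q| below is +oo exactly at the poles. *)
Definition ratfun (R : realType) (h : nat) (p q : {poly R[i]}) : Prop :=
  [/\ q != 0, coprimep p q, (size p <= h.+1)%N & (size q <= h.+1)%N].

Definition absrat (R : realType) (p q : {poly R[i]}) (z : R[i]) : \bar R :=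
  if q.[z] == 0 then +oo%E else (normc (p.[z] / q.[z]))%:E.

(* The conditions on g = p/q only discard quotients equal to +oo, which do not
   affect the infimum, and the indeterminate quotients 0/0 and oo/oo, to which
   the total operations on \bar R would assign the value 0. *)
Definition zolotarev (R : realType) (h : nat) (E F : set R[i]) : \bar R :=
  ereal_inf [set v | exists p q : {poly R[i]},
    let M := ereal_sup [set absrat p q z | z in E] in
    let m := ereal_inf [set absrat p q z | z in F] in
    [/\ ratfun h p q, (M < +oo)%E, (0 < m)%E & v = (M * m^-1)%E]].

(* Main.v *)
(* Let T = A - F X. For complementary index sets f and g, the block M = X_gf
   satisfies the Sylvester equation B M - M G = D with B = (T_gg)^T and
   G = - T_ff, where D collects products containing an off-diagonal block of A,
   F or Q and so has small rank. For polynomials p, q of degree at most h, the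
   matrix q(B) M p(G) - p(B) M q(G) has rank at most h rank D, so M differs by
   such a matrix from (p/q)(B) M (q/p)(G). The numerical ranges of B and - G lie
   in the convex set S spanned by W(T), and the Crouzeix-Palencia theorem bounds
   (p/q)(B) and (q/p)(G) by 1 + sqrt 2 times the suprema on S and - S.
   Only j = n enters: a Sylvester argument shows that the positive semidefinite
   solution is unique, so X is the given solution of index n.

   For Crouzeix-Palencia we follow Ransford and Schwenninger: if every f bounded
   by 1 on the boundary has a companion g, nearly bounded by 1, such that
   f(T) + g(T)^* has norm nearly at most 2, then the best constant K satisfies
   K^3 <= 2 K^2 + K. The companion is the Cauchy transform of the conjugate of f;
   all contour integrals are replaced by sums over fine polygons inscribed in the
   level sets of a gauge of the convex set. *)
Require Import Defs.
From mathcomp Require Import all_boot all_order all_algebra.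
From mathcomp Require Import spectral complex.
From mathcomp Require Import all_classical all_reals all_analysis.
From mathcomp Require Import ring lra.

Set Implicit Arguments.
Unset Strict Implicit.
Unset Printing Implicit Defensive.

Import Order.TTheory GRing.Theory Num.Theory.
Import ComplexField.Normc.

Local Open Scope classical_set_scope.
Local Open Scope sesquilinear_scope.
Local Open Scope ring_scope.
Local Open Scope complex_scope.

(** * Vectors and operators over the complex numbers *)

(** Write F = f(T), H = g(T) and b for the norm of F. The cubic inequality comes from F F^H F F^H =
    F (F^H + H) F F^H - (F H F) F^H: the left side has norm b^4, F^H + H has norm about 2, and F H F
    is again a polynomial in T, of norm at most about K; then divide by b. The companion works by
    positivity. Let z_k be the vertices, w_k = (z_(k+1) - z_k) / (2 pi i) and A_k = w_k (z_k -
    T)^-1. Then f(T) + g(T)^H is nearly the sum of f(z_k) (A_k + A_k^H), with positive semidefinite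
    weights of total nearly 2 I. Positivity requires that no chord cuts the convex set; hence
    polygons at a level slightly above 1, with a mesh small against that excess. The price is the
    bound on g at a boundary point x: the scalar weights concentrate near x, and the weight away
    from x has to be shown to be at most about 1. The convex set need be neither closed nor bounded,
    so attained extrema and supporting lines are replaced by approximate ones with explicit
    tolerances. *)

Section ComplexModulus.
Variable R : realType.
Implicit Types z w : R[i].
Local Notation Re := complex.Re.
Local Notation Im := complex.Im.

Lemma normc_sqr z : normc z ^+ 2 = Re z ^+ 2 + Im z ^+ 2.
Proof. by case: z => a b /=; rewrite sqr_sqrtr// addr_ge0// sqr_ge0. Qed.

Lemma normc_ge0 z : 0 <= normc z.
Proof. by case: z => a b; exact: sqrtr_ge0. Qed.

Lemma ler_normcD z w : normc (z + w) <= normc z + normc w.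
Proof. exact: (@le_normcD R z w). Qed.

Lemma normc_opp z : normc (- z) = normc z.
Proof. exact: (@normcN R z). Qed.

Lemma ler_normcB z w : normc (z - w) <= normc z + normc w.
Proof. by rewrite -(normc_opp w); exact: ler_normcD. Qed.

Lemma normc_distC z w : normc (z - w) = normc (w - z).
Proof. by rewrite -normc_opp opprB. Qed.

Lemma ler_dist_normc z w : normc z - normc w <= normc (z - w).
Proof. by rewrite lerBlDr -{1}(subrK w z); exact: ler_normcD. Qed.

Lemma normc_conj z : normc z^* = normc z.
Proof. by case: z => a b /=; rewrite sqrrN. Qed.

Lemma normc_real (x : R) : normc x%:C = `|x|.
Proof. by rewrite /= expr0n /= addr0 sqrtr_sqr. Qed.

Lemma normc0P z : (normc z == 0) = (z == 0).
Proof.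
apply/eqP/eqP => [/eq0_normc//|->].
exact: normc0.
Qed.

Lemma normc_gt0 z : (0 < normc z) = (z != 0).
Proof. by rewrite lt_def normc_ge0 andbT normc0P. Qed.

Lemma normcX z k : normc (z ^+ k) = normc z ^+ k.
Proof.
elim: k => [|k IH]; first by rewrite !expr0 normc1.
by rewrite !exprS normcM IH.
Qed.

Lemma ler_normRe z : `|Re z| <= normc z.
Proof.
rewrite -[leLHS]sqrtr_sqr -[leRHS]ger0_norm ?normc_ge0// -[leRHS]sqrtr_sqr.
by rewrite ler_sqrt ?sqr_ge0// normc_sqr lerDl sqr_ge0.
Qed.

Lemma ler_normIm z : `|Im z| <= normc z.
Proof.
rewrite -[leLHS]sqrtr_sqr -[leRHS]ger0_norm ?normc_ge0// -[leRHS]sqrtr_sqr.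
by rewrite ler_sqrt ?sqr_ge0// normc_sqr lerDr sqr_ge0.
Qed.

Lemma Re_le_normc z : Re z <= normc z.
Proof. exact: le_trans (ler_norm _) (ler_normRe z). Qed.

Lemma Im_le_normc z : Im z <= normc z.
Proof. exact: le_trans (ler_norm _) (ler_normIm z). Qed.

Lemma cReD z w : Re (z + w) = Re z + Re w.
Proof. by case: z w => a b [c d]. Qed.
Lemma cImD z w : Im (z + w) = Im z + Im w.
Proof. by case: z w => a b [c d]. Qed.
Lemma cReN z : Re (- z) = - Re z.
Proof. by case: z. Qed.
Lemma cImN z : Im (- z) = - Im z.
Proof. by case: z. Qed.
Lemma cReB z w : Re (z - w) = Re z - Re w.
Proof. by rewrite cReD cReN. Qed.
Lemma cImB z w : Im (z - w) = Im z - Im w.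
Proof. by rewrite cImD cImN. Qed.
Lemma cReM z w : Re (z * w) = Re z * Re w - Im z * Im w.
Proof. by case: z w => a b [c d]. Qed.
Lemma cImM z w : Im (z * w) = Re z * Im w + Im z * Re w.
Proof. by case: z w => a b [c d]. Qed.
Lemma cReJ z : Re z^* = Re z.
Proof. by case: z. Qed.
Lemma cImJ z : Im z^* = - Im z.
Proof. by case: z. Qed.

Lemma cRe_mulr z (x : R) : Re (z * x%:C) = Re z * x.
Proof. by case: z => a b /=; rewrite mulr0 subr0. Qed.
Lemma cRe_mull z (x : R) : Re (x%:C * z) = x * Re z.
Proof. by case: z => a b /=; rewrite mul0r subr0. Qed.
Lemma cIm_mulr z (x : R) : Im (z * x%:C) = Im z * x.
Proof. by case: z => a b /=; rewrite mulr0 add0r. Qed.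
Lemma cIm_mull z (x : R) : Im (x%:C * z) = x * Im z.
Proof. by case: z => a b /=; rewrite mul0r addr0. Qed.

Lemma mul_conjc z : z * z^* = (normc z ^+ 2)%:C.
Proof.
by apply/eqP; rewrite eq_complex cReM cImM cReJ cImJ normc_sqr /=; apply/andP;
  split; apply/eqP; ring.
Qed.

Lemma Re_sum I (r : seq I) (P : pred I) (F : I -> R[i]) :
  Re (\sum_(i <- r | P i) F i) = \sum_(i <- r | P i) Re (F i).
Proof. by by elim/big_rec2: _ => // i y x _ <-; rewrite cReD. Qed.

Lemma ler_normc_sum I (r : seq I) (P : pred I) (F : I -> R[i]) :
  normc (\sum_(i <- r | P i) F i) <= \sum_(i <- r | P i) normc (F i).
Proof.
elim/big_rec2: _ => [|i y x _ H]; first by rewrite normc0.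
by apply: le_trans (ler_normcD _ _) _; rewrite lerD2l.
Qed.

Lemma eq_complexP z w : Re z = Re w -> Im z = Im w -> z = w.
Proof. by case: z w => a b [c d] /= -> ->. Qed.

End ComplexModulus.

Section VectorNorm.
Variable R : realType.
Local Notation C := R[i].
Local Notation Re := complex.Re.

Definition dotc (n : nat) (x y : 'cV[C]_n) : C := \sum_i (x i 0)^* * y i 0.

(** Convertible to the [^t*] of the definitions; spelled with [conjc] so that entries simplify by
    the lemmas on [conjc]. *)
Definition adjmx (m n : nat) (M : 'M[C]_(m, n)) : 'M[C]_(n, m) :=
  map_mx (@conjc R) M^T.

Section Fixed.
Variable n : nat.
Implicit Types x y z : 'cV[C]_n.

Lemma dotcE x y : dotc x y = \sum_i (x i 0)^* * y i 0.
Proof. by []. Qed.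

Lemma dotcDl x y z : dotc (x + y) z = dotc x z + dotc y z.
Proof.
rewrite !dotcE -big_split/=; apply: eq_bigr => i _.
by rewrite mxE rmorphD mulrDl.
Qed.

Lemma dotcDr x y z : dotc x (y + z) = dotc x y + dotc x z.
Proof.
by rewrite !dotcE -big_split/=; apply: eq_bigr => i _; rewrite mxE mulrDr.
Qed.

Lemma dotcZr a x y : dotc x (a *: y) = a * dotc x y.
Proof.
by rewrite !dotcE mulr_sumr; apply: eq_bigr => i _; rewrite mxE mulrCA.
Qed.

Lemma dotcJ x y : (dotc x y)^* = dotc y x.
Proof.
rewrite !dotcE rmorph_sum/=; apply: eq_bigr => i _.
by rewrite rmorphM/= conjcK mulrC.
Qed.

Lemma dotcZl a x y : dotc (a *: x) y = a^* * dotc x y.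
Proof. by rewrite -dotcJ dotcZr rmorphM/= dotcJ. Qed.

Lemma dotcNr x y : dotc x (- y) = - dotc x y.
Proof. by rewrite -scaleN1r dotcZr mulN1r. Qed.

Lemma dotcNl x y : dotc (- x) y = - dotc x y.
Proof. by rewrite -dotcJ dotcNr rmorphN/= dotcJ. Qed.

Lemma vnorm2_ge0 x : 0 <= vnorm2 x.
Proof. exact: sqrtr_ge0. Qed.

Lemma vnorm2_sqr x : vnorm2 x ^+ 2 = \sum_i normc (x i 0) ^+ 2.
Proof. by rewrite sqr_sqrtr// sumr_ge0// => i _; exact: sqr_ge0. Qed.

Lemma dotcxx x : dotc x x = (vnorm2 x ^+ 2)%:C.
Proof.
rewrite dotcE vnorm2_sqr rmorph_sum/=; apply: eq_bigr => i _.
by rewrite mulrC mul_conjc.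
Qed.

Lemma Re_dotcxx x : Re (dotc x x) = vnorm2 x ^+ 2.
Proof. by rewrite dotcxx. Qed.

Lemma vnorm2_eq0 x : (vnorm2 x == 0) = (x == 0).
Proof.
apply/eqP/eqP => [x0|->]; last first.
  rewrite /vnorm2 big1 ?sqrtr0// => i _.
  by rewrite mxE normc0 expr0n.
apply/colP => i; rewrite mxE.
have := vnorm2_sqr x; rewrite x0 expr0n/= => /esym/eqP.
rewrite psumr_eq0; last by move=> j _; exact: sqr_ge0.
by move=> /allP/(_ i (mem_index_enum _)); rewrite sqrf_eq0 normc0P => /eqP.
Qed.

Lemma vnorm2_gt0 x : (0 < vnorm2 x) = (x != 0).
Proof. by rewrite lt_def vnorm2_ge0 andbT vnorm2_eq0. Qed.

Lemma vnorm2Z a x : vnorm2 (a *: x) = normc a * vnorm2 x.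
Proof.
have h : 0 <= normc a * vnorm2 x by rewrite mulr_ge0// ?normc_ge0// vnorm2_ge0.
apply/eqP; rewrite -(eqrXn2 (_ : 0 < 2)%N)// ?vnorm2_ge0// exprMn !vnorm2_sqr.
by rewrite mulr_sumr; apply/eqP/eq_bigr => i _; rewrite mxE normcM exprMn.
Qed.

Lemma vnorm2D_sqr x y :
  vnorm2 (x + y) ^+ 2 = vnorm2 x ^+ 2 + 2 * Re (dotc x y) + vnorm2 y ^+ 2.
Proof.
rewrite -!Re_dotcxx dotcDl !dotcDr !cReD -(dotcJ x y) cReJ.
ring.
Qed.

Lemma vnorm2N x : vnorm2 (- x) = vnorm2 x.
Proof. by rewrite -scaleN1r vnorm2Z normc_opp normc1 mul1r. Qed.

Lemma dotc_le x y : normc (dotc x y) <= vnorm2 x * vnorm2 y.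
Proof.
have [->|y0] := eqVneq y 0.
  rewrite dotcE big1 ?normc0 ?mulr_ge0 ?vnorm2_ge0// => i _.
  by rewrite mxE mulr0.
have ny0 : 0 < vnorm2 y by rewrite vnorm2_gt0.
set b := vnorm2 y in ny0 *; set a := vnorm2 x.
have a0 : 0 <= a by exact: vnorm2_ge0.
(* This vector is |y|^2 times the component of x orthogonal to y; its squared norm is |y|^2 (|x|^2
   |y|^2 - |d|^2). *)
set d := dotc x y; have := sqr_ge0 (vnorm2 ((b ^+ 2)%:C *: x + (- d^*) *: y)).
rewrite vnorm2D_sqr !vnorm2Z dotcZl dotcZr -/d normc_opp normc_conj -/a -/b.
rewrite normc_real ger0_norm ?sqr_ge0//.
have -> : Re (((b ^+ 2)%:C)^* * (- d^* * d)) = - (b ^+ 2 * normc d ^+ 2).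
  rewrite mulNr [d^* * d]mulrC mul_conjc cReM cReJ cImJ cReN cImN /=; ring.
move=> h; rewrite -(ler_pXn2r (_ : 0 < 2)%N)// ?nnegrE ?normc_ge0 ?mulr_ge0//
  ?(ltW ny0)//.
rewrite exprMn; move: h; move: (normc d) => e h.
have : 0 <= b ^+ 2 * (a ^+ 2 * b ^+ 2 - e ^+ 2) by move: h; lra.
by rewrite pmulr_rge0 ?exprn_gt0// subr_ge0.
Qed.

Lemma ler_vnorm2D x y : vnorm2 (x + y) <= vnorm2 x + vnorm2 y.
Proof.
rewrite -(ler_pXn2r (_ : 0 < 2)%N)// ?nnegrE ?addr_ge0 ?vnorm2_ge0//.
rewrite vnorm2D_sqr sqrrD lerD2r lerD2l mulr_natl lerMn2r /=.
exact: le_trans (Re_le_normc _) (dotc_le _ _).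
Qed.

Lemma vnorm2_0 : vnorm2 (0 : 'cV[C]_n) = 0.
Proof. by apply/eqP; rewrite vnorm2_eq0. Qed.

Lemma vnorm2_normalize x : x != 0 -> vnorm2 ((vnorm2 x)^-1%:C *: x) = 1.
Proof.
move=> x0; rewrite vnorm2Z normc_real ger0_norm ?invr_ge0 ?vnorm2_ge0//.
by rewrite mulVf// vnorm2_eq0.
Qed.

End Fixed.

Lemma adjmxK m n (M : 'M[C]_(m, n)) : adjmx (adjmx M) = M.
Proof. by apply/matrixP => i j; rewrite !mxE conjcK. Qed.

Lemma adjmxM m n p (A : 'M[C]_(m, n)) (B : 'M[C]_(n, p)) :
  adjmx (A *m B) = adjmx B *m adjmx A.
Proof. by rewrite /adjmx trmx_mul map_mxM. Qed.

Lemma adjmxD m n (A B : 'M[C]_(m, n)) : adjmx (A + B) = adjmx A + adjmx B.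
Proof. by apply/matrixP => i j; rewrite !mxE rmorphD. Qed.

Lemma dotc_mx n (x y : 'cV[C]_n) : dotc x y = (adjmx x *m y) 0 0.
Proof. by rewrite mxE; apply: eq_bigr => i _; rewrite !mxE. Qed.

Lemma adjmxE m n (M : 'M[C]_(m, n)) x y :
  dotc (adjmx M *m x) y = dotc x (M *m y).
Proof. by rewrite !dotc_mx adjmxM adjmxK mulmxA. Qed.

End VectorNorm.

Section OperatorBound.
Variable R : realType.
Local Notation C := R[i].
Local Notation Re := complex.Re.

(** A relation instead of the number [mxnorm2]: bounds combine without handling suprema. For n = 0
    it holds for negative c as well, which is why [opbound_ge0] asks for [n.+1]. *)
Definition opbound (m n : nat) (M : 'M[C]_(m, n)) (c : R) : Prop :=
  forall x, vnorm2 (M *m x) <= c * vnorm2 x.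

Lemma opbound_le m n (M : 'M[C]_(m, n)) b c :
  opbound M b -> b <= c -> opbound M c.
Proof.
by move=> Mb bc x; apply: le_trans (Mb x) _; rewrite ler_wpM2r ?vnorm2_ge0.
Qed.

Lemma opbound0 m n c : 0 <= c -> opbound (0 : 'M[C]_(m, n)) c.
Proof. by move=> c0 x; rewrite mul0mx vnorm2_0 mulr_ge0 ?vnorm2_ge0. Qed.

Lemma opbound1 n : opbound (1%:M : 'M[C]_n) 1.
Proof. by move=> x; rewrite mul1mx mul1r. Qed.

Lemma opboundD m n (M N : 'M[C]_(m, n)) b c :
  opbound M b -> opbound N c -> opbound (M + N) (b + c).
Proof.
move=> Mb Nc x; rewrite mulmxDl mulrDl.
by apply: le_trans (ler_vnorm2D _ _) _; exact: lerD.
Qed.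

Lemma opboundN m n (M : 'M[C]_(m, n)) b : opbound M b -> opbound (- M) b.
Proof. by move=> Mb x; rewrite mulNmx vnorm2N. Qed.

Lemma opboundB m n (M N : 'M[C]_(m, n)) b c :
  opbound M b -> opbound N c -> opbound (M - N) (b + c).
Proof. by move=> Mb Nc; apply: opboundD => //; exact: opboundN. Qed.

Lemma opboundZ m n (M : 'M[C]_(m, n)) a c :
  opbound M c -> opbound (a *: M) (normc a * c).
Proof.
by move=> Mc x; rewrite -scalemxAl vnorm2Z -mulrA ler_wpM2l ?normc_ge0.
Qed.

Lemma opboundM m n p (M : 'M[C]_(m, n)) (N : 'M[C]_(n, p)) b c :
  0 <= b -> opbound M b -> opbound N c -> opbound (M *m N) (b * c).
Proof.
move=> b0 Mb Nc x; rewrite -mulmxA; apply: le_trans (Mb _) _.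
by rewrite -mulrA ler_wpM2l.
Qed.

Lemma opbound_sum I (r : seq I) m n (M : I -> 'M[C]_(m, n)) (c : I -> R) :
  (forall i, opbound (M i) (c i)) ->
  opbound (\sum_(i <- r) M i) (\sum_(i <- r) c i).
Proof.
move=> Mc; elim/big_rec2: _ => [|i N d _ IH]; first exact: opbound0.
exact: opboundD.
Qed.

Lemma opbound_ge0 m n (M : 'M[C]_(m, n.+1)) c : opbound M c -> 0 <= c.
Proof.
have d0 : delta_mx 0 0 != 0 :> 'cV[C]_n.+1.
  by apply/eqP => /matrixP/(_ 0 0); rewrite !mxE eqxx => /eqP; rewrite oner_eq0.
move/(_ (delta_mx 0 0)) => /(le_trans (vnorm2_ge0 _)).
by rewrite pmulr_lge0// vnorm2_gt0.
Qed.

Lemma opbound_adj m n (M : 'M[C]_(m, n)) c :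
  0 <= c -> opbound M c -> opbound (adjmx M) c.
Proof.
move=> c0 Mc x; have [->|M0] := eqVneq (adjmx M *m x) 0.
  by rewrite vnorm2_0 mulr_ge0 ?vnorm2_ge0.
have n0 : 0 < vnorm2 (adjmx M *m x) by rewrite vnorm2_gt0.
rewrite -(ler_pM2r n0) -expr2 -Re_dotcxx adjmxE.
apply: le_trans (Re_le_normc _) _; apply: le_trans (dotc_le _ _) _.
by rewrite mulrAC [leRHS]mulrC ler_wpM2l ?vnorm2_ge0.
Qed.

Lemma normc_entry n (x : 'cV[C]_n) j : normc (x j 0) <= vnorm2 x.
Proof.
rewrite -(ler_pXn2r (_ : 0 < 2)%N)// ?nnegrE ?normc_ge0 ?vnorm2_ge0//.
by rewrite vnorm2_sqr (bigD1 j)//= lerDl sumr_ge0// => i _; exact: sqr_ge0.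
Qed.

Lemma opbound_exists m n (M : 'M[C]_(m, n)) : exists2 c, 0 <= c & opbound M c.
Proof.
exists (\sum_j vnorm2 (col j M)); first by apply: sumr_ge0 => j _; exact: vnorm2_ge0.
move=> x; have -> : M *m x = \sum_j x j 0 *: col j M.
  apply/colP => i; rewrite mxE summxE; apply: eq_bigr => j _.
  by rewrite !mxE mulrC.
rewrite mulr_suml.
apply: (@le_trans _ _ (\sum_j vnorm2 (x j 0 *: col j M))).
  elim/big_rec2: _ => [|i N d _ IH]; first by rewrite vnorm2_0.
  by apply: le_trans (ler_vnorm2D _ _) _; rewrite lerD2l.
apply: ler_sum => j _; rewrite vnorm2Z mulrC ler_wpM2l ?vnorm2_ge0//.
exact: normc_entry.
Qed.

Lemma opboundX n (M : 'M[C]_n.+1) c k : opbound M c -> opbound (M ^+ k) (c ^+ k).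
Proof.
move=> Mc; have c0 := opbound_ge0 Mc.
elim: k => [|k IH]; first by rewrite !expr0; exact: opbound1.
by rewrite !exprS; exact: opboundM.
Qed.

Lemma mxnorm2_has_ubound m n (M : 'M[C]_(m, n)) :
  has_ubound [set vnorm2 (M *m x) | x in [set x : 'cV[C]_n | vnorm2 x = 1]].
Proof.
have [c c0 Mc] := opbound_exists M; exists c => _ [x x1 <-].
by apply: le_trans (Mc x) _; rewrite x1 mulr1.
Qed.

Lemma opbound_mxnorm2 m n (M : 'M[C]_(m, n)) : opbound M (mxnorm2 M).
Proof.
move=> x; have [->|x0] := eqVneq x 0; first by rewrite mulmx0 !vnorm2_0 mulr0.
have nx : 0 < vnorm2 x by rewrite vnorm2_gt0.
rewrite -ler_pdivrMr//; apply: ub_le_sup; first exact: mxnorm2_has_ubound.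
exists ((vnorm2 x)^-1%:C *: x); first exact: vnorm2_normalize.
by rewrite -scalemxAr vnorm2Z normc_real ger0_norm ?invr_ge0 ?ltW// mulrC.
Qed.

Lemma mxnorm2_ge0 m n (M : 'M[C]_(m, n)) : 0 <= mxnorm2 M.
Proof.
have [[y [x x1 xy]]|/nonemptyPn s0] := pselect ([set vnorm2 (M *m x)
    | x in [set x : 'cV[C]_n | vnorm2 x = 1]] !=set0).
  apply: (@le_trans _ _ y); first by rewrite -xy vnorm2_ge0.
  by apply: ub_le_sup; [exact: mxnorm2_has_ubound | exists x].
by rewrite /mxnorm2 s0 sup0.
Qed.

Lemma mxnorm2_le m n (M : 'M[C]_(m, n)) c : 0 <= c -> opbound M c -> mxnorm2 M <= c.
Proof.
move=> c0 Mc; have [s0|/nonemptyPn s0] := pselect ([set vnorm2 (M *m x)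
    | x in [set x : 'cV[C]_n | vnorm2 x = 1]] !=set0); last first.
  by rewrite /mxnorm2 s0 sup0.
by apply: ge_sup => // _ [x x1 <-]; apply: le_trans (Mc x) _; rewrite x1 mulr1.
Qed.

Lemma opbound_mxsub m n p q (f : 'I_p -> 'I_m) (g : 'I_q -> 'I_n)
    (M : 'M[C]_(m, n)) c :
  injective f -> injective g -> 0 <= c -> opbound M c -> opbound (mxsub f g M) c.
Proof.
(* Selecting distinct coordinates does not increase the norm; a submatrix is M between such a
   selection and the adjoint of another. *)
have sub1 k l (h : 'I_k -> 'I_l) : injective h ->
    opbound (rowsub h (1%:M : 'M[C]_l)) 1.
  move=> hI x; rewrite mul1r -rowsubE.
  rewrite -(ler_pXn2r (_ : 0 < 2)%N)// ?nnegrE ?vnorm2_ge0// !vnorm2_sqr.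
  under eq_bigr do rewrite mxE.
  rewrite -(big_imset (h := h) (A := predT) (fun i => normc (x i 0) ^+ 2))/=;
    last by move=> i j _ _ /hI.
  rewrite [leRHS](bigID (mem [set h i | i in predT]%SET))/= ler_wpDr//.
  by apply: sumr_ge0 => i _; exact: sqr_ge0.
move=> fI gI c0 Mc.
have -> : mxsub f g M = rowsub f 1%:M *m M *m adjmx (rowsub g 1%:M).
  rewrite -rowsubE; apply/matrixP => i j; rewrite !mxE (bigD1 (g j))//= big1.
    by rewrite !mxE eqxx rmorph1 mulr1 addr0.
  by move=> k kj; rewrite !mxE eq_sym (negPf kj) rmorph0 mulr0.
rewrite -[c]mulr1; apply: opboundM => //; last first.
  by apply: opbound_adj => //; exact: sub1.
by rewrite -[c]mul1r; apply: opboundM => //; exact: sub1.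
Qed.

(** A kernel vector of N would contradict coercivity. [det0P] provides row vectors, hence the detour
    through the transpose. *)
Lemma coercive_unitmx n (N : 'M[C]_n) (u : C) d : 0 < d ->
  (forall x, d * vnorm2 x ^+ 2 <= Re (u * dotc x (N *m x))) ->
  N \in unitmx.
Proof.
move=> d0 H; rewrite -unitmx_tr; rewrite unitmxE unitfE; apply/negP => /eqP/eqP.
move=> /det0P[v v0 vN].
have := H v^T; rewrite -[N]trmxK -trmx_mul vN trmx0 dotcE big1; last first.
  by move=> i _; rewrite [X in _ * X]mxE mulr0.
rewrite mulr0 /= pmulr_rle0// le_eqVlt ltNge sqr_ge0 orbF sqrf_eq0 vnorm2_eq0 => /eqP/(congr1 trmx).
by rewrite trmxK trmx0 => /eqP; rewrite (negPf v0).
Qed.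

Lemma coercive_opbound n (N : 'M[C]_n) (u : C) d : 0 < d ->
  (forall x, d * vnorm2 x ^+ 2 <= Re (u * dotc x (N *m x))) ->
  opbound (invmx N) (normc u / d).
Proof.
move=> d0 H x; have Nu := coercive_unitmx d0 H.
have := H (invmx N *m x); rewrite mulKVmx//; set y := invmx N *m x.
have [->|y0] := eqVneq y 0.
  by rewrite vnorm2_0 mulr_ge0 ?vnorm2_ge0// divr_ge0 ?normc_ge0// ltW.
have ny : 0 < vnorm2 y by rewrite vnorm2_gt0.
move=> h; rewrite mulrAC ler_pdivlMr// mulrC -(ler_pM2r ny) -mulrA -expr2.
apply: le_trans h _; apply: le_trans (Re_le_normc _) _.
by rewrite normcM -mulrA ler_wpM2l ?normc_ge0// mulrC dotc_le.
Qed.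

End OperatorBound.

(** * Singular values and approximation by matrices of low rank *)

Section SingularValues.
Variable R : realType.
Local Notation C := R[i].
Local Notation Re := complex.Re.

Lemma mx_ker_col m n (B : 'M[C]_(m, n)) : (\rank B < n)%N ->
  exists2 v : 'cV[C]_n, v != 0 & B *m v = 0.
Proof.
move=> rB; have : kermx B^T != 0.
  by rewrite kermx_eq0 -row_leq_rank mxrank_tr -ltnNge.
case/rowV0Pn => v /sub_kermxP vB v0; exists v^T.
  by apply: contra v0 => /eqP/(congr1 trmx); rewrite trmxK trmx0 => ->.
by rewrite -[B]trmxK -trmx_mul vB trmx0.
Qed.

(** Counting is invariant under sorting, and the first k + 1 entries of the sorted list dominate
    entry k. This makes the space spanned by the top eigenvectors large enough in [singval_le]. *)
Lemma card_sorted_nth n (s : 'I_n -> R) k : (k < n)%N ->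
  (k < #|[set i | (nth 0 (sort >=%O [seq s i | i <- enum 'I_n]) k <= s i)%R]%SET|)%N.
Proof.
move=> kn; set L := sort _ _; set a := nth 0 L k.
have szL : size L = n by rewrite size_sort size_map size_enum_ord.
have -> : #|[set i | a <= s i]%SET| = count (fun x => a <= x) L.
  rewrite cardsE cardE /enum_mem size_filter.
  rewrite (permP (permEl (perm_sort _ _))) count_map enumT.
  by apply: eq_count.
rewrite -[L](cat_take_drop k.+1) count_cat.
have sztk : size (take k.+1 L) = k.+1 by rewrite size_takel// szL.
suff : all (fun x => a <= x) (take k.+1 L).
  by rewrite all_count sztk => /eqP ->; exact: leq_addr.
apply/(all_nthP 0) => i; rewrite sztk => ik; rewrite nth_take//.
apply: (sorted_leq_nth (leT := >=%O) ge_trans ge_refl 0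
  (sort_sorted ge_total _)); rewrite ?inE ?szL//.
by apply: leq_trans ik _.
Qed.

(** The easy half of Eckart-Young. The eigenvectors of M^H M with singular value at least a, the
    entry of index k, span a space of dimension above k, so Y kills some nonzero x in it; there a
    |x| <= |M x| = |(M - Y) x| <= c |x|. *)
Lemma singval_le m n (M Y : 'M[C]_(m, n)) k c : 0 <= c -> (\rank Y <= k)%N ->
  opbound (M - Y) c -> singval M k.+1 <= c.
Proof.
move=> c0 rY MYc; rewrite /singval /=.
(* [singvals] has n entries; past them [nth] returns the default 0. *)
have [nk|kn] := leqP n k.
  by rewrite nth_default// size_sort size_map size_enum_ord.
set H : 'M[C]_n := adjmx M *m M; set d : 'rV[C]_n := spectral_diag H.
have [P PP HE] : exists2 P : 'M[C]_n, P *m adjmx P = 1%:M &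
    H = adjmx P *m diag_mx d *m P.
  have Hn : H \is normalmx by apply/normalmxP; rewrite /H -[_^t*]/(adjmx _) adjmxM adjmxK.
  exists (spectralmx H); first by apply/unitarymxP; exact: spectral_unitarymx.
  by have /orthomx_spectralP := Hn; rewrite invmx_unitary ?spectral_unitarymx.
pose s i := Num.sqrt (Re (d 0 i)).
rewrite -/(singvals M); set a := nth 0 _ k; rewrite leNgt; apply/negP => ca.
set I := [set i | a <= s i]%SET.
have kI : (k < #|I|)%N := card_sorted_nth s kn.
pose E : 'M[C]_(#|I|, n) := rowsub (fun i => enum_val i) 1%:M.
have EE : E *m adjmx E = 1%:M.
  rewrite /E -rowsubE; apply/matrixP => i j; rewrite !mxE.
  by rewrite (inj_eq enum_val_inj) eq_sym; case: eqP => _; rewrite ?rmorph1 ?rmorph0.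
have [v v0 Bv] : exists2 v : 'cV[C]_#|I|, v != 0 & Y *m adjmx P *m adjmx E *m v = 0.
  apply: mx_ker_col; apply: leq_ltn_trans kI; apply: leq_trans rY.
  by rewrite -mulmxA mxrankM_maxl.
have [y yv] : {y : 'cV[C]_n | y = adjmx E *m v} by eexists.
have [x xy] : {x : 'cV[C]_n | x = adjmx P *m y} by eexists.
have yE : y = P *m x by rewrite xy mulmxA PP mul1mx.
have y0 : y != 0.
  apply: contra v0 => /eqP y0.
  by rewrite -[v]mul1mx -EE -mulmxA -yv y0 mulmx0.
have yI i : i \notin I -> y i 0 = 0.
  move=> iI; rewrite yv mxE big1// => j _; rewrite !mxE.
  have /negPf -> : enum_val j != i by apply: contra iI => /eqP <-; exact: enum_valP.
  by rewrite rmorph0 mul0r.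
have nxy : vnorm2 x ^+ 2 = vnorm2 y ^+ 2.
  by rewrite -!Re_dotcxx {1}xy adjmxE -yE.
have Mx : vnorm2 (M *m x) ^+ 2 = \sum_i Re (d 0 i) * normc (y i 0) ^+ 2.
  have -> : vnorm2 (M *m x) ^+ 2 = Re (dotc y (diag_mx d *m y)).
    rewrite -Re_dotcxx; congr Re; transitivity (dotc x (H *m x)).
      by rewrite /H -mulmxA -(adjmxE (adjmx M)) adjmxK.
    by rewrite HE -!mulmxA -yE -(adjmxE (adjmx P)) adjmxK -yE.
  rewrite dotcE Re_sum; apply: eq_bigr => i _.
  rewrite mul_diag_mx mxE mulrCA [(y i 0)^* * _]mulrC mul_conjc.
  by rewrite cReM /= mulr0 subr0.
have : a ^+ 2 * vnorm2 y ^+ 2 <= vnorm2 (M *m x) ^+ 2.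
  rewrite Mx vnorm2_sqr mulr_sumr; apply: ler_sum => i _.
  have [iI|/yI ->] := boolP (i \in I); last by rewrite normc0 expr0n !mulr0.
  rewrite ler_wpM2r ?sqr_ge0//.
  move: iI; rewrite inE /s => asi.
  (* [Num.sqrt] is 0 on negative numbers, whereas this root is at least a > c >= 0. *)
  have d0 : 0 <= Re (d 0 i).
    rewrite leNgt; apply/negP => d0; move: asi; rewrite ltr0_sqrtr// => a0.
    by have := le_lt_trans c0 (lt_le_trans ca a0); rewrite ltxx.
  rewrite -(sqr_sqrtr d0) ler_pXn2r// ?nnegrE ?sqrtr_ge0//.
  exact: le_trans c0 (ltW ca).
have -> : M *m x = (M - Y) *m x.
  by rewrite mulmxBl xy yv !mulmxA -[Y *m _]/(Y *m _) Bv subr0.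
have ny : 0 < vnorm2 y ^+ 2 by rewrite exprn_gt0// vnorm2_gt0.
move=> h; have : a ^+ 2 * vnorm2 y ^+ 2 <= c ^+ 2 * vnorm2 y ^+ 2.
  apply: le_trans h _; rewrite -nxy -exprMn.
  by rewrite ler_pXn2r// ?nnegrE ?mulr_ge0 ?vnorm2_ge0.
rewrite ler_pM2r// ler_pXn2r// ?nnegrE//; last exact: le_trans c0 (ltW ca).
by rewrite leNgt ca.
Qed.

End SingularValues.

(** * Polynomial approximation of functions of a matrix *)

Section PolynomialApproximation.
Variable R : realType.
Local Notation C := R[i].
Local Notation Re := complex.Re.

Lemma exists_expr_lt (r e : R) : 0 <= r -> r < 1 -> 0 < e ->
  exists k, r ^+ k <= e.
Proof.
move=> r0 r1 e0; have r1' : `|r| < 1 by rewrite ger0_norm.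
have /(_ _ e e0) := cvgr0_norm_lt _ (cvg_expr r1').
case=> k _ /(_ k (leqnn k)) /=; rewrite ger0_norm ?exprn_ge0// => h.
by exists k; exact: ltW.
Qed.

(** Homogeneous form of: every w in the numerical range of T satisfies Re (conj u (a - w)) >= d, so
    that range lies in a half plane at a positive distance from a. *)
Definition separated (n : nat) (T : 'M[C]_n) (a u : C) (d : R) : Prop :=
  forall x, d * vnorm2 x ^+ 2 <= Re (u^* * dotc x ((a%:M - T) *m x)).

Lemma separated_unit n (T : 'M[C]_n) a u d : 0 < d -> separated T a u d ->
  a%:M - T \in unitmx.
Proof. by move=> d0; exact: coercive_unitmx. Qed.

Lemma separated_opbound n (T : 'M[C]_n) a u d : 0 < d -> separated T a u d ->
  opbound (invmx (a%:M - T)) (normc u / d).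
Proof. by move=> d0 H; rewrite -normc_conj; exact: (coercive_opbound d0 H). Qed.

(* Geometric series around the center [a - s u], which for large [s] makes the
   half plane look like a disc of radius [< s |u|]. *)
Lemma runge_mx (a u : C) (d r e : R) : 0 < d -> 0 < e -> u != 0 -> 0 <= r ->
  exists p : {poly C}, forall n (T : 'M[C]_n.+1), opbound T r ->
    separated T a u d -> opbound (horner_mx T p - invmx (a%:M - T)) e.
Proof.
move=> d0 e0 u0 r0; set v := normc u; have v0 : 0 < v by rewrite normc_gt0.
pose r' := normc a + r; have r'0 : 0 <= r' by rewrite addr_ge0// normc_ge0.
(* In the expansion of |Y x|^2 below, the first summand makes the quadratic term at most half of the
   gain from the linear term, leaving the factor q; the second makes q nonnegative. *)
pose s := r' ^+ 2 / d + d / v ^+ 2 + 1.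
have v20 : 0 < v ^+ 2 by rewrite exprn_gt0.
have h1 : 0 <= r' ^+ 2 / d by rewrite divr_ge0 ?sqr_ge0// ltW.
have h2 : 0 < d / v ^+ 2 by rewrite divr_gt0.
have s0 : 0 < s by rewrite /s; lra.
pose q := 1 - d / (s * v ^+ 2).
have q1 : q < 1 by rewrite /q ltrBlDr ltrDl divr_gt0// mulr_gt0.
have q0 : 0 <= q.
  rewrite subr_ge0 ler_pdivrMr ?mulr_gt0// mul1r -ler_pdivrMr// /s; lra.
pose th := Num.sqrt q.
have th1 : th < 1 by rewrite -sqrtr1 ltr_sqrt.
have [m thm] : exists m, th ^+ m <= e / (v / d).
  by apply: exists_expr_lt; rewrite ?sqrtr_ge0// ?divr_gt0.
pose w : C := s%:C * u.
have w0 : w != 0 by rewrite mulf_neq0// -normc0P normc_real normr_eq0 gt_eqF.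
pose y : {poly C} := w^-1 *: ('X - (a - w)%:P).
exists (w^-1 *: \sum_(j < m) y ^+ j) => n T Tr Tsep.
set Y := horner_mx T y.
have YE : Y = 1 - w^-1 *: (a%:M - T).
  rewrite /Y /y horner_mxZ rmorphB/= horner_mx_X horner_mx_C.
  have -> : T - (a - w)%:M = w%:M - (a%:M - T) by rewrite raddfB/= !opprB addrCA.
  by rewrite scalerBr -scalemx1 scalerA mulVf// scale1r.
have Yth : opbound Y th.
  move=> x; rewrite -(ler_pXn2r (_ : 0 < 2)%N)// ?nnegrE ?mulr_ge0
    ?vnorm2_ge0 ?sqrtr_ge0// exprMn [th ^+ 2]sqr_sqrtr//.
  have -> : Y *m x = x + - (w^-1 *: ((a%:M - T) *m x)).
    by rewrite YE mulmxBl -scalemxAl mul1mx.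
  rewrite vnorm2D_sqr vnorm2N vnorm2Z dotcNr dotcZr.
  have := Tsep x; set z := dotc x _; set b := vnorm2 (_ *m x) => H.
  have br : b <= r' * vnorm2 x.
    by apply: opboundB => //; rewrite -scalemx1 -[normc a]mulr1;
      apply: opboundZ; exact: opbound1.
  have -> : w^-1 * z = (s * v ^+ 2)^-1%:C * (u^* * z).
    apply: (mulfI w0); rewrite mulVKf//; set k := (s * v ^+ 2)^-1%:C.
    have -> : w * (k * (u^* * z)) = s%:C * (u * u^*) * k * z by rewrite /w; ring.
    by rewrite mul_conjc -!rmorphM/= mulfV ?mul1r// mulf_neq0 ?gt_eqF.
  have -> : Re (- ((s * v ^+ 2)^-1%:C * (u^* * z))) =
     - ((s * v ^+ 2)^-1 * Re (u^* * z)) by rewrite cReN cReM /= mul0r subr0.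
  rewrite normcV /w normcM normc_real gtr0_norm// -/v.
  set t := Re _ in H *; set X := vnorm2 x in H br *.
  have sv : 0 < s * v ^+ 2 by rewrite mulr_gt0.
  have E1 : q * X ^+ 2 = X ^+ 2 - (s * v ^+ 2)^-1 * (d * X ^+ 2).
    by rewrite /q mulrBl mul1r -[d / _ * _]mulrA [d * (_ * _)]mulrCA.
  have b2 : ((s * v)^-1 * b) ^+ 2 <= (s * v ^+ 2)^-1 * (d * X ^+ 2).
    rewrite exprMn exprVn.
    have -> : (s * v) ^+ 2 = (s * v ^+ 2) * s by ring.
    rewrite invfM -mulrA ler_wpM2l ?invr_ge0 ?(ltW sv)//.
    rewrite ler_pdivrMl//.
    have b20 : b ^+ 2 <= r' ^+ 2 * X ^+ 2.
      by rewrite -exprMn ler_pXn2r// ?nnegrE ?mulr_ge0 ?vnorm2_ge0.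
    apply: le_trans b20 _; rewrite [leRHS]mulrA ler_wpM2r ?sqr_ge0//.
    by rewrite -ler_pdivrMr// /s; lra.
  have h3 : (s * v ^+ 2)^-1 * (d * X ^+ 2) <= (s * v ^+ 2)^-1 * t.
    by rewrite ler_wpM2l ?invr_ge0 ?(ltW sv).
  by rewrite E1; move: b2 h3; lra.
have Nu := separated_unit d0 Tsep.
have Ninv := separated_opbound d0 Tsep.
(* Since a - T = w (1 - Y), the sum is a partial geometric series of the inverse, and this is its
   remainder. *)
have -> : horner_mx T (w^-1 *: \sum_(j < m) y ^+ j) - invmx (a%:M - T) =
    - (invmx (a%:M - T) *m Y ^+ m).
  apply: (can_inj (mulKmx Nu)).
  rewrite mulmxBr mulmxN mulmxV// mulKVmx//.
  rewrite horner_mxZ rmorph_sum/=.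
  under eq_bigr do rewrite rmorphXn/= -/Y.
  have -> : a%:M - T = w *: (1 - Y).
    by rewrite YE subKr scalerA mulfV// scale1r.
  rewrite -scalemxAl -scalemxAr scalerA mulfV// scale1r.
  rewrite [_ *m \sum_(i < m) _](_ : _ = 1 - Y ^+ m).
    by rewrite addrAC subrr add0r.
  by apply: oppr_inj; rewrite opprB subrX1 -mulNr opprB.
apply: opboundN; apply: (@opbound_le _ _ _ _ (v / d * th ^+ m)).
  apply: opboundM; rewrite ?divr_ge0 ?ltW//.
  exact: opboundX.
by rewrite mulrC -ler_pdivlMr// divr_gt0.
Qed.

End PolynomialApproximation.

Section PolynomialApproximationAlgebra.
Variable R : realType.
Local Notation C := R[i].
Local Notation Re := complex.Re.

Lemma horner_bounded (p : {poly C}) (r : R) :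
  exists2 B, 0 <= B & forall z, normc z <= r -> normc p.[z] <= B.
Proof.
elim/poly_ind: p => [|p c [B B0 IH]].
  by exists 0 => // z _; rewrite horner0 normc0.
exists (B * `|r| + normc c) => [|z zr]; first by rewrite addr_ge0 ?mulr_ge0 ?normc_ge0.
rewrite !hornerE; apply: le_trans (ler_normcD _ _) _; rewrite lerD2r normcM.
apply: ler_pM; rewrite ?normc_ge0 ?IH//.
exact: le_trans zr (ler_norm _).
Qed.

Lemma horner_lipschitz (p : {poly C}) (r : R) :
  exists2 L, 0 <= L & forall z w, normc z <= r -> normc w <= r ->
    normc (p.[z] - p.[w]) <= L * normc (z - w).
Proof.
elim/poly_ind: p => [|p c [L L0 IH]].
  by exists 0 => // z w _ _; rewrite !horner0 subr0 normc0 mul0r.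
have [B B0 pB] := horner_bounded p r.
exists (L * `|r| + B) => [|z w zr wr]; first by rewrite addr_ge0 ?mulr_ge0.
rewrite !hornerE [_ - _](_ : _ = (p.[z] - p.[w]) * z + p.[w] * (z - w));
  last by ring.
apply: le_trans (ler_normcD _ _) _; rewrite !normcM mulrDl lerD//.
  rewrite mulrAC; apply: ler_pM; rewrite ?normc_ge0 ?IH//.
  exact: le_trans zr (ler_norm _).
by rewrite ler_wpM2r ?normc_ge0 ?pB.
Qed.

Lemma ler_eps (x y c : R) : 0 <= c -> (forall e, 0 < e -> x <= y + e * c) -> x <= y.
Proof.
move=> c0 H; apply/ler_addgt0Pr => e e0.
have c1 : 0 < c + 1 by lra.
have := H (e / (c + 1)) (divr_gt0 e0 c1).
have : e / (c + 1) * c <= e by rewrite -mulrA ler_piMr ?(ltW e0)// mulrC ler_pdivrMr//; lra.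
lra.
Qed.

Lemma horner_mx_scalar1 (z : C) (p : {poly C}) :
  horner_mx (z%:M : 'M[C]_1) p = p.[z]%:M.
Proof.
elim/poly_ind: p => [|p c IH]; first by rewrite rmorph0 horner0 raddf0.
rewrite rmorphD rmorphM/= IH horner_mx_X horner_mx_C !hornerE.
by rewrite -mulmxE -scalar_mxM raddfD.
Qed.

Lemma opbound_scalar1 (c : C) e : opbound (c%:M : 'M[C]_1) e -> normc c <= e.
Proof.
move/(_ 1%:M); rewrite mul_scalar_mx vnorm2Z.
have -> : vnorm2 (1%:M : 'cV[C]_1) = 1.
  by rewrite /vnorm2 big_ord1 mxE normc1 expr1n sqrtr1.
by rewrite !mulr1.
Qed.

Lemma opboundM_scalar n (z : C) : opbound (z%:M : 'M[C]_n) (normc z).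
Proof. by rewrite -scalemx1 -[normc z]mulr1; apply: opboundZ; exact: opbound1. Qed.

(* Read [appr G T phi Phi] as [Phi = phi(T)]: the same polynomials approximate
   [phi] on [G] and [Phi] at [T]. *)
Definition appr (n : nat) (G : set C) (T : 'M[C]_n.+1) (phi : C -> C)
  (Phi : 'M[C]_n.+1) : Prop :=
  forall e : R, 0 < e -> exists p : {poly C},
    (forall z, G z -> normc (p.[z] - phi z) <= e) /\
    opbound (horner_mx T p - Phi) e.

Section Fixed.
Variables (n : nat) (G : set C) (T : 'M[C]_n.+1) (r : R).
Hypothesis Gr : forall z, G z -> normc z <= r.

Lemma appr_poly (p : {poly C}) : appr G T (fun z => p.[z]) (horner_mx T p).
Proof.
move=> e e0; exists p; rewrite subrr; split; last exact/opbound0/ltW.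
by move=> z _; rewrite subrr normc0 ltW.
Qed.

Lemma eq_appr phi psi Phi : (forall z, G z -> phi z = psi z) ->
  appr G T phi Phi -> appr G T psi Phi.
Proof.
by move=> E H e /H[p [pG pT]]; exists p; split=> // z Gz; rewrite -E ?pG.
Qed.

Lemma apprD phi psi Phi Psi : appr G T phi Phi -> appr G T psi Psi ->
  appr G T (fun z => phi z + psi z) (Phi + Psi).
Proof.
move=> H1 H2 e e0; have e20 : 0 < e / 2 by rewrite divr_gt0.
have [p [pG pT]] := H1 _ e20; have [q [qG qT]] := H2 _ e20.
exists (p + q); rewrite [e](splitr e); split=> [z Gz|].
  rewrite hornerD opprD addrACA; apply: le_trans (ler_normcD _ _) _.
  by apply: lerD; [exact: pG | exact: qG].
have -> : horner_mx T (p + q) - (Phi + Psi) =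
    (horner_mx T p - Phi) + (horner_mx T q - Psi).
  by rewrite [horner_mx T (p + q)]rmorphD opprD addrACA.
exact (opboundD pT qT).
Qed.

Lemma appr_bounded phi Phi : appr G T phi Phi ->
  exists2 B, 0 <= B & (forall z, G z -> normc (phi z) <= B) /\ opbound Phi B.
Proof.
move=> /(_ 1 ltr01)[p [pG pT]].
have [B B0 pB] := horner_bounded p r; have [c c0 Tc] := opbound_exists Phi.
exists (B + 1 + c); first by rewrite !addr_ge0.
split=> [z Gz|]; last by apply: opbound_le Tc _; rewrite lerDr addr_ge0.
apply: (@le_trans _ _ (B + 1)); last by rewrite lerDl.
rewrite -[phi z](subKr p.[z]); apply: le_trans (ler_normcB _ _) _.
by apply: lerD; [apply: pB; exact: Gr | exact: pG].
Qed.

Lemma apprM phi psi Phi Psi : appr G T phi Phi -> appr G T psi Psi ->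
  appr G T (fun z => phi z * psi z) (Phi *m Psi).
Proof.
move=> H1 H2 e e0.
have [B1 B10 [phB PhB]] := appr_bounded H1.
have [B2 B20 [psB PsB]] := appr_bounded H2.
(* The minimum with 1 keeps the approximant of [phi] below B1 + 1, so that the error of the product
   is linear in d. *)
pose d := Num.min 1 (e / (B1 + 1 + B2)).
have S0 : 0 < B1 + 1 + B2 by lra.
have d0 : 0 < d by rewrite lt_min ltr01 divr_gt0.
have d1 : d <= 1 by rewrite ge_min lexx.
have dS : (B1 + 1) * d + d * B2 <= e.
  have : d * (B1 + 1 + B2) <= e by rewrite -ler_pdivlMr// ge_min lexx orbT.
  lra.
have [p [pG pT]] := H1 _ d0; have [q [qG qT]] := H2 _ d0.
exists (p * q); split=> [z Gz|].
  rewrite hornerM.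
  have -> : p.[z] * q.[z] - phi z * psi z =
    (phi z + (p.[z] - phi z)) * (q.[z] - psi z) + (p.[z] - phi z) * psi z by ring.
  apply: le_trans (ler_normcD _ _) _; apply: le_trans dS; rewrite !normcM.
  apply: lerD; apply: ler_pM; rewrite ?normc_ge0 ?pG ?qG ?psB//.
  apply: le_trans (ler_normcD _ _) _; apply: lerD; first exact: phB.
  exact: le_trans (pG _ Gz) d1.
rewrite rmorphM/= -mulmxE.
set P := horner_mx T p in pT *; set Q := horner_mx T q in qT *.
have -> : P *m Q - Phi *m Psi = (Phi + (P - Phi)) *m (Q - Psi) + (P - Phi) *m Psi.
  by rewrite [Phi + _]addrC subrK mulmxBr mulmxBl addrA subrK.
apply: opbound_le dS; apply: opboundD.
  apply: opboundM; rewrite ?addr_ge0//.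
  by apply: opboundD => //; exact: opbound_le pT d1.
by apply: opboundM => //; exact: ltW.
Qed.

Lemma appr_const c : appr G T (fun=> c) c%:M.
Proof.
rewrite -(horner_mx_C T); apply: eq_appr (appr_poly _) => z _.
by rewrite hornerC.
Qed.

Lemma apprZ c phi Phi : appr G T phi Phi ->
  appr G T (fun z => c * phi z) (c *: Phi).
Proof. by move=> H; rewrite -mul_scalar_mx; exact: apprM (appr_const c) H. Qed.

Lemma appr_sum I (s : seq I) (phi : I -> C -> C) Phi :
  (forall i, appr G T (phi i) (Phi i)) ->
  appr G T (fun z => \sum_(i <- s) phi i z) (\sum_(i <- s) Phi i).
Proof.
move=> H; elim: s => [|i s IH].
  rewrite big_nil -(rmorph0 (horner_mx T)).
  by apply: eq_appr (appr_poly 0) => z _; rewrite horner0 big_nil.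
rewrite big_cons; apply: eq_appr (apprD (H i) IH) => z _.
by rewrite big_cons.
Qed.

(** [runge_mx] fixes the polynomial before the matrix, so the same one serves T and every point z of
    G, taken as a 1 x 1 matrix. *)
Lemma appr_inv a u d : 0 < d -> u != 0 -> opbound T r ->
  separated T a u d -> (forall z, G z -> d <= Re (u^* * (a - z))) ->
  appr G T (fun z => (a - z)^-1) (invmx (a%:M - T)).
Proof.
move=> d0 u0 Tr Ts Gs e e0.
have r0 : 0 <= r by exact: opbound_ge0 Tr.
have [p H] := runge_mx a d0 e0 u0 r0; exists p; split; last exact: H.
move=> z Gz; apply: opbound_scalar1.
rewrite raddfB/= -horner_mx_scalar1 -invmx_scalar raddfB/=; apply: H.
  exact: (opbound_le (@opboundM_scalar 1 z) (Gr Gz)).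
move=> x; rewrite -raddfB/= mul_scalar_mx dotcZr dotcxx [_^* * _]mulrA cRe_mulr.
by rewrite ler_wpM2r ?sqr_ge0// Gs.
Qed.

End Fixed.

End PolynomialApproximationAlgebra.

(** * The Crouzeix-Palencia constant *)

Section CrouzeixPalencia.
Variable R : realType.
Local Notation C := R[i].

(** Cauchy-Schwarz twice: |F^H x|^2 <= |x| |F F^H x| and |F F^H x|^2 <= |x| |F F^H F F^H x|. *)
Lemma mxnorm2_pow4_le n (F : 'M[C]_n.+1) b : 0 <= b ->
  opbound (F *m adjmx F *m F *m adjmx F) b -> mxnorm2 F ^+ 4 <= b.
Proof.
move=> b0 Fb; pose s := Num.sqrt (Num.sqrt b).
have s0 : 0 <= s by exact: sqrtr_ge0.
have sb : s ^+ 4 = b.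
  by rewrite -[4%N]/(2 * 2)%N exprM !sqr_sqrtr ?sqrtr_ge0.
rewrite -sb ler_pXn2r// ?nnegrE ?mxnorm2_ge0//.
apply: mxnorm2_le => //; rewrite -(adjmxK F); apply: opbound_adj => //.
move=> x; have y1 : vnorm2 (adjmx F *m x) ^+ 2 <=
    vnorm2 x * vnorm2 (F *m adjmx F *m x).
  rewrite -Re_dotcxx adjmxE mulmxA.
  exact: le_trans (Re_le_normc _) (dotc_le _ _).
have y2 : vnorm2 (F *m adjmx F *m x) ^+ 2 <= b * vnorm2 x ^+ 2.
  have sa : adjmx (F *m adjmx F) = F *m adjmx F by rewrite adjmxM adjmxK.
  rewrite -Re_dotcxx -{1}sa adjmxE !mulmxA.
  apply: le_trans (Re_le_normc _) _; apply: le_trans (dotc_le _ _) _.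
  by rewrite mulrC expr2 mulrA ler_wpM2r ?vnorm2_ge0//; exact: Fb.
rewrite -(ler_pXn2r (_ : 0 < 4)%N)// ?nnegrE ?mulr_ge0 ?vnorm2_ge0//.
rewrite exprMn sb -[4%N]/(2 * 2)%N !exprM.
apply: (@le_trans _ _ ((vnorm2 x * vnorm2 (F *m adjmx F *m x)) ^+ 2)).
  rewrite ler_pXn2r; [exact: y1 | by [] | rewrite nnegrE; exact: sqr_ge0 |].
  by rewrite nnegrE mulr_ge0 ?vnorm2_ge0.
rewrite exprMn; apply: le_trans (ler_wpM2l (sqr_ge0 _) y2) _.
by rewrite [leLHS]mulrCA -[_ ^+ 2 * _ ^+ 2]expr2.
Qed.

(* The largest real root of [b^3 = 2 b^2 + b] is [1 + sqrt 2]. *)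
Lemma sup_cubic_le (s K : R) : s ^+ 2 = 2 * s + 1 -> 2 <= s ->
  forall A : set R, (forall b, A b -> 0 <= b) -> has_sup A -> K = sup A ->
  (forall b, A b -> b ^+ 3 <= 2 * b ^+ 2 + K) -> K <= s.
Proof.
move=> s2 s_ge2 A A0 Asup KE AK; rewrite leNgt; apply/negP => sK.
(* Each b in A is at most this average, which is below K if s < K. For b > s it follows from b^3 - 2
   b^2 = b + b (b - s) (b + s - 2) and b (b + s - 2) >= 4. *)
suff : K <= (K + 3 * s) / 4 by lra.
rewrite KE; apply: ge_sup; first by case: Asup.
rewrite -KE => b Ab.
have [bs|sb] := leP b s; first by move: sK bs; lra.
have := AK b Ab.
suff : b + 3 * (b - s) <= b ^+ 3 - 2 * b ^+ 2 by lra.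
have -> : b ^+ 3 - 2 * b ^+ 2 = b + b * (b - s) * (b + s - 2).
  have -> : b * (b - s) * (b + s - 2) = b ^+ 3 - 2 * b ^+ 2 - b * (s ^+ 2 - 2 * s).
    by ring.
  rewrite s2; ring.
rewrite lerD2l mulrAC ler_wpM2r ?subr_ge0 ?(ltW sb)//.
have : 2 * 2 <= b * (b + s - 2) by apply: ler_pM => //; lra.
lra.
Qed.

Section Abstract.
Variables (n : nat) (G : set C) (T : 'M[C]_n.+1).
Definition unit_on (p : {poly C}) (M : R) := forall z, G z -> normc p.[z] <= M.

Hypothesis finite_constant : exists K0, forall f : {poly C},
  unit_on f 1 -> opbound (horner_mx T f) K0.

Hypothesis companion : forall f : {poly C}, unit_on f 1 -> forall e, 0 < e ->
  exists g : {poly C}, unit_on g (1 + e) /\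
    opbound (horner_mx T f + adjmx (horner_mx T g)) (2 + e).

Lemma spectral_constant_unit f : unit_on f 1 ->
  opbound (horner_mx T f) (1 + Num.sqrt 2).
Proof.
pose A := [set mxnorm2 (horner_mx T f) | f in [set f | unit_on f 1]].
have A0 b : A b -> 0 <= b by case=> g _ <-; exact: mxnorm2_ge0.
have Asup : has_sup A.
  split; first by exists (mxnorm2 (horner_mx T 0)), 0 => //= z _; rewrite horner0 normc0 ler01.
  case: finite_constant => K0 HK0; exists K0 => _ [g /HK0 gK <-].
  by apply: mxnorm2_le => //; exact: opbound_ge0 gK.
pose K := sup A.
have fK f0 : unit_on f0 1 -> opbound (horner_mx T f0) K.
  move=> f0u; apply: opbound_le (opbound_mxnorm2 _) _.
  by apply: ub_le_sup; [case: Asup | exists f0].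
have K0 : 0 <= K.
  apply: (@opbound_ge0 _ _ _ (horner_mx T 0)); apply: fK => z _.
  by rewrite horner0 normc0 ler01.
have fMK f0 M : 0 < M -> unit_on f0 M -> opbound (horner_mx T f0) (K * M).
  move=> M0 f0M.
  have -> : f0 = M%:C *: (M^-1%:C *: f0).
    by rewrite scalerA -rmorphM/= mulfV ?gt_eqF// scale1r.
  rewrite horner_mxZ mulrC -[M in M * K](gtr0_norm M0) -normc_real.
  apply: opboundZ; apply: fK => z Gz.
  rewrite hornerZ normcM normc_real gtr0_norm ?invr_gt0//.
  by rewrite ler_pdivrMl// mulr1 f0M.
suff KS : K <= 1 + Num.sqrt 2 by move=> /fK H; exact: opbound_le H KS.
have s22 : Num.sqrt 2 ^+ 2 = 2 :> R by rewrite sqr_sqrtr.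
have s21 : 1 <= Num.sqrt 2 :> R by rewrite -{1}sqrtr1 ler_sqrt// ler1n.
apply: (sup_cubic_le _ _ A0 Asup (erefl K)).
- rewrite sqrrD s22 expr1n mul1r mulr2n; ring.
- lra.
move=> _ [g gu <-]; set b := mxnorm2 _; rewrite -/K.
have b0 : 0 <= b by exact: mxnorm2_ge0.
have bK : b <= K by apply: ub_le_sup; [case: Asup | exists g].
suff : b * b ^+ 3 <= b * (2 * b ^+ 2 + K).
  have [->|bn0] := eqVneq b 0; first by move=> _; rewrite !expr0n /= mulr0 add0r.
  by rewrite ler_pM2l// lt_def bn0.
apply: (@ler_eps _ _ _ (b ^+ 3 + K * b)).
  by rewrite addr_ge0 ?mulr_ge0 ?exprn_ge0.
(* From here g is the given function and h its companion. *)
move=> e e0; have [h [hu hT]] := companion gu e0.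
set F := horner_mx T g in b b0 bK hT *; set H := horner_mx T h in hT.
have Fb : opbound F b by exact: opbound_mxnorm2.
have e1 : 0 < 1 + e by lra.
have FHF : opbound (F *m H *m F) (K * (1 + e)).
  have -> : F *m H *m F = horner_mx T (g * h * g) by rewrite !rmorphM.
  apply: fMK => // z Gz; rewrite !hornerM !normcM.
  rewrite -[1 + e]mulr1 -[1 + e]mul1r.
  by apply: ler_pM; rewrite ?mulr_ge0 ?normc_ge0 ?gu//; apply: ler_pM;
    rewrite ?normc_ge0 ?gu ?hu.
have Fa : opbound (adjmx F) b by exact: opbound_adj.
have Ha : opbound (adjmx F + H) (2 + e).
  by rewrite -[H]adjmxK -adjmxD; apply: opbound_adj; rewrite // addr_ge0 ?ltW.
have /mxnorm2_pow4_le : opbound (F *m adjmx F *m F *m adjmx F)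
    (b * (2 + e) * b * b + K * (1 + e) * b).
  have -> : F *m adjmx F *m F *m adjmx F =
      F *m (adjmx F + H) *m F *m adjmx F - F *m H *m F *m adjmx F.
    by rewrite mulmxDr !mulmxDl addrK.
  apply: opboundB; apply: opboundM => //; rewrite ?mulr_ge0//; try lra.
  by apply: opboundM => //; [rewrite mulr_ge0//; lra | exact: opboundM].
rewrite -/b => /(_ _); rewrite -exprS => H4; apply: le_trans (H4 _) _.
  by rewrite addr_ge0// !mulr_ge0//; lra.
rewrite le_eqVlt; apply/orP; left; apply/eqP; ring.
Qed.

Lemma spectral_constant f M : unit_on f M -> 0 <= M ->
  opbound (horner_mx T f) ((1 + Num.sqrt 2) * M).
Proof.
move=> fM M0 x; apply: (@ler_eps _ _ _ ((1 + Num.sqrt 2) * vnorm2 x)).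
  by rewrite mulr_ge0 ?vnorm2_ge0 ?addr_ge0 ?sqrtr_ge0.
move=> e e0; have Me : 0 < M + e by lra.
have : opbound (horner_mx T ((M + e)^-1%:C *: f)) (1 + Num.sqrt 2).
  apply: spectral_constant_unit => z Gz.
  rewrite hornerZ normcM normc_real gtr0_norm ?invr_gt0//.
  by rewrite ler_pdivrMl// mulr1; apply: le_trans (fM _ Gz) _; lra.
move=> /(_ x); rewrite horner_mxZ -scalemxAl vnorm2Z normc_real.
rewrite gtr0_norm ?invr_gt0// ler_pdivrMl//; lra.
Qed.

Lemma spectral_constant_appr phi Phi M : appr G T phi Phi ->
  (forall z, G z -> normc (phi z) <= M) -> 0 <= M ->
  opbound Phi ((1 + Num.sqrt 2) * M).
Proof.
move=> H phM M0 x; set c := 1 + Num.sqrt 2.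
have c0 : 0 <= c by rewrite addr_ge0 ?sqrtr_ge0.
apply: (@ler_eps _ _ _ ((c + 1) * vnorm2 x)).
  by rewrite mulr_ge0 ?vnorm2_ge0 ?addr_ge0.
move=> e e0; have [p [pG pT]] := H _ e0.
have pM : unit_on p (M + e).
  move=> z Gz; rewrite -(subrK (phi z) p.[z]) addrC.
  by apply: le_trans (ler_normcD _ _) _; apply: lerD; [exact: phM | exact: pG].
have Me : 0 <= M + e by lra.
have := spectral_constant pM Me x; have := pT x; rewrite -/c.
have -> : Phi *m x = horner_mx T p *m x - (horner_mx T p - Phi) *m x.
  by rewrite mulmxBl opprB addrC subrK.
have := ler_vnorm2D (horner_mx T p *m x) (- ((horner_mx T p - Phi) *m x)).
rewrite vnorm2N; move: (vnorm2 _) (vnorm2 _) (vnorm2 _) => u v w; lra.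
Qed.

End Abstract.

End CrouzeixPalencia.

(** * Cauchy's formula on polygons inscribed in the level sets of a gauge *)

Section Gauge.
Variable R : realType.
Local Notation C := R[i].
Local Notation Re := complex.Re.

Definition dotR (u v : C) : R := Re (u^* * v).

(* [gauge_support] is what remains of the supporting lines of the convex set
   [N <= 1] without compactness: they are only attained up to [e]. *)
Record gauge (N : C -> R) (c0 c1 : R) : Prop := Gauge {
  gauge_gt0 : 0 < c0;
  gaugeD : forall v w, N (v + w) <= N v + N w;
  gaugeZ : forall (t : R) v, 0 <= t -> N (t%:C * v) = t * N v;
  gauge_ge : forall v, c0 * normc v <= N v;
  gauge_le : forall v, N v <= c1 * normc v;
  gauge_support : forall v e, 0 < e -> exists2 u,
    forall w, dotR u w <= N w & N v - e <= dotR u v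
}.

(** Homogeneous form of: the numerical range of T lies in the level set N <= mu. *)
Definition below (N : C -> R) (mu : R) (n : nat) (T : 'M[C]_n) : Prop :=
  forall x, N (dotc x (T *m x)) <= mu * vnorm2 x ^+ 2.

Variables (N : C -> R) (c0 c1 : R).
Hypothesis gN : gauge N c0 c1.

Lemma gauge_ge0 v : 0 <= N v.
Proof.
by apply: le_trans (gauge_ge gN v); rewrite mulr_ge0 ?normc_ge0// ltW// (gauge_gt0 gN).
Qed.

Lemma gauge_c01 : c0 <= c1.
Proof.
by have := le_trans (gauge_ge gN 1) (gauge_le gN 1); rewrite normc1 !mulr1.
Qed.

Lemma gauge_c1 : 0 < c1.
Proof. exact: lt_le_trans (gauge_gt0 gN) gauge_c01. Qed.

Lemma gauge0 : N 0 = 0.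
Proof. by have := gaugeZ gN 0 (lexx 0); rewrite !mul0r. Qed.

Lemma normc_le_gauge v : normc v <= N v / c0.
Proof. by rewrite ler_pdivlMr ?(gauge_gt0 gN)// mulrC (gauge_ge gN). Qed.

Lemma support_normc u : (forall w, dotR u w <= N w) -> normc u <= c1.
Proof.
move=> H; have [->|u0] := eqVneq u 0; first by rewrite normc0 ltW ?gauge_c1.
have := le_trans (H u) (gauge_le gN u); rewrite /dotR mulrC mul_conjc /=.
by rewrite expr2 ler_pM2r// normc_gt0.
Qed.

Lemma dotRBr u v w : dotR u (v - w) = dotR u v - dotR u w.
Proof. by rewrite /dotR mulrBr cReB. Qed.

Lemma dotR_le u v : dotR u v <= normc u * normc v.
Proof. by rewrite -normc_conj -normcM; exact: Re_le_normc. Qed.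

Lemma below_separated n (T : 'M[C]_n) mu z : mu < N z -> 0 <= mu ->
  below N mu T -> exists2 u, u != 0 /\ normc u <= c1 &
  separated T z u ((N z - mu) / 2) /\
  (forall w, dotR u w <= N w) /\ (N z + mu) / 2 <= dotR u z.
Proof.
move=> muz mu0 Tmu.
(* Half of the gap pays for the inexact supporting line; the other half remains as separation. *)
have d0 : 0 < (N z - mu) / 2 by lra.
have [u uN uz] := gauge_support gN z d0.
exists u; [split; [|exact: support_normc]|split; last (split=> //; lra)].
  apply/eqP => u0; move: uz; rewrite /dotR u0 rmorph0 mul0r /=.
  lra.
move=> x; rewrite mulmxBl mul_scalar_mx dotcDr dotcNr dotcZr dotcxx.
rewrite mulrBr [_^* * (_ * _)]mulrA cReB cRe_mulr -/(dotR u z).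
have := le_trans (uN _) (Tmu x); rewrite /dotR => h.
have : (N z - (N z - mu) / 2) * vnorm2 x ^+ 2 <= dotR u z * vnorm2 x ^+ 2.
  by rewrite ler_wpM2r ?sqr_ge0.
move: h; set X := vnorm2 x ^+ 2; set Y := Re _; set W := dotR u z; lra.
Qed.

Lemma below_unit n (T : 'M[C]_n) mu z : mu < N z -> 0 <= mu ->
  below N mu T -> z%:M - T \in unitmx.
Proof.
move=> muz mu0 /(below_separated muz mu0)[u _ [sep _]].
by apply: separated_unit sep; lra.
Qed.

Lemma below_opbound n (T : 'M[C]_n) mu z : mu < N z -> 0 <= mu ->
  below N mu T -> opbound (invmx (z%:M - T)) (2 * c1 / (N z - mu)).
Proof.
move=> muz mu0 /(below_separated muz mu0)[u [_ uc] [sep _]].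
have d0 : 0 < (N z - mu) / 2 by lra.
apply: opbound_le (separated_opbound d0 sep) _.
have -> : 2 * c1 / (N z - mu) = c1 / ((N z - mu) / 2).
  by rewrite invf_div mulrA [2 * c1]mulrC.
by rewrite ler_wpM2r// invr_ge0 ltW.
Qed.

(** Level sets are star-shaped about 0, so the homotopy t T from 0 to T stays inside the polygon. *)
Lemma belowZ n (T : 'M[C]_n) mu (t : R) : 0 <= mu -> 0 <= t <= 1 -> below N mu T ->
  below N mu (t%:C *: T).
Proof.
move=> mu0 /andP[t0 t1] Tmu x; rewrite -scalemxAl dotcZr (gaugeZ gN)//.
apply: le_trans (ler_wpM2l t0 (Tmu x)) _.
by rewrite ler_piMl// mulr_ge0// sqr_ge0.
Qed.

Lemma below_scalar n z mu : N z <= mu -> below N mu (z%:M : 'M[C]_n).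
Proof.
move=> zmu x; rewrite mul_scalar_mx dotcZr dotcxx mulrC (gaugeZ gN) ?sqr_ge0//.
by rewrite mulrC ler_wpM2r ?sqr_ge0.
Qed.

End Gauge.

Section Loop.
Variable R : realType.
Local Notation C := R[i].

Lemma horner_taylor1 (p : {poly C}) (r : R) :
  exists2 B, 0 <= B & forall z w, normc z <= r -> normc w <= r ->
    normc (p.[w] - p.[z] - p^`().[z] * (w - z)) <= B * normc (w - z) ^+ 2.
Proof.
elim/poly_ind: p => [|p c [B B0 IH]].
  exists 0 => // z w _ _.
  by rewrite deriv0 !horner0 mul0r !subr0 normc0 mul0r.
have [D D0 pD] := horner_bounded p^`() r.
exists (B * `|r| + D) => [|z w zr wr]; first by rewrite addr_ge0 ?mulr_ge0.
have -> : (p * 'X + c%:P)^`().[z] = p^`().[z] * z + p.[z].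
  by rewrite derivD derivM derivX derivC !hornerE.
rewrite !hornerMXaddC.
rewrite [X in normc X](_ : _ = (p.[w] - p.[z] - p^`().[z] * (w - z)) * w +
  p^`().[z] * (w - z) ^+ 2); last by ring.
apply: le_trans (ler_normcD _ _) _. rewrite -normcX !normcM mulrDl lerD//.
  rewrite mulrAC; apply: ler_pM; rewrite ?normc_ge0 ?IH//.
  exact: le_trans wr (ler_norm _).
by rewrite ler_wpM2r ?mulr_ge0 ?normc_ge0 ?pD.
Qed.

Lemma poly_primitive (p : {poly C}) : exists P : {poly C}, P^`() = p.
Proof.
exists (\poly_(i < (size p).+1) (p`_i.-1 / i%:R)).
apply/polyP => i; rewrite coef_deriv coef_poly ltnS /=.
have [ip|pi] := ltnP i (size p); last by rewrite mul0rn nth_default.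
by rewrite -[LHS]mulr_natr mulfVK// pnatr_eq0.
Qed.

Definition twopii : C := (2 * pi)%:C * 'i%C.

(* The winding number of the polygon is a Riemann sum, so it is known only up to
   the mesh. *)
Record loop (N : C -> R) (la D : R) (m : nat) (z : nat -> C) : Prop := Loop {
  loop_m : (0 < m)%N;
  loop_N : forall k, N (z k) = la;
  loop_closed : z m = z 0%N;
  loop_mesh : forall k, normc (z k.+1 - z k) <= D / m%:R;
  loop_winding :
    normc (\sum_(k < m) (z k.+1 - z k) / z k - twopii) <= D / m%:R
}.

Lemma loop_D N la D m z : loop N la D m z -> 0 <= D.
Proof.
move=> L; have := le_trans (normc_ge0 _) (loop_mesh L 0).
by rewrite pmulr_lge0// invr_gt0 ltr0n (loop_m L).
Qed.

Lemma loop_sum N la D m z (V : zmodType) (F : nat -> V) : loop N la D m z ->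
  F m = F 0%N -> \sum_(k < m) (F k.+1 - F k) = 0.
Proof.
move=> L Fm; rewrite -(big_mkord xpredT (fun k => F k.+1 - F k)).
by rewrite telescope_sumr// Fm subrr.
Qed.

Lemma sum_const_div (m : nat) (c : R) : (0 < m)%N -> \sum_(k < m) c / m%:R = c.
Proof.
move=> m0; rewrite sumr_const card_ord -[LHS]mulr_natr mulfVK//.
by rewrite pnatr_eq0 -lt0n.
Qed.

(** A primitive of p telescopes to 0 around the loop; each of the m edges contributes a Taylor error
    of order 1 / m^2. *)
Lemma loop_poly N c0 c1 la D (p : {poly C}) : gauge N c0 c1 ->
  exists2 B, 0 <= B & forall m z, loop N la D m z ->
    normc (\sum_(k < m) (z k.+1 - z k) * p.[z k]) <= B / m%:R.
Proof.
move=> gN; have [P Pp] := poly_primitive p.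
have [B B0 HB] := horner_taylor1 P (la / c0).
exists (B * D ^+ 2) => [|m z L]; first by rewrite mulr_ge0 ?sqr_ge0.
have zr k : normc (z k) <= la / c0.
  by rewrite -(loop_N L k); exact: normc_le_gauge gN _.
have tel := loop_sum (F := fun k => P.[z k]) L (congr1 _ (loop_closed L)).
have -> : \sum_(k < m) (z k.+1 - z k) * p.[z k] =
    \sum_(k < m) (- (P.[z k.+1] - P.[z k] - P^`().[z k] * (z k.+1 - z k))).
  rewrite sumrN sumrB tel sub0r opprK Pp.
  by apply: eq_bigr => k _; rewrite mulrC.
apply: le_trans (ler_normc_sum _ _ _) _.
have m0 : 0 < m%:R :> R by rewrite ltr0n (loop_m L).
have -> : B * D ^+ 2 / m%:R = \sum_(k < m) B * (D / m%:R) ^+ 2.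
  rewrite sumr_const card_ord -[RHS]mulr_natr; field.
  by rewrite gt_eqF.
apply: ler_sum => k _; rewrite normc_opp.
apply: le_trans (HB _ _ (zr _) (zr _)) _; rewrite ler_wpM2l//.
rewrite ler_pXn2r// ?nnegrE ?normc_ge0 ?(loop_mesh L)//.
by rewrite divr_ge0 ?(loop_D L)// ltW.
Qed.

Lemma invr_sub (A : unitRingType) (a b : A) : a \is a GRing.unit ->
  b \is a GRing.unit -> a^-1 - b^-1 = a^-1 * (b - a) * b^-1.
Proof. by move=> ua ub; rewrite mulrBr mulrBl mulVr// mulrK// mul1r. Qed.

Section Resolvent.
Variables (N : C -> R) (c0 c1 : R).
Hypothesis gN : gauge N c0 c1.
Variables (la mu D r : R).
Hypotheses (mu0 : 0 <= mu) (mula : mu < la).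

Let K := 2 * c1 / (la - mu).

Definition rsv n (T : 'M[C]_n.+1) (z : C) : 'M[C]_n.+1 := (z%:M - T)^-1.

Lemma res_bound_ge0 : 0 <= K.
Proof.
by rewrite divr_ge0 ?mulr_ge0 ?subr_ge0 ?(ltW mula)//; exact/ltW/(gauge_c1 gN).
Qed.

Section OneLoop.
Variables (m : nat) (z : nat -> C) (n : nat).
Hypothesis L : loop N la D m z.
Implicit Types T : 'M[C]_n.+1.

Lemma res_unit T k : below N mu T -> (z k)%:M - T \is a GRing.unit.
Proof. by apply: (below_unit gN); rewrite ?(loop_N L). Qed.

Lemma res_opbound T k : below N mu T -> opbound (rsv T (z k)) K.
Proof.
by move=> Tmu; rewrite /K -(loop_N L k); apply: (below_opbound gN) => //;
  rewrite (loop_N L).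
Qed.

Lemma res_sub T k : below N mu T ->
  rsv T (z k.+1) - rsv T (z k) =
  - ((z k.+1 - z k) *: (rsv T (z k.+1) * rsv T (z k))).
Proof.
move=> Tmu; rewrite /rsv (invr_sub (res_unit k.+1 Tmu) (res_unit k Tmu)).
have -> : (z k)%:M - T - ((z k.+1)%:M - T) = (- (z k.+1 - z k)) *: 1.
  by rewrite opprB addrA subrK -raddfB/= opprB -scalemx1.
by rewrite -scalerAr mulr1 -scalerAl scaleNr.
Qed.

Lemma loop_sum_le (F : nat -> 'M[C]_n.+1) (c : R) :
  (forall k, opbound (F k) c) ->
  opbound (\sum_(k < m) (z k.+1 - z k) *: F k) (D * c).
Proof.
move=> Fc; have c00 := opbound_ge0 (Fc 0%N).
rewrite -(sum_const_div (D * c) (loop_m L)).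
apply: opbound_sum => k; apply: opbound_le (opboundZ _ (Fc k)) _.
by rewrite mulrAC ler_wpM2r ?(loop_mesh L).
Qed.

Let S T (t : R) := \sum_(k < m) (z k.+1 - z k) *: rsv (t%:C *: T) (z k).

(* The derivative of [S T] in [t] is a sum of increments of the resolvent along
   the closed polygon, up to the mesh. *)
Lemma homotopy_step T (s t : R) : below N mu T -> opbound T r ->
  0 <= s <= 1 -> 0 <= t <= 1 ->
  opbound (S T t - S T s)
    (`|t - s| * (D * ((`|t - s| * (K * r * K) + D / m%:R * (K * K)) * (r * K)))).
Proof.
move=> Tmu Tr s01 t01.
have K0 := res_bound_ge0; have r0 := opbound_ge0 Tr.
have Ts := belowZ gN mu0 s01 Tmu; have Tt := belowZ gN mu0 t01 Tmu.
set A := s%:C *: T in Ts *; set B := t%:C *: T in Tt *.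
have diff k : rsv B (z k) - rsv A (z k) =
    (t - s)%:C *: (rsv B (z k) * (T * rsv A (z k))).
  rewrite /rsv (invr_sub (res_unit k Tt) (res_unit k Ts)).
  have -> : (z k)%:M - A - ((z k)%:M - B) = (t - s)%:C *: T.
    by rewrite opprB addrCA addrAC subrr add0r rmorphB/= scalerBl.
  by rewrite -scalerAr -scalerAl mulrA.
have comm k : T * rsv A (z k) = rsv A (z k) * T.
  apply: commrV; apply: commrB; last first.
    by rewrite /A /GRing.comm -scalerAr -scalerAl.
  by rewrite /GRing.comm -!mulmxE scalar_mxC.
(* By the resolvent identity and since T commutes with the resolvents of s T, this is minus the
   telescoping sum of the resolvents, times T. *)
pose U := \sum_(k < m) (z k.+1 - z k) *: (rsv A (z k.+1) * (T * rsv A (z k))).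
have tel : U = 0.
  have : \sum_(k < m) (rsv A (z k.+1) - rsv A (z k)) = 0.
    by apply: (loop_sum (F := fun k => rsv A (z k)) L); rewrite (loop_closed L).
  under eq_bigr do rewrite res_sub//; rewrite sumrN => /eqP; rewrite oppr_eq0.
  move=> /eqP/(congr1 (fun X => X * T)); rewrite mul0r mulr_suml => E; rewrite -[RHS]E.
  by apply: eq_bigr => k _; rewrite comm -scalerAl !mulrA.
have -> : S T t - S T s = (t - s)%:C *: \sum_(k < m) (z k.+1 - z k) *:
    ((rsv B (z k) - rsv A (z k.+1)) * (T * rsv A (z k))).
  have -> : \sum_(k < m) (z k.+1 - z k) *:
      ((rsv B (z k) - rsv A (z k.+1)) * (T * rsv A (z k))) =
      \sum_(k < m) (z k.+1 - z k) *: (rsv B (z k) * (T * rsv A (z k))).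
    apply: (@etrans _ _ (\sum_(k < m) (z k.+1 - z k) *:
      (rsv B (z k) * (T * rsv A (z k))) - U)); last by rewrite tel subr0.
    by rewrite -sumrB; apply: eq_bigr => k _; rewrite mulrBl scalerBr.
  rewrite scaler_sumr; apply: (@etrans _ _ (\sum_(k < m)
    ((z k.+1 - z k) *: rsv B (z k) - (z k.+1 - z k) *: rsv A (z k)))).
    exact/esym/sumrB.
  apply: eq_bigr => k _.
  by rewrite -scalerBr diff !scalerA mulrC.
rewrite -normc_real; apply: opboundZ.
apply: (loop_sum_le (F := fun k =>
  (rsv B (z k) - rsv A (z k.+1)) * (T * rsv A (z k)))) => k.
have TA : opbound (T * rsv A (z k)) (r * K).
  by apply: opboundM => //; exact: res_opbound.
apply: opboundM => //.
  apply: addr_ge0.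
    by apply: mulr_ge0; [exact: normc_ge0 | do 2 apply: mulr_ge0 => //].
  by apply: mulr_ge0; [apply: divr_ge0 => //; exact: loop_D L | apply: mulr_ge0].
have -> : rsv B (z k) - rsv A (z k.+1) = (rsv B (z k) - rsv A (z k)) -
    (rsv A (z k.+1) - rsv A (z k)) by rewrite opprB addrA subrK.
apply: opboundB.
  rewrite diff; apply: opboundZ.
  rewrite -mulrA; apply: opboundM => //; exact: res_opbound.
rewrite res_sub//; apply: opboundN.
apply: opbound_le (opboundZ _ _) _; last first.
  by apply: ler_wpM2r (loop_mesh L k); rewrite mulr_ge0.
by apply: opboundM => //; exact: res_opbound.
Qed.

(** At t = 0 the sum for t T is the scalar winding sum. From there T is reached in m steps of length
    1 / m, each costing order 1 / m^2 by [homotopy_step]. *)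
Lemma loop_resolvent T : below N mu T -> opbound T r ->
  opbound (\sum_(k < m) (z k.+1 - z k) *: rsv T (z k) - twopii%:M)
    ((D * ((K * r * K + D * (K * K)) * (r * K)) + D) / m%:R).
Proof.
move=> Tmu Tr; pose tt (k : nat) : R := k%:R / m%:R.
have m0 : 0 < m%:R :> R by rewrite ltr0n (loop_m L).
have K0 := res_bound_ge0; have r0 := opbound_ge0 Tr.
have tm : tt m = 1 by rewrite /tt divff ?gt_eqF.
have t0 : tt 0%N = 0 by rewrite /tt mul0r.
have t01 k : (k <= m)%N -> 0 <= tt k <= 1.
  move=> km; rewrite /tt divr_ge0//= ler_pdivrMr// mul1r ler_nat//.
have -> : \sum_(k < m) (z k.+1 - z k) *: rsv T (z k) = S T 1.
  by apply: eq_bigr => k _; rewrite scale1r.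
have S0 : S T 0 = (\sum_(k < m) (z k.+1 - z k) / z k)%:M.
  rewrite raddf_sum/=; apply: eq_bigr => k _.
  by rewrite /rsv scale0r subr0 -[_^-1]/(invmx _) invmx_scalar scale_scalar_mx.
have -> : S T 1 - twopii%:M = \sum_(j < m) (S T (tt j.+1) - S T (tt j)) +
    (S T 0 - twopii%:M).
  rewrite -(big_mkord xpredT (fun j => S T (tt j.+1) - S T (tt j))).
  rewrite (telescope_sumr (fun j => S T (tt j)))// tm t0.
  by rewrite addrA subrK.
rewrite mulrDl; apply: opboundD; last first.
  rewrite S0 -raddfB/=.
  exact: (opbound_le (@opboundM_scalar _ n.+1 _) (loop_winding L)).
have -> : D * ((K * r * K + D * (K * K)) * (r * K)) / m%:R = \sum_(j < m)
  (m%:R^-1 * (D * ((m%:R^-1 * (K * r * K) + D / m%:R * (K * K)) * (r * K)))).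
  rewrite sumr_const card_ord -[RHS]mulr_natr; field.
  by rewrite gt_eqF.
have tS j : `|tt j.+1 - tt j| = m%:R^-1.
  by rewrite /tt -mulrBl -natr1 addrAC subrr add0r mul1r ger0_norm// invr_ge0.
elim/big_ind2: _ => [|M1 b1 M2 b2|j _].
- exact: opbound0.
- exact: opboundD.
- have := homotopy_step Tmu Tr (t01 _ (ltnW (ltn_ord j))) (t01 _ (ltn_ord j)).
  by rewrite tS.
Qed.

End OneLoop.
End Resolvent.
End Loop.

Section Cauchy.
Variable R : realType.
Local Notation C := R[i].
Variables (N : C -> R) (c0 c1 : R).
Hypothesis gN : gauge N c0 c1.
Variables (la mu D r : R).
Hypotheses (mu0 : 0 <= mu) (mula : mu < la).

(** Induction on f through z (z - T)^-1 = 1 + (z - T)^-1 T: the sum for f X + c is the sum for f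
    times T, plus the scalar sum of [loop_poly], plus c times the sum of [loop_resolvent]. *)
Lemma loop_cauchy (f : {poly C}) : exists2 B, 0 <= B &
  forall m z n (T : 'M[C]_n.+1), loop N la D m z -> below N mu T -> opbound T r ->
    opbound (\sum_(k < m) (z k.+1 - z k) *: (f.[z k] *: rsv T (z k)) -
             twopii R *: horner_mx T f) (B / m%:R).
Proof.
elim/poly_ind: f => [|f c [B B0 IH]].
  exists 0 => // m z n T _ _ _; rewrite rmorph0 scaler0 subr0 mul0r.
  rewrite big1; first exact: opbound0.
  by move=> k _; rewrite horner0 scale0r scaler0.
have [B1 B10 HB1] := loop_poly la D f gN.
pose K := 2 * c1 / (la - mu).
have K0 : 0 <= K by exact: (res_bound_ge0 gN mula).
pose B2 := D * ((K * r * K + D * (K * K)) * (r * K)) + D.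
(* A negative D admits no loop and a negative r no T, so these cases are vacuous; they are split off
   to make B nonnegative. *)
have [D0|Dlt0] := leP 0 D; last first.
  by exists 0 => // m z n T /loop_D; rewrite leNgt Dlt0.
have [r0|rlt0] := leP 0 r; last first.
  by exists 0 => // m z n T _ _ /opbound_ge0; rewrite leNgt rlt0.
have B20 : 0 <= B2.
  rewrite /B2; move: K K0 {B2} => k k0.
  by rewrite addr_ge0// mulr_ge0// mulr_ge0 ?addr_ge0 ?mulr_ge0.
exists (B * r + B1 + normc c * B2) => [|m z n T L Tmu Tr].
  by rewrite !addr_ge0 ?mulr_ge0 ?normc_ge0.
have rE k : z k *: rsv T (z k) = 1 + rsv T (z k) * T.
  have u := res_unit gN mu0 mula L k Tmu.
  apply: (mulIr u); rewrite /rsv mulrDl mul1r -scalerAl mulVr//.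
  have -> : (z k)%:M - T = z k *: 1 - T by rewrite scalemx1.
  have com : T * (z k *: 1 - T) = (z k *: 1 - T) * T.
    by rewrite mulrBr mulrBl -scalerAr -scalerAl mulr1 mul1r.
  have u' : z k *: 1 - T \is a GRing.unit by rewrite scalemx1.
  by rewrite -mulrA com mulrA mulVr// mul1r subrK.
have -> : \sum_(k < m) (z k.+1 - z k) *: ((f * 'X + c%:P).[z k] *: rsv T (z k)) -
    twopii R *: horner_mx T (f * 'X + c%:P) =
  (\sum_(k < m) (z k.+1 - z k) *: (f.[z k] *: rsv T (z k)) -
     twopii R *: horner_mx T f) * T +
  (\sum_(k < m) (z k.+1 - z k) * f.[z k])%:M +
  c *: (\sum_(k < m) (z k.+1 - z k) *: rsv T (z k) - (twopii R)%:M).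
  have -> : \sum_(k < m) (z k.+1 - z k) *: ((f * 'X + c%:P).[z k] *: rsv T (z k)) =
      (\sum_(k < m) (z k.+1 - z k) *: (f.[z k] *: rsv T (z k))) * T +
      (\sum_(k < m) (z k.+1 - z k) * f.[z k])%:M +
      c *: \sum_(k < m) (z k.+1 - z k) *: rsv T (z k).
    rewrite raddf_sum/= mulr_suml scaler_sumr -!big_split/=.
    apply: eq_bigr => k _; rewrite hornerMXaddC scalerDl -scalerA rE !scalerDr.
    rewrite [X in X + _]addrC; congr (_ + _ + _).
    - by rewrite -!scalerAl.
    - by rewrite -scalemx1 scalerA.
    - by rewrite !scalerA mulrC.
  rewrite rmorphD rmorphM/= horner_mx_X horner_mx_C scalerDr opprD addrACA.
  congr (_ + _); last by rewrite scalerBr !scale_scalar_mx mulrC.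
  by rewrite addrAC mulrBl scalerAl.
rewrite 2![_ / m%:R]mulrDl; apply: opboundD; first apply: opboundD.
- have -> : B * r / m%:R = B / m%:R * r by rewrite mulrAC.
  by apply: opboundM; [rewrite divr_ge0 | exact: IH | ].
- exact: (opbound_le (@opboundM_scalar _ n.+1 _) (HB1 _ _ L)).
- have -> : normc c * B2 / m%:R = normc c * (B2 / m%:R) by rewrite mulrA.
  apply: opboundZ.
  exact: (loop_resolvent gN mu0 mula L Tmu Tr).
Qed.

End Cauchy.

(** * Chords and arcs of the unit circle *)

Section Polygon.
Variable R : realType.
Local Notation C := R[i].

Definition cis (t : R) : C := cos t +i* sin t.

Lemma normc_cis t : normc (cis t) = 1.
Proof. by rewrite /= cos2Dsin2 sqrtr1. Qed.

Lemma cisD s t : cis (s + t) = cis s * cis t.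
Proof.
apply: eq_complexP; first by rewrite cReM /= cosD.
by rewrite cImM /= sinD addrC.
Qed.

Lemma cis0 : cis 0 = 1.
Proof. by rewrite /cis cos0 sin0. Qed.

Lemma mean_value (f df : R -> R) (a b : R) : a < b ->
  (forall x : R, is_derive x (1 : R) f (df x)) ->
  exists2 c, a < c < b & f b - f a = df c * (b - a).
Proof.
move=> ab fdf; have fd (x : R) : derivable f x (1 : R) by case: (fdf x).
have [c] := MVT ab (fun x _ => fdf x) (derivable_within_continuous (fun x _ => fd x)).
by rewrite in_itv/= => cab E; exists c.
Qed.

Lemma sin_abs_le (x : R) : `|sin x| <= `|x|.
Proof.
wlog x0 : x / 0 < x => [H|].
  have [|x0|<-] := ltgtP 0 x; first exact: H.
    by rewrite -normrN -sinN -[leRHS]normrN H// oppr_gt0.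
  by rewrite sin0 normr0.
have [c _] := mean_value x0 (@is_derive_sin R).
rewrite sin0 !subr0 => ->; rewrite normrM ler_piMl//.
exact: cos_max.
Qed.

Lemma cos_sub1 (x : R) : cos x - 1 = - 2 * sin (x / 2) ^+ 2.
Proof.
have {1}-> : x = (x / 2) *+ 2 by rewrite -[RHS]mulr_natr mulfVK.
rewrite cos_mulr2n cos2sin2 -[_ *+ 2]mulr_natr; ring.
Qed.

Lemma cos_sub1_le (x : R) : `|cos x - 1| <= x ^+ 2 / 2.
Proof.
have : sin (x / 2) ^+ 2 <= (x / 2) ^+ 2.
  rewrite -[leLHS]real_normK ?num_real// -[leRHS]real_normK ?num_real//.
  by rewrite ler_pXn2r// ?nnegrE// sin_abs_le.
have := sqr_ge0 (sin (x / 2)); rewrite cos_sub1 expr_div_n ler_norml.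
move: (sin _ ^+ 2) => s s0 sx; have := sqr_ge0 x; lra.
Qed.

Lemma normc_cisB s t : normc (cis s - cis t) <= `|s - t|.
Proof.
rewrite -(ler_pXn2r (_ : 0 < 2)%N)// ?nnegrE ?normc_ge0// normc_sqr cReB cImB /=.
have -> : (cos s - cos t) ^+ 2 + (sin s - sin t) ^+ 2 = - 2 * (cos (s - t) - 1).
  by rewrite cosB; have := cos2Dsin2 s; have := cos2Dsin2 t; nra.
have := cos_sub1_le (s - t); rewrite ler_norml => /andP[h _].
rewrite real_normK ?num_real//; lra.
Qed.

Lemma cis_taylor t : normc (cis t - 1 - t%:C * 'i%C) <= 2 * t ^+ 2.
Proof.
have sint : `|sin t - t| <= t ^+ 2.
  wlog t0 : t / 0 < t => [H|].
    have [|t0|<-] := ltgtP 0 t; first exact: H.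
      have := H (- t); rewrite oppr_gt0 => /(_ t0).
      by rewrite sinN -opprD normrN sqrrN.
    by rewrite sin0 subr0 normr0 expr0n.
  have df (c : R) : is_derive c (1 : R) (fun x => sin x - x) (cos c - 1) by exact: is_deriveB.
  have [c /andP[c0 ct]] := mean_value t0 df.
  rewrite sin0 !subr0 => ->; rewrite normrM expr2 [`|t|]gtr0_norm//.
  rewrite ler_pM2r//.
  have : `|cos c - 1| <= c.
    have := normc_cisB c 0; rewrite cis0 subr0 gtr0_norm//.
    by apply: le_trans; have := ler_normRe (cis c - 1); rewrite cReB.
  by move=> /le_trans; apply; exact: ltW.
have := cos_sub1_le t => cost.
apply: (@le_trans _ _ (normc ((cos t - 1)%:C) + normc ((sin t - t)%:C * 'i%C))).
  apply: le_trans _ (ler_normcD _ _); rewrite le_eqVlt; apply/orP; left.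
  apply/eqP; congr normc; apply: eq_complexP;
    rewrite ?cReD ?cImD ?cReN ?cImN ?cRe_mull ?cIm_mull /=; ring.
rewrite normcM normc_real normc_real.
have -> : normc 'i%C = 1 :> R by rewrite /= expr0n /= add0r expr1n sqrtr1.
have := sqr_ge0 t; lra.
Qed.

End Polygon.

(** * Equiangular polygons on the level sets of a gauge *)

Section GaugePolygon.
Variable R : realType.
Local Notation C := R[i].

(** Both bounds are ln x <= x - 1, at a / b and at b / a. Replacing a / b - 1 by a difference of
    logarithms costs a second order term and makes sums telescope. *)
Lemma ln_ratio_bounds (a b : R) : 0 < a -> 0 < b ->
  0 <= a / b - 1 - (ln a - ln b) <= (a / b - 1) ^+ 2 * (b / a).
Proof.
move=> a0 b0.
have lnq (x y : R) : 0 < x -> 0 < y -> ln x - ln y <= x / y - 1.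
  move=> x0 y0; rewrite -ln_div ?posrE//.
  have -> : x / y = 1 + (x / y - 1) by rewrite addrC subrK.
  rewrite [leRHS](_ : _ = x / y - 1); last by ring.
  by apply: le_ln1Dx; rewrite ltrBrDr addNr divr_gt0.
rewrite subr_ge0 lnq//=.
have := lnq b a b0 a0.
have -> : (a / b - 1) ^+ 2 * (b / a) = a / b - 1 + (b / a - 1).
  by field; rewrite ?gt_eqF.
lra.
Qed.

Variables (N : C -> R) (c0 c1 : R).
Hypothesis gN : gauge N c0 c1.

Lemma gauge_lipschitz v w : `|N v - N w| <= c1 * normc (v - w).
Proof.
have H x y : N x - N y <= c1 * normc (x - y).
  rewrite lerBlDr; apply: le_trans (lerD (gauge_le gN (x - y)) (lexx (N y))).
  by rewrite -{1}[x](subrK y); exact: gaugeD gN _ _.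
by rewrite ler_norml H andbT lerNl opprB normc_distC H.
Qed.

Definition Ncis t : R := N (cis t).
(** The point with argument t on the curve N = 1. *)
Definition gcis t : C := (Ncis t)^-1%:C * cis t.

Lemma Ncis_ge t : c0 <= Ncis t.
Proof. by have := gauge_ge gN (cis t); rewrite normc_cis mulr1. Qed.

Lemma Ncis_le t : Ncis t <= c1.
Proof. by have := gauge_le gN (cis t); rewrite normc_cis mulr1. Qed.

Lemma Ncis_gt0 t : 0 < Ncis t.
Proof. exact: lt_le_trans (gauge_gt0 gN) (Ncis_ge t). Qed.

Lemma Ncis_lipschitz s t : `|Ncis s - Ncis t| <= c1 * `|s - t|.
Proof.
apply: le_trans (gauge_lipschitz _ _) _; rewrite ler_wpM2l ?normc_cisB//.
exact/ltW/(gauge_c1 gN).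
Qed.

Lemma N_gcis t : N (gcis t) = 1.
Proof.
by rewrite (gaugeZ gN) ?invr_ge0 ?(ltW (Ncis_gt0 t))// mulVf ?gt_eqF ?Ncis_gt0.
Qed.

Let H : R := c0^-1 + c1 / c0 ^+ 2.

Lemma gcis_lipschitz_ge0 : 0 <= H.
Proof.
have := gauge_gt0 gN; have := gauge_c1 gN => h1 h0.
by rewrite addr_ge0 ?divr_ge0 ?invr_ge0 ?exprn_ge0 ?ltW.
Qed.

Lemma gcis_lipschitz s t : normc (gcis s - gcis t) <= H * `|s - t|.
Proof.
have c00 := gauge_gt0 gN.
have -> : gcis s - gcis t = (Ncis s)^-1%:C * (cis s - cis t) +
    ((Ncis s)^-1 - (Ncis t)^-1)%:C * cis t by rewrite /gcis rmorphB/=; ring.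
apply: le_trans (ler_normcD _ _) _; rewrite !normcM !normc_real normc_cis mulr1.
rewrite /H mulrDl; apply: lerD.
  apply: ler_pM; rewrite ?normc_ge0 ?normr_ge0 ?normc_cisB//.
  by rewrite gtr0_norm ?invr_gt0 ?Ncis_gt0// lef_pV2 ?posrE ?Ncis_gt0 ?Ncis_ge.
have -> : (Ncis s)^-1 - (Ncis t)^-1 = (Ncis t - Ncis s) / (Ncis s * Ncis t).
  by field; rewrite ?gt_eqF ?Ncis_gt0.
rewrite normrM distrC mulrAC; apply: ler_pM; rewrite ?normr_ge0 ?Ncis_lipschitz//.
rewrite gtr0_norm ?invr_gt0 ?mulr_gt0 ?Ncis_gt0//.
rewrite lef_pV2 ?posrE ?mulr_gt0 ?Ncis_gt0 ?exprn_gt0// expr2.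
by apply: ler_pM; rewrite ?Ncis_ge ?ltW.
Qed.

Definition angle (m k : nat) : R := 2 * pi * (k%:R / m%:R).
Definition vertex (la : R) (m k : nat) : C := la%:C * gcis (angle m k).

Lemma angleS m k : angle m k.+1 = angle m k + 2 * pi / m%:R.
Proof. by rewrite /angle -[k.+1%:R]natr1 [_ / m%:R]mulrDl mulrDr [1 / _]mul1r. Qed.

Lemma cisD2pi (t : R) : cis (t + 2 * pi) = cis t.
Proof. by rewrite /cis mulr_natl cosD2pi sinD2pi. Qed.

Lemma angleDm m k : (0 < m)%N -> angle m (k + m) = angle m k + 2 * pi.
Proof.
move=> m0; rewrite /angle natrD [_ / m%:R]mulrDl divff ?mulrDr ?mulr1//.
by rewrite pnatr_eq0 -lt0n.
Qed.

Lemma vertexDm la m k : (0 < m)%N -> vertex la m (k + m) = vertex la m k.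
Proof. by move=> m0; rewrite /vertex /gcis /Ncis angleDm// cisD2pi. Qed.

Lemma N_vertex la m k : 0 <= la -> N (vertex la m k) = la.
Proof. by move=> la0; rewrite (gaugeZ gN)// N_gcis mulr1. Qed.

Lemma vertex_neq0 la m k : 0 < la -> vertex la m k != 0.
Proof.
move=> la0; apply/eqP => v0; have := N_vertex m k (ltW la0).
by rewrite v0 (gauge0 gN) => e; move: la0; rewrite -e ltxx.
Qed.

(* [(z' - z) / z] splits into a real part, whose sum is a telescoping sum of
   logarithms up to the mesh, and the angular increment [i delta]. *)
Lemma vertex_winding : exists2 D, 0 <= D & forall la m, 0 < la -> (0 < m)%N ->
  normc (\sum_(k < m) (vertex la m k.+1 - vertex la m k) / vertex la m k - twopii R)
    <= D / m%:R.
Proof.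
have c00 := gauge_gt0 gN; have c10 := gauge_c1 gN.
pose q := c1 / c0; have q0 : 0 < q by rewrite divr_gt0.
exists ((q ^+ 2 * q + 2 + q) * (2 * pi) ^+ 2).
  have q1 := ltW q0.
  by apply: mulr_ge0; rewrite ?sqr_ge0// !addr_ge0// mulr_ge0// sqr_ge0.
move=> la m la0 m0; have mR : 0 < m%:R :> R by rewrite ltr0n.
pose d : R := 2 * pi / m%:R.
have d0 : 0 <= d by rewrite divr_ge0// mulr_ge0// pi_ge0.
pose n k := Ncis (angle m k); pose eta k : R := n k / n k.+1 - 1.
have n0 k : 0 < n k by exact: Ncis_gt0.
have etad k : `|eta k| <= q * d.
  have -> : eta k = (n k - n k.+1) / n k.+1.
    by rewrite /eta mulrBl divff// gt_eqF.
  rewrite normrM distrC normfV [`|n _|]gtr0_norm// ler_pdivrMr//.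
  apply: le_trans (Ncis_lipschitz _ _) _; rewrite angleS addrAC subrr add0r.
  rewrite ger0_norm// -/d.
  have -> : q * d * n k.+1 = c1 * d * (n k.+1 / c0) by rewrite /q; ring.
  apply: ler_peMr; first exact: mulr_ge0 (ltW c10) d0.
  by rewrite ler_pdivlMr// mul1r Ncis_ge.
have termE k : (vertex la m k.+1 - vertex la m k) / vertex la m k =
   (eta k)%:C + ((cis d - 1 - d%:C * 'i%C) + (eta k)%:C * (cis d - 1)) + d%:C * 'i%C.
  have v0 := vertex_neq0 m k la0.
  have -> : vertex la m k.+1 = (n k / n k.+1)%:C * cis d * vertex la m k.
    have nk j : (n j)%:C != 0 by rewrite -normc0P normc_real normr_eq0 gt_eqF.
    rewrite /vertex /gcis -/(n k) -/(n k.+1) angleS -/d cisD rmorphM/= !fmorphV/=.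
    by field; rewrite !nk.
  rewrite -{2}[vertex la m k]mul1r -mulrBl mulfK// /eta rmorphB/= rmorph1; ring.
under eq_bigr do rewrite termE.
rewrite 3!big_split/= !sumr_const !card_ord.
have -> : d%:C * 'i%C *+ m = twopii R.
  rewrite -mulrnAl -rmorphMn/= /twopii; congr (_%:C * _).
  by rewrite -mulr_natr /d mulfVK// gt_eqF.
rewrite addrK.
have etaS : `|\sum_(k < m) eta k| <= m%:R * ((q * d) ^+ 2 * q).
  (* After m steps the angle has grown by a full turn, so the radius returns to its initial
     value. *)
  have tel : \sum_(k < m) (ln (n k) - ln (n k.+1)) = 0.
    rewrite -(big_mkord xpredT (fun k => ln (n k) - ln (n k.+1))).
    under eq_bigr do rewrite -opprB.
    rewrite sumrN (telescope_sumr (fun k => ln (n k)))//.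
    by rewrite -{1}[m]add0n /n angleDm// /Ncis cisD2pi subrr oppr0.
  have -> : \sum_(k < m) eta k = \sum_(k < m) (eta k - (ln (n k) - ln (n k.+1))).
    by rewrite [RHS]sumrB tel subr0.
  apply: le_trans (ler_norm_sum _ _ _) _.
  have -> : m%:R * ((q * d) ^+ 2 * q) = \sum_(k < m) ((q * d) ^+ 2 * q).
    by rewrite sumr_const card_ord mulr_natl.
  apply: ler_sum => k _; have /andP[h1 h2] := ln_ratio_bounds (n0 k) (n0 k.+1).
  rewrite ger0_norm//; apply: le_trans h2 _; apply: ler_pM; rewrite ?sqr_ge0//.
  - by rewrite divr_ge0 ?ltW.
  - rewrite -[leLHS]real_normK ?num_real// ler_pXn2r ?nnegrE// ?etad//.
    by rewrite mulr_ge0// ltW.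
  - apply: ler_pM; rewrite ?invr_ge0 ?(ltW (n0 _)) ?Ncis_le//.
    by rewrite lef_pV2 ?posrE ?Ncis_ge.
apply: (@le_trans _ _ (m%:R * ((q * d) ^+ 2 * q) +
    (m%:R * (2 * d ^+ 2) + m%:R * (q * d * d)))); last first.
  rewrite le_eqVlt; apply/orP; left; apply/eqP; rewrite /d; field.
  by rewrite gt_eqF.
apply: le_trans (ler_normcD _ _) _; apply: lerD.
  have -> : \sum_(k < m) (eta k)%:C = (\sum_(k < m) eta k)%:C by rewrite rmorph_sum.
  by rewrite normc_real.
apply: le_trans (ler_normcD _ _) _; apply: lerD.
  by rewrite [leRHS]mulr_natl [leLHS](@normcMn R) lerMn2r cis_taylor orbT.
apply: le_trans (ler_normc_sum _ _ _) _.
have -> : m%:R * (q * d * d) = \sum_(k < m) (q * d * d).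
  by rewrite sumr_const card_ord mulr_natl.
apply: ler_sum => k _; rewrite normcM normc_real.
apply: ler_pM; rewrite ?normr_ge0 ?normc_ge0 ?etad//.
by have := normc_cisB d 0; rewrite cis0 subr0 ger0_norm.
Qed.

(** One D serves all levels up to 2: the winding bound is invariant under scaling, and the mesh
    grows at most by the factor 2. [gauge_companion] chooses its level in terms of D. *)
Lemma vertex_loop : exists2 D, 0 <= D & forall la m, 0 < la <= 2 -> (0 < m)%N ->
  loop N la D m (vertex la m).
Proof.
have [D D0 HD] := vertex_winding; have H0 := gcis_lipschitz_ge0.
have p0 : 0 <= pi :> R := pi_ge0 R.
exists (2 * (H * (2 * pi)) + D) => [|la m /andP[la0 la2] m0].
  by rewrite addr_ge0// !mulr_ge0.
have mR : 0 < m%:R :> R by rewrite ltr0n.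
split=> //.
- by move=> k; exact/N_vertex/ltW.
- by rewrite -{2}[m]add0n vertexDm.
- move=> k; rewrite -mulrBr normcM normc_real gtr0_norm//.
  apply: (@le_trans _ _ (2 * (H * (2 * pi) / m%:R))); last first.
    have -> : 2 * (H * (2 * pi) / m%:R) = 2 * (H * (2 * pi)) / m%:R by rewrite mulrA.
    by rewrite ler_wpM2r ?invr_ge0 ?(ltW mR)// lerDl.
  apply: ler_pM; rewrite ?normc_ge0 ?(ltW la0)//.
  apply: le_trans (gcis_lipschitz _ _) _; rewrite angleS addrAC subrr add0r.
  by rewrite ger0_norm ?divr_ge0 ?mulr_ge0// [leLHS]mulrA.
- apply: le_trans (HD la m la0 m0) _.
  by rewrite ler_wpM2r ?invr_ge0 ?(ltW mR)// lerDr !mulr_ge0.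
Qed.

End GaugePolygon.

(** * The Cauchy transform of the conjugate *)

Section Positivity.
Variable R : realType.
Local Notation C := R[i].
Local Notation Re := complex.Re.
Local Notation Im := complex.Im.

Definition cross (a b : C) : R := Im (a^* * b).

Lemma crossE a b : cross a b = Re a * Im b - Im a * Re b.
Proof. by rewrite /cross cImM cReJ cImJ; ring. Qed.

(** Discrete positivity of the double layer kernel: t lies to the left of the edge from a to b. In
    coordinates t = al a + be b the claim is al + be <= 1. If a coordinate is negative, the triangle
    inequality for N gives (al + be) la <= 1. Otherwise t differs from (al + be) a by be (b - a),
    and the mesh condition N (a - b) <= la - 1 gives al + be <= N t. *)
Lemma chord_support (N : C -> R) (c0 c1 la : R) (a b t : C) : gauge N c0 c1 ->
  1 < la -> N a = la -> N b = la -> 0 < cross a b ->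
  c1 * normc (b - a) <= la - 1 -> N t <= 1 -> 0 <= cross (a - t) (b - a).
Proof.
move=> gN la1 Na Nb X0 ab Nt.
have la0 : 0 < la by lra.
pose al := cross t b / cross a b; pose be := cross a t / cross a b.
have tE : t = al%:C * a + be%:C * b.
  have Xn : cross a b != 0 by rewrite gt_eqF.
  move: Xn; rewrite /al /be !crossE => Xn.
  by apply: eq_complexP; rewrite ?cReD ?cImD ?cRe_mull ?cIm_mull; field.
have -> : cross (a - t) (b - a) = cross a b * (1 - al - be).
  rewrite {1}tE !crossE ?cReB ?cImB ?cReD ?cImD ?cRe_mull ?cIm_mull; ring.
rewrite pmulr_rge0// leNgt; apply/negP => neg.
have [al0|al0] := leP 0 al; last first.
  have : N (be%:C * b) <= N t + N ((- al)%:C * a).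
    have -> : be%:C * b = t + (- al)%:C * a by rewrite {1}tE rmorphN/=; ring.
    exact: gaugeD gN _ _.
  rewrite !(gaugeZ gN) ?Na ?Nb; [|lra..] => h.
  have : (be + al) * la <= 1 by lra.
  have : 1 * la < (be + al) * la by rewrite ltr_pM2r//; lra.
  lra.
have [be0|be0] := leP 0 be; last first.
  have : N (al%:C * a) <= N t + N ((- be)%:C * b).
    have -> : al%:C * a = t + (- be)%:C * b by rewrite {1}tE rmorphN/=; ring.
    exact: gaugeD gN _ _.
  rewrite !(gaugeZ gN) ?Na ?Nb; [|lra..] => h.
  have : (be + al) * la <= 1 by lra.
  have : 1 * la < (be + al) * la by rewrite ltr_pM2r//; lra.
  lra.
pose s := al + be; have s1 : 1 < s by rewrite /s; lra.
have : s * la <= N t + N (be%:C * (a - b)).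
  have -> : s * la = N (s%:C * a) by rewrite (gaugeZ gN) ?Na//; lra.
  have -> : s%:C * a = t + be%:C * (a - b) by rewrite {1}tE /s rmorphD/=; ring.
  exact: gaugeD gN _ _.
rewrite (gaugeZ gN)// => h.
have h1 : N (a - b) <= la - 1.
  by apply: le_trans (gauge_le gN _) _; rewrite normc_distC.
have h2 : be * N (a - b) <= s * (la - 1).
  apply: ler_pM => //; first exact: (gauge_ge0 gN).
  by rewrite /s lerDr.
have : s <= N t by lra.
lra.
Qed.

Lemma conjc_mulr (z : C) (x : R) : (z * x%:C)^* = z^* * x%:C.
Proof.
by apply: eq_complexP; rewrite ?cReJ ?cImJ ?cRe_mulr ?cIm_mulr ?cReJ ?cImJ ?mulNr.
Qed.

Definition accretive n (A : 'M[C]_n) := forall x, 0 <= Re (dotc x (A *m x)).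

(** With y = (z_k - T)^-1 x, the form at x is |y|^2 w conj (z_k - t), where t is the Rayleigh
    quotient of T at y. Positivity at the points t of the level set thus passes to the resolvent. *)
Lemma accretive_rsv (N : C -> R) (la mu D : R) m z n (T : 'M[C]_n.+1) c0 c1 k :
  gauge N c0 c1 -> 0 <= mu -> mu < la -> loop N la D m z -> below N mu T ->
  forall w : C, (forall t, N t <= mu -> 0 <= Re (w * (z k - t)^*)) ->
  accretive (w *: rsv T (z k)).
Proof.
move=> gN mu0 mula L Tmu w H x.
have u := res_unit gN mu0 mula L k Tmu.
set y := rsv T (z k) *m x.
have xE : x = ((z k)%:M - T) *m y by rewrite /y mulmxA mulmxV ?mul1mx.
rewrite -scalemxAl -/y dotcZr {1}xE -dotcJ.
have [->|y0] := eqVneq y 0.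
  by rewrite dotcE big1 ?rmorph0 ?mulr0// => i _; rewrite mxE rmorph0 mul0r.
have n0 : 0 < vnorm2 y ^+ 2 by rewrite exprn_gt0// vnorm2_gt0.
pose t := (vnorm2 y ^- 2)%:C * dotc y (T *m y).
have Nt : N t <= mu.
  rewrite (gaugeZ gN) ?invr_ge0 ?(ltW n0)// ler_pdivrMl// mulrC; exact: Tmu.
have -> : dotc y (((z k)%:M - T) *m y) = (z k - t) * (vnorm2 y ^+ 2)%:C.
  rewrite mulmxBl mul_scalar_mx dotcDr dotcNr dotcZr dotcxx mulrBl; congr (_ - _).
  by rewrite /t mulrC mulrA -rmorphM/= divff ?gt_eqF// rmorph1 mul1r.
rewrite conjc_mulr [w * _]mulrA.
by rewrite cRe_mulr mulr_ge0 ?sqr_ge0// H.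
Qed.

(** Accretivity at x - c y, for the phase c that turns p into |p|. The right side is a sum rather
    than a product, so the bounds can be added over k. *)
Lemma accretive_cauchy n (A : 'M[C]_n) x y : accretive A ->
  normc (dotc x ((A + adjmx A) *m y)) <=
    Re (dotc x (A *m x)) + Re (dotc y (A *m y)).
Proof.
move=> Aa; set p := dotc x _.
have adjE a b : dotc a (adjmx A *m b) = (dotc b (A *m a))^*.
  by rewrite -{2}[A]adjmxK -adjmxE dotcJ.
have [->|p0] := eqVneq p 0; first by rewrite normc0 addr_ge0.
have np : 0 < normc p by rewrite normc_gt0.
pose c := (normc p)^-1%:C * p^*.
have c1 : c * p = (normc p)%:C.
  rewrite /c -mulrA [p^* * p]mulrC mul_conjc -rmorphM/= expr2 mulrA mulVf ?mul1r//.
  by rewrite gt_eqF.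
have cc : c^* * c = 1.
  rewrite mulrC mul_conjc /c normcM normc_real normc_conj gtr0_norm ?invr_gt0//.
  by rewrite mulVf ?expr1n// gt_eqF.
have := Aa (x - c *: y).
rewrite mulmxBr -scalemxAr !(dotcDl, dotcDr, dotcNl, dotcNr, dotcZl, dotcZr).
have -> : c^* * (c * dotc y (A *m y)) = dotc y (A *m y) by rewrite mulrA cc mul1r.
have : Re (c * p) = normc p by rewrite c1.
rewrite /p mulmxDl dotcDr adjE mulrDr cReD.
rewrite opprK !(cReD, cReN, cReB) => E.
have -> : Re (c^* * dotc y (A *m x)) = Re (c * (dotc y (A *m x))^*).
  by rewrite -cReJ rmorphM/= conjcK.
move: E; rewrite -/p; lra.
Qed.

(** For unit vectors u and v, [accretive_cauchy] bounds the form by F times the sum of the quadratic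
    forms of the A_k at u and at v, each at most S. The factor 2 is the one in f(T) + g(T)^H. *)
Lemma accretive_sum_opbound n m (A : nat -> 'M[C]_n) (f : nat -> C) (F S : R) :
  0 <= F -> (forall k, (k < m)%N -> accretive (A k)) ->
  (forall k, (k < m)%N -> normc (f k) <= F) ->
  opbound (\sum_(k < m) A k) S ->
  opbound (\sum_(k < m) f k *: (A k + adjmx (A k))) (F * (2 * S)).
Proof.
move=> F0 Aa fF AS x; set M := \sum_(k < m) _.
have dsum (u v : 'cV[C]_n) (B : nat -> 'M[C]_n) :
    dotc u ((\sum_(k < m) B k) *m v) = \sum_(k < m) dotc u (B k *m v).
  elim/big_rec2: _ => [|i c X _ IH].
    by rewrite mul0mx dotcE big1// => i _; rewrite mxE mulr0.
  by rewrite mulmxDl dotcDr IH.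
have key u v : vnorm2 u = 1 -> vnorm2 v = 1 -> normc (dotc u (M *m v)) <= F * (2 * S).
  move=> u1 v1; rewrite /M (dsum u v (fun k => f k *: (A k + adjmx (A k)))).
  have q w : vnorm2 w = 1 -> \sum_(k < m) Re (dotc w (A k *m w)) <= S.
    move=> w1; rewrite -Re_sum -dsum; apply: le_trans (Re_le_normc _) _.
    apply: le_trans (dotc_le _ _) _; rewrite w1 mul1r.
    by apply: le_trans (AS w) _; rewrite w1 mulr1.
  apply: le_trans (ler_normc_sum _ _ _) _.
  apply: (@le_trans _ _ (\sum_(k < m) F * (Re (dotc u (A k *m u)) +
      Re (dotc v (A k *m v))))).
    apply: ler_sum => k _; rewrite -scalemxAl dotcZr normcM.
    apply: ler_pM; rewrite ?normc_ge0 ?fF//.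
    by apply: accretive_cauchy; exact: Aa.
  rewrite -mulr_sumr ler_wpM2l// big_split/= mulr_natl mulr2n.
  by apply: lerD; exact: q.
have [->|x0] := eqVneq x 0; first by rewrite mulmx0 !vnorm2_0 mulr0.
have [->|y0] := eqVneq (M *m x) 0.
  rewrite vnorm2_0 !mulr_ge0 ?vnorm2_ge0//.
  have := le_trans (vnorm2_ge0 _) (AS ((vnorm2 x)^-1%:C *: x)).
  by rewrite (vnorm2_normalize x0) mulr1.
have nx : 0 < vnorm2 x by rewrite vnorm2_gt0.
have ny : 0 < vnorm2 (M *m x) by rewrite vnorm2_gt0.
have := key _ _ (vnorm2_normalize y0) (vnorm2_normalize x0).
rewrite -scalemxAr dotcZr dotcZl dotcxx.
rewrite !normcM normc_conj !normc_real !gtr0_norm ?invr_gt0 ?exprn_gt0//.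
by rewrite [X in _ * (_ * X) <= _]expr2 mulKf ?gt_eqF// ler_pdivrMl// mulrC.
Qed.

End Positivity.

(** * The angle under which the distant part of a polygon is seen *)

Section FarMass.
Variable R : realType.
Local Notation C := R[i].
Local Notation Re := complex.Re.
Local Notation Im := complex.Im.

Lemma le_cos_arc (p t : R) : 0 <= p -> p <= t -> t <= 2 * pi - p -> cos t <= cos p.
Proof.
move=> p0; wlog tpi : t / t <= pi => [H pt tp|pt _].
  have [tpi|pit] := leP t pi; first exact: H.
  have -> : cos t = cos (2 * pi - t).
    by rewrite addrC mulr_natl cosD2pi cosN.
  by apply: H; lra.
have [->//|ptn] := eqVneq t p.
apply/ltW; rewrite ltr_cos ?in_itv/= ?p0 ?(le_trans p0) ?(le_trans pt)//.
by rewrite lt_neqAle eq_sym ptn.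
Qed.

Lemma cis_dist_ge (a b s t : R) : 0 <= a -> 0 <= b ->
  2 * (a * b) * (1 - cos (s - t)) <= normc (a%:C * cis s - b%:C * cis t) ^+ 2.
Proof.
move=> a0 b0; rewrite normc_sqr !(cReB, cImB, cRe_mull, cIm_mull) /= cosB.
have h1 := cos2Dsin2 s; have h2 := cos2Dsin2 t.
have -> : (a * cos s - b * cos t) ^+ 2 + (a * sin s - b * sin t) ^+ 2 =
  a ^+ 2 * (cos s ^+ 2 + sin s ^+ 2) + b ^+ 2 * (cos t ^+ 2 + sin t ^+ 2) -
  2 * (a * b) * (cos s * cos t + sin s * sin t) by ring.
by rewrite h1 h2; have := sqr_ge0 (a - b); lra.
Qed.

(** Mean value theorem, the derivative 1 / (1 + x^2) being 1-Lipschitz. *)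
Lemma atan_taylor (a b : R) :
  (b - a) / (1 + a ^+ 2) <= atan b - atan a + (b - a) ^+ 2.
Proof.
have pos (x : R) : 1 <= 1 + x ^+ 2 by rewrite lerDl sqr_ge0.
have pos0 (x : R) : 0 < 1 + x ^+ 2 by apply: lt_le_trans (pos x).
have [c ca E] : exists2 c, `|c - a| <= `|b - a| &
    atan b - atan a = (1 + c ^+ 2)^-1 * (b - a).
  have [ab|ba|->] := ltgtP a b.
  - have [c /andP[ac cb] E] := mean_value ab (@is_derive1_atan R).
    by exists c => //; rewrite !ger0_norm; lra.
  - have [c /andP[bc ca] E] := mean_value ba (@is_derive1_atan R).
    exists c; first by rewrite !ler0_norm; lra.
    by rewrite -[LHS]opprB E -mulrN opprB.
  - by exists b; rewrite ?subrr ?mulr0.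
rewrite {}E mulrC -lerBlDl -mulrBl.
apply: le_trans (ler_norm _) _; rewrite normrM -[leRHS]real_normK ?num_real//.
rewrite expr2 ler_wpM2r//; apply: le_trans ca.
have -> : (1 + a ^+ 2)^-1 - (1 + c ^+ 2)^-1 =
    (c - a) * ((c + a) / ((1 + a ^+ 2) * (1 + c ^+ 2))).
  by field; rewrite !gt_eqF.
rewrite normrM ler_piMr// normrM [`|_^-1|]gtr0_norm ?invr_gt0 ?mulr_gt0//.
rewrite ler_pdivrMr ?mulr_gt0// mul1r ler_norml.
have := sqr_ge0 (c + 1); have := sqr_ge0 (a + 1); have := sqr_ge0 (c - 1).
have := sqr_ge0 (a - 1); have := mulr_ge0 (sqr_ge0 a) (sqr_ge0 c).
nra.
Qed.

(** Im ((x' - y) / y) is the increment of the argument to first order, and on the half plane Re >=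
    sg the argument is atan (Im / Re), whose increments telescope. *)
Lemma half_plane_arg (y x' : C) (sg B d : R) : 0 < sg ->
  sg <= Re y -> sg <= Re x' -> `|Im y| <= B -> normc (x' - y) <= d ->
  Im ((x' - y) / y) <= atan (Im x' / Re x') - atan (Im y / Re y) +
    ((sg^-1 + B / sg ^+ 2) ^+ 2 + (sg^-1 + B / sg ^+ 2) / sg) * d ^+ 2.
Proof.
move=> sg0 y0 x0 yB xyd; have d0 : 0 <= d by exact: le_trans (normc_ge0 _) xyd.
have yp : 0 < Re y by lra.
have xp : 0 < Re x' by lra.
have B0 : 0 <= B by apply: le_trans yB.
pose s := Im y / Re y; pose s' := Im x' / Re x'.
have dRe : `|Re x' - Re y| <= d.
  by rewrite -cReB; apply: le_trans (ler_normRe _) xyd.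
have dIm : `|Im x' - Im y| <= d.
  by rewrite -cImB; apply: le_trans (ler_normIm _) xyd.
pose k := sg^-1 + B / sg ^+ 2.
have k0 : 0 <= k by rewrite addr_ge0 ?invr_ge0 ?divr_ge0 ?sqr_ge0// ltW.
have ssd : `|s' - s| <= k * d.
  have -> : s' - s = (Im x' - Im y) / Re x' - Im y * (Re x' - Re y) / (Re x' * Re y).
    by rewrite /s /s'; field; rewrite !gt_eqF.
  apply: le_trans (ler_normB _ _) _; rewrite [k * d]mulrDl; apply: lerD.
    rewrite normrM mulrC; apply: ler_pM; rewrite ?normr_ge0//.
    by rewrite gtr0_norm ?invr_gt0// lef_pV2.
  rewrite !normrM mulrAC; apply: ler_pM; rewrite ?mulr_ge0 ?normr_ge0//.
  apply: ler_pM; rewrite ?normr_ge0//.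
  rewrite gtr0_norm ?invr_gt0 ?mulr_gt0//.
  by rewrite lef_pV2 ?posrE ?mulr_gt0 ?exprn_gt0// expr2; apply: ler_pM => //; exact: ltW.
have -> : Im ((x' - y) / y) = (s' - s) / (1 + s ^+ 2) +
    (s' - s) * ((Re x' - Re y) / Re y) / (1 + s ^+ 2).
  have n0 : Re y ^+ 2 + Im y ^+ 2 != 0.
    by rewrite gt_eqF// ltr_pwDl ?exprn_gt0 ?sqr_ge0.
  have y0' : y != 0 by apply: contraTneq yp => ->; rewrite ltxx.
  have -> : (x' - y) / y = ((Re y ^+ 2 + Im y ^+ 2)^-1)%:C * ((x' - y) * y^*).
    apply: (mulIf y0'); rewrite mulfVK// -!mulrA [y^* * y]mulrC mul_conjc.
    by rewrite normc_sqr mulrCA -rmorphM/= mulVf// rmorph1 mulr1.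
  rewrite cIm_mull cImM !cReB !cImB cReJ cImJ /s /s'; field.
  by rewrite n0 !gt_eqF.
have s1 : 1 <= 1 + s ^+ 2 by rewrite lerDl sqr_ge0.
have s0 : 0 < 1 + s ^+ 2 by lra.
have h1 := atan_taylor s s'.
have h2 : (s' - s) ^+ 2 <= k ^+ 2 * d ^+ 2.
  rewrite -[leLHS]real_normK ?num_real// -exprMn ler_pXn2r ?nnegrE//.
  by rewrite mulr_ge0.
have h3 : (s' - s) * ((Re x' - Re y) / Re y) / (1 + s ^+ 2) <= k / sg * d ^+ 2.
  apply: le_trans (ler_norm _) _; rewrite normrM [`|_^-1|]gtr0_norm ?invr_gt0//.
  apply: (@le_trans _ _ `|(s' - s) * ((Re x' - Re y) / Re y)|).
    by rewrite ler_piMr// invf_le1.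
  have -> : k / sg * d ^+ 2 = k * d * (d / sg) by ring.
  rewrite !normrM; apply: ler_pM; rewrite ?mulr_ge0 ?normr_ge0//.
  apply: ler_pM; rewrite ?normr_ge0//.
  by rewrite gtr0_norm ?invr_gt0// lef_pV2.
rewrite -/s -/s' -/k [(_ + _) * d ^+ 2]mulrDl; lra.
Qed.

End FarMass.

Section FarVertices.
Variable R : realType.
Local Notation C := R[i].
Local Notation Re := complex.Re.
Local Notation Im := complex.Im.

Lemma sum_period (V : zmodType) (F : nat -> V) (m s : nat) :
  (forall k, F (k + m)%N = F k) -> \sum_(k < m) F (s + k)%N = \sum_(k < m) F k.
Proof.
move=> Fm; elim: s => [|s <-]; first by apply: eq_bigr => k _; rewrite add0n.
case: m Fm => [|m] Fm; first by rewrite !big_ord0.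
rewrite big_ord_recr [RHS]big_ord_recl /= addn0 addrC.
congr (_ + _); first by rewrite -(Fm s) addnS addSn.
by apply: eq_bigr => k _; rewrite /bump /= add1n addSnnS.
Qed.

Lemma cis_surj (z : C) : normc z = 1 -> exists2 t, 0 <= t & z = cis t.
Proof.
move=> z1; have := normc_sqr z; rewrite z1 expr1n => E.
have xb : -1 <= Re z <= 1.
  by rewrite -ler_norml -z1 ler_normRe.
have a0 := acos_ge0 xb; have api := acos_lepi xb.
have sa : sin (acos (Re z)) = `|Im z|.
  by rewrite sin_acos// E addrC addKr sqrtr_sqr.
have ca : cos (acos (Re z)) = Re z by rewrite acosK// in_itv.
have [I0|I0] := leP 0 (Im z).
  exists (acos (Re z)) => //; apply: eq_complexP => //=.
  by rewrite sa ger0_norm.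
exists (2 * pi - acos (Re z)); first by have := pi_ge0 R; lra.
apply: eq_complexP => /=; rewrite addrC mulr_natl ?cosD2pi ?sinD2pi ?cosN ?sinN//.
by rewrite sa ltr0_norm// opprK.
Qed.

Variables (N : C -> R) (c0 c1 : R).
Hypothesis gN : gauge N c0 c1.

Lemma gcis_surj z : N z = 1 -> exists2 t, 0 <= t & z = gcis N t.
Proof.
move=> z1; have z0 : z != 0.
  by apply/eqP => z0; move: z1; rewrite z0 (gauge0 gN) => /esym/eqP; rewrite oner_eq0.
have nz : 0 < normc z by rewrite normc_gt0.
have [|t t0 zt] := @cis_surj ((normc z)^-1%:C * z).
  by rewrite normcM normc_real gtr0_norm ?invr_gt0// mulVf ?gt_eqF.
exists t => //; rewrite /gcis /Ncis -zt (gaugeZ gN) ?invr_ge0 ?(ltW nz)// z1 mulr1.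
by rewrite invrK mulrA -rmorphM/= mulfV ?gt_eqF// mul1r.
Qed.

Let H : R := c0^-1 + c1 / c0 ^+ 2.

(** Lower bound for the squared distance of two points with N >= 1, hence of modulus at least 1 /
    c1, whose arguments differ by at least 2 pi / q modulo a full turn. *)
Definition far_dist (q : nat) : R := 2 / c1 ^+ 2 * (1 - cos (2 * pi / q%:R)).

Lemma far_dist_gt0 q : (3 < q)%N -> 0 < far_dist q.
Proof.
move=> q3; have c10 := gauge_c1 gN; have p0 := pi_gt0 R.
have q0 : 0 < q%:R :> R by rewrite ltr0n (leq_trans _ q3).
rewrite /far_dist mulr_gt0 ?divr_gt0 ?exprn_gt0// subr_gt0 -[ltRHS]cos0.
have h0 : 0 < 2 * pi / q%:R :> R by rewrite divr_gt0 ?mulr_gt0.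
have h1 : 2 * pi / q%:R <= pi :> R.
  rewrite ler_pdivrMr// mulrC ler_wpM2l ?(ltW p0)//.
  by rewrite ler_nat ltnW// ltnW.
by rewrite ltr_cos ?in_itv/= ?lexx ?(ltW p0) ?(ltW h0) ?h1 ?h0.
Qed.

Section Index.
Variables (q l k0 : nat) (t : R).
Hypotheses (q3 : (3 < q)%N) (l0 : (0 < l)%N).
Let m := (q * l)%N.
Let d : R := 2 * pi / m%:R.
Hypothesis tk0 : k0%:R * d <= t < k0.+1%:R * d.
(** The vertices s, ..., s + n form the far arc: they are at least l steps, an angle 2 pi / q, away
    from t. The successor in [l.+1] accounts for t lying anywhere between k0 d and (k0 + 1) d. *)
Let s := (k0 + l.+1)%N.
Let n := (m - 2 * l.+1)%N.

Let m0 : (0 < m)%N. Proof. by rewrite muln_gt0 l0 (leq_trans _ q3). Qed.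
Let mR : 0 < m%:R :> R. Proof. by rewrite ltr0n m0. Qed.
Let d0 : 0 < d. Proof. by rewrite divr_gt0// mulr_gt0// pi_gt0. Qed.
Let ldE : l%:R * d = 2 * pi / q%:R.
Proof.
rewrite /d /m natrM; field; rewrite !pnatr_eq0 -!lt0n l0.
by rewrite (leq_trans _ q3).
Qed.
Let mdE : m%:R * d = 2 * pi. Proof. by rewrite /d mulrC divfK// gt_eqF. Qed.
Let lm : (2 * l.+1 <= m)%N.
Proof.
apply: (@leq_trans (4 * l)); last by rewrite leq_mul2r q3 orbT.
by rewrite -[4%N]/(2 * 2)%N -mulnA leq_mul2l/= mul2n -addnn -addn1 leq_add2l.
Qed.

Let angleE k : angle R m k = k%:R * d.
Proof. by rewrite /angle /d; ring. Qed.

Lemma far_vertex (la b : R) i : (i <= n)%N -> 1 <= la -> 1 <= b ->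
  far_dist q <= normc (vertex N la m (s + i) - b%:C * gcis N t) ^+ 2.
Proof.
move=> iN la1 b1; have c10 := gauge_c1 gN.
set a := angle R m (s + i).
have -> : vertex N la m (s + i) - b%:C * gcis N t =
    (la / Ncis N a)%:C * cis a - (b / Ncis N t)%:C * cis t.
  by rewrite /vertex /gcis -/a !rmorphM/= !mulrA.
have inv_ge x y : 1 <= y -> c1^-1 <= y / Ncis N x.
  move=> y1; rewrite -[c1^-1]mul1r; apply: ler_pM; rewrite ?invr_ge0 ?(ltW c10)//.
  by rewrite lef_pV2 ?posrE ?(Ncis_gt0 gN) ?(Ncis_le gN).
have pos x y : 1 <= y -> 0 <= y / Ncis N x.
  by move=> y1; apply: le_trans (inv_ge x y y1); rewrite invr_ge0 ltW.
apply: le_trans _ (cis_dist_ge a t (pos _ _ la1) (pos _ _ b1)).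
rewrite /far_dist; apply: ler_pM.
- by rewrite divr_ge0 ?exprn_ge0// ltW.
- by rewrite subr_ge0 cos_le1.
- rewrite ler_wpM2l// expr2 invfM; apply: ler_pM; rewrite ?invr_ge0 ?(ltW c10)//;
    exact: inv_ge.
- rewrite lerD2l lerN2 -ldE; case/andP: tk0 => h1 h2.
  have i0 : 0 <= i%:R * d by rewrite mulr_ge0// ltW.
  apply: le_cos_arc.
  + by rewrite mulr_ge0// ltW.
  + rewrite /a angleE /s !natrD -!natr1 in h2 *; lra.
  + have : i%:R * d <= (m%:R - 2 * l.+1%:R) * d.
      by rewrite ler_wpM2r ?(ltW d0)// -natrM -natrB ?ler_nat// -[2%:R]/2.
    rewrite mulrBl mdE /a angleE /s !natrD -!natr1; lra.
Qed.

(** Once a full turn is subtracted, these vertices are at most l + 2 <= 3 l steps from t; the term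
    sg / c0 is the distance between the levels 1 + sg and 1. *)
Lemma near_vertex (sg : R) i : (n <= i < m)%N -> 0 <= sg ->
  normc (vertex N (1 + sg) m (s + i) - gcis N t) <=
  sg / c0 + H * (3 * (2 * pi / q%:R)).
Proof.
move=> /andP[ni im] sg0.
set a := angle R m (s + i); pose a' := a - 2 * pi.
have aE : gcis N a = gcis N a' by rewrite /gcis /Ncis -(cisD2pi a') subrK.
have -> : vertex N (1 + sg) m (s + i) - gcis N t =
    sg%:C * gcis N a + (gcis N a' - gcis N t).
  by rewrite /vertex -/a -aE rmorphD/= mulrDl mul1r; ring.
apply: le_trans (ler_normcD _ _) _; apply: lerD.
  rewrite normcM normc_real ger0_norm// ler_wpM2l//.
  by have := normc_le_gauge gN (gcis N a); rewrite (N_gcis gN) mul1r.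
apply: le_trans (gcis_lipschitz gN _ _) _.
rewrite ler_wpM2l ?(gcis_lipschitz_ge0 gN)// -ldE.
case/andP: tk0; rewrite -natr1 => h1 h2.
have h3 : i%:R * d <= m%:R * d by rewrite ler_wpM2r ?(ltW d0)// ler_nat ltnW.
have h4 : (m%:R - 2 * l.+1%:R) * d <= i%:R * d.
  by rewrite ler_wpM2r ?(ltW d0)// -natrM -natrB ?ler_nat.
have h5 : 1 * d <= l%:R * d by rewrite ler_wpM2r ?(ltW d0)// ler1n.
rewrite mulrBl mdE -natr1 in h4; rewrite mdE in h3.
rewrite /a' /a angleE /s !natrD -natr1 ler_norml; apply/andP; split; lra.
Qed.

(* From the outer point [(1 + 3 sg) gcis t] the polygon is seen in a half plane,
   hence under an angle at most [pi]; moving back to [gcis t] costs little on the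
   vertices that stay away from it. *)
Lemma far_mass (D sg : R) : 0 < sg <= 1 -> loop N (1 + sg) D m (vertex N (1 + sg) m) ->
  \sum_(i < n) Im ((vertex N (1 + sg) m (s + i).+1 - vertex N (1 + sg) m (s + i)) /
     (vertex N (1 + sg) m (s + i) - gcis N t)) <=
  pi + ((sg^-1 + c1 * (6 / c0) / sg ^+ 2) ^+ 2 +
        (sg^-1 + c1 * (6 / c0) / sg ^+ 2) / sg) * (c1 * D) ^+ 2 / m%:R
     + D * (3 * sg / c0) / far_dist q.
Proof.
move=> /andP[sg0 sg1] L; set P := fun i => vertex N (1 + sg) m (s + i).
have PS i : vertex N (1 + sg) m (s + i).+1 = P i.+1 by rewrite /P addnS.
under eq_bigr do rewrite PS -/(P _).
set z := gcis N t; have z1 : N z = 1 by exact: (N_gcis gN).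
have c00 := gauge_gt0 gN; have c10 := gauge_c1 gN; have D0 := loop_D L.
have [kk kkE] : exists kk, kk = far_dist q by eexists.
have k0' : 0 < kk by rewrite kkE; exact: far_dist_gt0.
rewrite -kkE.
have b0 : 0 < 1 + 3 * sg by lra.
(* Scaled by 1 + 3 sg this tolerance costs exactly sg, so the supporting line leaves the gap (1 + 3
   sg) - sg - (1 + sg) = sg used in [Rexi]. *)
have tau0 : 0 < sg / (1 + 3 * sg) by rewrite divr_gt0.
have [u uN uz] := gauge_support gN z tau0.
have uc := support_normc gN uN.
pose zs := (1 + 3 * sg)%:C * z.
have Pmesh i : normc (P i.+1 - P i) <= D / m%:R.
  by rewrite /P addnS; exact: (loop_mesh L).
have NP i : N (P i) = 1 + sg by exact: (loop_N L).
pose xi i := u^* * (zs - P i).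
have zzs : normc (zs - z) <= 3 * sg / c0.
  have -> : zs - z = (3 * sg)%:C * z by rewrite /zs rmorphD/= mulrDl mul1r addrC addKr.
  rewrite normcM normc_real gtr0_norm ?mulr_gt0// ler_wpM2l// ?mulr_ge0 ?(ltW sg0)//.
  by have := normc_le_gauge gN z; rewrite z1 mul1r.
have Rexi i : sg <= Re (xi i).
  have := uN (P i); rewrite NP.
  have -> : Re (xi i) = (1 + 3 * sg) * dotR u z - dotR u (P i).
    by rewrite /xi mulrBr cReB /zs mulrCA cRe_mull.
  have : (1 + 3 * sg) * (1 - sg / (1 + 3 * sg)) <= (1 + 3 * sg) * dotR u z.
    by move: uz; rewrite z1 => uz; rewrite ler_wpM2l ?(ltW b0).
  rewrite mulrBr mulr1 [_ * (sg / _)]mulrC divfK ?gt_eqF//; lra.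
have xiB i : `|Im (xi i)| <= c1 * (6 / c0).
  apply: le_trans (ler_normIm _) _; rewrite normcM normc_conj.
  apply: ler_pM; rewrite ?normc_ge0//; apply: le_trans (ler_normcB _ _) _.
  have -> : 6 / c0 = 4 * (1 / c0) + 2 / c0 :> R by ring.
  have zc : normc z <= 1 / c0 by rewrite -z1; exact: (normc_le_gauge gN).
  apply: lerD.
    rewrite normcM normc_real gtr0_norm//; apply: ler_pM; rewrite ?normc_ge0 ?(ltW b0)//.
    by lra.
  apply: le_trans (normc_le_gauge gN _) _; rewrite NP ler_wpM2r ?invr_ge0 ?(ltW c00)//.
  by lra.
have xid i : normc (xi i.+1 - xi i) <= c1 * D / m%:R.
  have -> : xi i.+1 - xi i = - u^* * (P i.+1 - P i) by rewrite /xi; ring.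
  rewrite normcM normc_opp normc_conj -mulrA.
  by apply: ler_pM; rewrite ?normc_ge0.
set B := c1 * (6 / c0) in xiB *.
set K := (_ ^+ 2 + _ / sg).
have K0 : 0 <= K.
  have Y0 : 0 <= sg^-1 + B / sg ^+ 2.
    apply: addr_ge0; first by rewrite invr_ge0 ltW.
    apply: divr_ge0; last exact: sqr_ge0.
    by apply: mulr_ge0; [exact: ltW | rewrite divr_ge0 ?ltW].
  by rewrite addr_ge0 ?sqr_ge0// divr_ge0 ?(ltW sg0).
(* The quotient does not change when P - zs is replaced by xi, a constant multiple of it with values
   in the half plane Re >= sg. *)
have argi i : Im ((P i.+1 - P i) / (P i - zs)) <=
    atan (Im (xi i.+1) / Re (xi i.+1)) - atan (Im (xi i) / Re (xi i)) +
    K * (c1 * D / m%:R) ^+ 2.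
  have := half_plane_arg sg0 (Rexi i) (Rexi i.+1) (xiB i) (xid i).
  congr (Im _ <= _).
  have u0 : u^* != 0.
    rewrite conjc_eq0; apply/eqP => u0; have := Rexi 0%N.
    by rewrite /xi u0 rmorph0 mul0r leNgt sg0.
  have xi0 : zs - P i != 0.
    apply/eqP => x0; have := Rexi i.
    by rewrite /xi x0 mulr0 leNgt sg0.
  have xi0' : P i - zs != 0 by rewrite -oppr_eq0 opprB.
  by rewrite /xi; field; rewrite u0 xi0 xi0'.
(* 1 / (P - z) - 1 / (P - zs) = (z - zs) / ((P - z) (P - zs)), and on the far arc both factors have
   squared modulus at least kk. *)
have cmp i : (i <= n)%N -> Im ((P i.+1 - P i) / (P i - z)) <=
    Im ((P i.+1 - P i) / (P i - zs)) + D / m%:R * ((3 * sg / c0) / kk).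
  move=> iN; rewrite -lerBlDl -cImB; apply: le_trans (Im_le_normc _) _.
  have fz : kk <= normc (P i - z) ^+ 2.
    rewrite kkE; have := far_vertex iN (_ : 1 <= 1 + sg) (lexx 1).
    by rewrite mul1r; apply; lra.
  have fzs : kk <= normc (P i - zs) ^+ 2 by rewrite kkE; apply: far_vertex => //; lra.
  have nz : 0 < normc (P i - z).
    rewrite lt_def normc_ge0 andbT; apply/eqP => e; move: fz.
    by rewrite e expr0n /= leNgt k0'.
  have nzs : 0 < normc (P i - zs).
    rewrite lt_def normc_ge0 andbT; apply/eqP => e; move: fzs.
    by rewrite e expr0n /= leNgt k0'.
  have -> : (P i.+1 - P i) / (P i - z) - (P i.+1 - P i) / (P i - zs) =
      (P i.+1 - P i) * (z - zs) / ((P i - z) * (P i - zs)).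
    by field; rewrite -!normc_gt0 nz nzs.
  rewrite !normcM normcV normcM -mulrA; apply: ler_pM; rewrite ?normc_ge0//.
    by rewrite divr_ge0 ?mulr_ge0 ?normc_ge0.
  apply: ler_pM; rewrite ?normc_ge0 ?invr_ge0 ?mulr_ge0 ?normc_ge0//.
    by rewrite normc_distC.
  rewrite lef_pV2 ?posrE ?mulr_gt0//.
  rewrite -(ler_pXn2r (_ : 0 < 2)%N) ?nnegrE ?mulr_ge0 ?(ltW k0') ?normc_ge0//.
  by rewrite exprMn [kk ^+ 2]expr2; apply: ler_pM; rewrite ?(ltW k0').
have nm : n%:R <= m%:R :> R by rewrite ler_nat leq_subr.
apply: (@le_trans _ _ (\sum_(i < n) (atan (Im (xi i.+1) / Re (xi i.+1)) -
    atan (Im (xi i) / Re (xi i))) + n%:R * (K * (c1 * D / m%:R) ^+ 2 +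
    D / m%:R * ((3 * sg / c0) / kk)))).
  rewrite mulr_natl -[n in X in _ <= _ + X]card_ord -sumr_const -big_split/=.
  apply: ler_sum => i _; apply: le_trans (cmp i (ltnW (ltn_ord i))) _.
  by rewrite addrA lerD2r; exact: argi.
rewrite -addrA; apply: lerD.
  (* The increments telescope to a difference of two values of atan, hence at most pi. *)
  rewrite -(big_mkord xpredT (fun i => atan (Im (xi i.+1) / Re (xi i.+1)) -
    atan (Im (xi i) / Re (xi i)))).
  rewrite (telescope_sumr (fun i => atan (Im (xi i) / Re (xi i))))//.
  have := atan_ltpi2 (Im (xi n) / Re (xi n)).
  have := atan_gtNpi2 (Im (xi 0%N) / Re (xi 0%N)); lra.
apply: (@le_trans _ _ (m%:R * (K * (c1 * D / m%:R) ^+ 2 +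
    D / m%:R * ((3 * sg / c0) / kk)))).
  rewrite ler_wpM2r// addr_ge0 ?mulr_ge0 ?sqr_ge0 ?divr_ge0 ?invr_ge0 ?mulr_ge0//;
    exact: ltW.
rewrite le_eqVlt; apply/orP; left; apply/eqP; field.
by rewrite !gt_eqF.
Qed.

End Index.

Lemma index_of_angle (t d : R) : 0 <= t -> 0 < d ->
  exists k : nat, k%:R * d <= t < k.+1%:R * d.
Proof.
move=> t0 d0; have td0 : 0 <= t / d by rewrite divr_ge0// ltW.
exists (Num.truncn (t / d)).
by have := truncn_itv td0; rewrite ler_pdivlMr// ltr_pdivrMr.
Qed.

End FarVertices.

(** * Bounds for the Cauchy transform and a first, crude spectral constant *)

Section GaugeConstant.
Variable R : realType.
Local Notation C := R[i].
Local Notation Re := complex.Re.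
Local Notation Im := complex.Im.

(* With [mu = 2 Re a] the sum of [f^* a] is the [mu]-sum of [f^*] minus the
   conjugate of the [a]-sum of [f]. The total mass of [mu] is about 2; at least
   about half of it sits where [f] is close to [w], and this half is cancelled. *)
Lemma kernel_bound (m n : nat) (a f : nat -> C) (w : C) (F om e1 e3 : R) :
  (n <= m)%N -> (forall k, (k < m)%N -> 0 <= Re (a k)) ->
  (forall k, (k < m)%N -> normc (f k) <= F) -> normc w <= 1 -> 1 <= F ->
  normc (\sum_(k < m) a k - 1) <= e1 ->
  normc (\sum_(k < m) f k * a k - w) <= e1 ->
  0 <= e3 -> 0 <= om ->
  \sum_(k < n) 2 * Re (a k) <= 1 + e3 ->
  (forall k, (n <= k < m)%N -> normc (f k - w) <= om) ->
  normc (\sum_(k < m) (f k)^* * a k) <= F + e3 * (1 + F) + om * (2 + 2 * e1) + 3 * e1.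
Proof.
move=> nm a0 fF w1 F1 ae fae e30 om0 far near.
pose mu k : R := 2 * Re (a k).
have mu0 k : (k < m)%N -> 0 <= mu k by move=> km; rewrite mulr_ge0// a0.
have muE k : (mu k)%:C = a k + (a k)^*.
  by apply: eq_complexP; rewrite ?cReD ?cImD ?cReJ ?cImJ /mu /=; ring.
pose Y := \sum_(0 <= k < n) mu k; pose Z := \sum_(n <= k < m) mu k.
have Y0 : 0 <= Y.
  rewrite /Y big_nat sumr_ge0// => k /andP[_ kn].
  by apply: mu0; exact: leq_trans kn nm.
have Z0 : 0 <= Z by rewrite /Z big_nat sumr_ge0// => k /andP[_ km]; exact: mu0.
have Y1 : Y <= 1 + e3 by rewrite /Y big_mkord.
have YZ : `|Y + Z - 2| <= 2 * e1.
  rewrite /Y /Z -big_cat_nat// big_mkord /mu -mulr_sumr -Re_sum.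
  have -> : 2 * Re (\sum_(i < m) a i) - 2 = 2 * Re (\sum_(i < m) a i - 1).
    by rewrite cReB mulrBr /= mulr1.
  rewrite normrM ger0_norm// ler_wpM2l//.
  exact: le_trans (ler_normRe _) ae.
have e10 : 0 <= e1 by exact: le_trans (normc_ge0 _) ae.
have F0 : 0 <= F by lra.
have E1 : \sum_(k < m) (f k)^* * a k =
    \sum_(k < m) (f k)^* * (mu k)%:C - (\sum_(k < m) f k * a k)^*.
  rewrite rmorph_sum -sumrB; apply: eq_bigr => k _.
  by rewrite muE rmorphM/= mulrDr addrK.
have E2 : \sum_(k < m) (f k)^* * (mu k)%:C =
    \sum_(0 <= k < n) (f k)^* * (mu k)%:C +
    (\sum_(n <= k < m) (f k - w)^* * (mu k)%:C + w^* * Z%:C).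
  rewrite -(big_mkord xpredT (fun k => (f k)^* * (mu k)%:C)).
  rewrite (big_cat_nat (n := n))//=; congr (_ + _).
  rewrite /Z rmorph_sum mulr_sumr -big_split/=; apply: eq_bigr => k _.
  by rewrite rmorphB/= mulrBl subrK.
have -> : \sum_(k < m) (f k)^* * a k =
    \sum_(0 <= k < n) (f k)^* * (mu k)%:C +
    (\sum_(n <= k < m) (f k - w)^* * (mu k)%:C + w^* * (Z - 1)%:C) -
    (\sum_(k < m) f k * a k - w)^*.
  by rewrite E1 E2 !rmorphB/= rmorph1; ring.
apply: le_trans (ler_normcB _ _) _; rewrite normc_conj.
apply: (@le_trans _ _ (F * Y + (om * Z + `|Z - 1|) + e1)); last first.
  have h1 : om * Z <= om * (2 + 2 * e1).
    by rewrite ler_wpM2l//; move: YZ; rewrite ler_norml => /andP[_]; lra.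
  (* Here the bound on the far mass Y enters: for Y <= 1 the left side is 1 + (F - 1) Y <= F, and
     beyond 1 the excess is at most e3. *)
  have h2 : F * Y + `|1 - Y| <= F + e3 * (1 + F).
    have [Y1'|Y1'] := leP Y 1.
      rewrite ger0_norm; last by lra.
      have : (F - 1) * Y <= (F - 1) * 1 by rewrite ler_wpM2l//; lra.
      have : 0 <= e3 * (1 + F) by rewrite mulr_ge0//; lra.
      lra.
    rewrite ltr0_norm; last by lra.
    have : F * Y <= F * (1 + e3) by rewrite ler_wpM2l.
    lra.
  have h3 : `|Z - 1| <= `|1 - Y| + 2 * e1.
    have -> : Z - 1 = (1 - Y) + (Y + Z - 2) by ring.
    by apply: le_trans (ler_normD _ _) _; rewrite lerD2l.
  lra.
apply: lerD => //; apply: le_trans (ler_normcD _ _) _; apply: lerD.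
  apply: le_trans (ler_normc_sum _ _ _) _; rewrite /Y mulr_sumr.
  rewrite big_nat [leRHS]big_nat; apply: ler_sum => k /andP[_ kn].
  have km := leq_trans kn nm.
  by rewrite normcM normc_conj normc_real ger0_norm ?mu0// ler_wpM2r ?mu0// fF.
apply: le_trans (ler_normcD _ _) _; apply: lerD.
  apply: le_trans (ler_normc_sum _ _ _) _; rewrite /Z mulr_sumr.
  rewrite big_nat [leRHS]big_nat; apply: ler_sum => k nkm.
  have /andP[_ km] := nkm.
  by rewrite normcM normc_conj normc_real ger0_norm ?mu0// ler_wpM2r ?mu0// near.
by rewrite normcM normc_conj normc_real ler_piMl.
Qed.

Lemma exists_large_nat (x : R) : exists2 l : nat, (0 < l)%N & x <= l%:R.
Proof.
exists (Num.truncn `|x|).+1 => //.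
apply: le_trans (ler_norm x) _; apply/ltW.
by have /andP[] := truncn_itv (normr_ge0 x).
Qed.

Lemma twopii_normc : normc (twopii R) = 2 * pi.
Proof.
rewrite /twopii normcM normc_real ger0_norm ?mulr_ge0 ?pi_ge0//.
by rewrite /= expr0n /= add0r expr1n sqrtr1 mulr1.
Qed.

Lemma twopii_neq0 : twopii R != 0.
Proof. by rewrite -normc_gt0 twopii_normc mulr_gt0// pi_gt0. Qed.

Lemma Re_div_twopii (w : C) : Re (w / twopii R) = Im w / (2 * pi).
Proof.
have p0 : 2 * pi != 0 :> R by rewrite mulf_neq0// gt_eqF// pi_gt0.
have -> : w / twopii R = (2 * pi)^-1%:C * (- 'i%C * w).
  apply: (mulIf twopii_neq0); rewrite divfK ?twopii_neq0// /twopii fmorphV/=.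
  have h : (2 * pi)%:C != 0 :> C by rewrite -normc0P normc_real normr_eq0.
  have i2 : 'i%C * 'i%C = -1 :> C by rewrite -expr2 sqr_i.
  transitivity (- ('i%C * 'i%C) * w); first by rewrite i2 opprK mul1r.
  by move: ((2 * pi)%:C) h => t h; field.
by rewrite cRe_mull cReM cReN cImN /= oppr0 mul0r sub0r mulN1r opprK mulrC.
Qed.

Variables (N : C -> R) (c0 c1 : R).
Hypothesis gN : gauge N c0 c1.
Variables (n : nat) (T : 'M[C]_n.+1) (mu0 : R).
Hypotheses (mu00 : 0 <= mu0) (mu01 : mu0 < 1) (Tmu : below N mu0 T).

Let G : set C := [set z | N z = 1].

(** Cauchy's formula on the curve N = 1 itself, where mu0 < 1 bounds the resolvents. The number of
    vertices depends on f but the resulting bound does not, so the supremum K is finite. *)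
Lemma gauge_finite_constant : exists K0, forall f : {poly C},
  unit_on G f 1 -> opbound (horner_mx T f) K0.
Proof.
have [D D0 HD] := vertex_loop gN; have [r r0 Tr] := opbound_exists T.
pose K := 2 * c1 / (1 - mu0).
exists ((2 * pi)^-1 * (D * (1 * K) + 1)) => f fu.
have [B B0 HB] := loop_cauchy gN D r mu00 mu01 f.
have [m m0 Bm] := exists_large_nat B.
have L : loop N 1 D m (vertex N 1 m) by apply: HD => //; rewrite ltr01 ler1n.
have mR : 0 < m%:R :> R by rewrite ltr0n.
have := HB _ _ _ _ L Tmu Tr; set S := \sum_(k < m) _ => HS.
have Sb : opbound S (D * (1 * K)).
  apply: (loop_sum_le L (F := fun k => f.[vertex N 1 m k] *: rsv T (vertex N 1 m k))).
  move=> k; apply: opbound_le (opboundZ _ (res_opbound gN mu00 mu01 L k Tmu)) _.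
  rewrite ler_wpM2r ?(res_bound_ge0 gN mu01)//.
  by apply: fu; exact: (loop_N L).
have -> : horner_mx T f = (twopii R)^-1 *: (S - (S - twopii R *: horner_mx T f)).
  by rewrite opprB addrC subrK scalerA mulVf ?twopii_neq0// scale1r.
rewrite -twopii_normc -normcV; apply: opboundZ; apply: opboundB => //.
by apply: opbound_le HS _; rewrite ler_pdivrMr// mul1r.
Qed.

End GaugeConstant.

Section GaugeCompanion.
Variable R : realType.
Local Notation C := R[i].
Local Notation Re := complex.Re.
Local Notation Im := complex.Im.

(** The companion approximates [gf], the discrete Cauchy transform of conj f, which is a combination
    of resolvents and hence a limit of polynomials. Its value [Gt] at T satisfies Ft + Gt^H = sum of
    f(z_k) (A_k + A_k^H). *)
Lemma gauge_companion (N : C -> R) (c0 c1 : R) (n : nat) (T : 'M[C]_n.+1)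
    (mu0 : R) (f : {poly C}) (e : R) :
  gauge N c0 c1 -> mu0 < 1 -> below N mu0 T ->
  unit_on [set z | N z = 1] f 1 -> 0 < e ->
  exists g : {poly C}, unit_on [set z | N z = 1] g (1 + e) /\
    opbound (horner_mx T f + adjmx (horner_mx T g)) (2 + e).
Proof.
(* All errors together stay below 40 e1, and e1 <= 1 / 40 absorbs the terms in e1^2. *)
move=> gN mu01 Tmu; set G := [set z | N z = 1] => fu e0; pose e1 := Num.min 1 e / 40.
have e10 : 0 < e1 by rewrite divr_gt0// lt_min ltr01.
have e11 : e1 <= 1 / 40 by rewrite ler_wpM2r// ge_min lexx.
have e1e : 40 * e1 <= e by rewrite /e1 mulrC divfK// ge_min lexx orbT.
have c00 := gauge_gt0 gN; have c10 := gauge_c1 gN.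
have [D D0 HD] := vertex_loop gN.
have [rT rT0 TrT] := opbound_exists T.
(* r bounds T and also the points with N = 1, so Cauchy's formula applies to both with the same
   error constant. *)
pose r := rT + c0^-1.
have rTr : rT <= r by rewrite lerDl invr_ge0 ltW.
have c0r : 1 / c0 <= r by rewrite /r mul1r lerDr.
have Tr : opbound T r by exact: opbound_le TrT rTr.
have [Lf Lf0 HLf] := horner_lipschitz f (2 / c0).
pose H : R := c0^-1 + c1 / c0 ^+ 2.
have H0 : 0 <= H by exact: gcis_lipschitz_ge0 gN.
have p0 := pi_gt0 R; have p2 := pi_ge2 R.
(* The order of choices matters: q makes f nearly constant on the near arc, sg then depends on
   [far_dist] at q, and the mesh l depends on sg. *)
have [q' q'0 Hq'] := exists_large_nat (Lf * (H * (3 * (2 * pi))) / e1).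
pose q := (q' + 3)%N; have q3 : (3 < q)%N by rewrite /q -[3%N]add0n ltn_add2r.
have qR : 0 < q%:R :> R by rewrite ltr0n (leq_trans _ q3).
have Hq : Lf * (H * (3 * (2 * pi / q%:R))) <= e1.
  have -> : Lf * (H * (3 * (2 * pi / q%:R))) = Lf * (H * (3 * (2 * pi))) / q%:R.
    by ring.
  rewrite ler_pdivrMr// [e1 * _]mulrC -ler_pdivrMr//; apply: le_trans Hq' _.
  by rewrite ler_nat /q leq_addr.
have kk0 := far_dist_gt0 gN q3.
have [sg [sg0 sg1 sgL sgD]] : exists sg, [/\ 0 < sg, sg <= 1,
    Lf * (sg / c0) <= e1 & D * (3 * sg / c0) / far_dist c1 q <= e1].
  pose X := Lf / c0 + D * (3 / c0) / far_dist c1 q + e1.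
  have X1 : 0 <= Lf / c0 by rewrite divr_ge0// ltW.
  have X2 : 0 <= D * (3 / c0) / far_dist c1 q.
    by apply: divr_ge0 (ltW kk0); apply: mulr_ge0 => //; rewrite divr_ge0// ltW.
  have X0 : 0 < X by rewrite /X; move: X1 X2 e10; clear; lra.
  have eX : 0 <= e1 / X by rewrite divr_ge0 ?ltW.
  exists (e1 / X); split.
  - by rewrite divr_gt0.
  - by rewrite ler_pdivrMr// mul1r /X; move: X1 X2; clear; lra.
  - have -> : Lf * (e1 / X / c0) = e1 / X * (Lf / c0) by ring.
    by rewrite mulrAC ler_pdivrMr// ler_wpM2l ?(ltW e10)// /X; move: X1 X2 e10; clear; lra.
  - have -> : D * (3 * (e1 / X) / c0) / far_dist c1 q =
        e1 / X * (D * (3 / c0) / far_dist c1 q) by ring.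
    by rewrite mulrAC ler_pdivrMr// ler_wpM2l ?(ltW e10)// /X; move: X1 X2 e10; clear; lra.
pose la := 1 + sg; have la1 : 1 < la by rewrite /la ltrDl.
have la02 : 0 < la <= 2 
  by rewrite /la; move: sg0 sg1; clear; move=> ? ?; apply/andP; split; lra.
(* Taken with inner level 1, so that it holds for T and for every x with N x = 1, with the polygon
   at level 1 + sg. *)
have [Bf Bf0 HBf] := loop_cauchy gN D r ler01 la1 f.
have [B1 B10 HB1] := loop_cauchy gN D r ler01 la1 1.
pose KK := ((sg^-1 + c1 * (6 / c0) / sg ^+ 2) ^+ 2 +
        (sg^-1 + c1 * (6 / c0) / sg ^+ 2) / sg) * (c1 * D) ^+ 2.
have [l l0 Hl] := exists_large_nat ((Bf + B1 + `|KK|) / e1 + c1 * D / sg).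
pose m := (q * l)%N.
have m0 : (0 < m)%N by rewrite muln_gt0 l0 (leq_trans _ q3).
have m3 : (3 < m)%N by apply: leq_trans q3 _; rewrite leq_pmulr.
have mR : 0 < m%:R :> R by rewrite ltr0n.
have lm : l%:R <= m%:R :> R by rewrite ler_nat leq_pmull// (leq_trans _ q3).
have cDs : 0 <= c1 * D / sg by rewrite divr_ge0 ?mulr_ge0 ?(ltW c10) ?(ltW sg0).
have small X : X <= Bf + B1 + `|KK| -> X / m%:R <= e1.
  move=> XX; rewrite ler_pdivrMr// [e1 * _]mulrC -ler_pdivrMr//.
  have : X / e1 <= (Bf + B1 + `|KK|) / e1 by rewrite ler_wpM2r ?invr_ge0 ?(ltW e10).
  by move: Hl lm cDs; clear; lra.
have Bfm : Bf / m%:R <= e1 by apply: small; move: Bf0 B10 (normr_ge0 KK); clear; lra.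
have B1m : B1 / m%:R <= e1 by apply: small; move: Bf0 B10 (normr_ge0 KK); clear; lra.
have KKm : KK / m%:R <= e1 by apply: small; move: Bf0 B10 (ler_norm KK); clear; lra.
have cDm : c1 * (D / m%:R) <= la - 1.
  rewrite mulrA ler_pdivrMr// /la addrAC subrr add0r [sg * _]mulrC -ler_pdivrMr//.
  have : 0 <= (Bf + B1 + `|KK|) / e1 by rewrite divr_ge0 ?addr_ge0// ?normr_ge0// ltW.
  by move: Hl lm; clear; lra.
pose z := vertex N la m; have L : loop N la D m z by exact: HD.
pose w k : C := (z k.+1 - z k) / twopii R.
have i2pi : (2 * pi)^-1 <= 1 / 4 :> R.
  by rewrite div1r lef_pV2 ?posrE ?mulr_gt0//; move: p2; clear; lra.
have t2 : twopii R != 0 := twopii_neq0 R.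
have t2n : normc (twopii R)^-1 <= 1 / 4 by rewrite normcV twopii_normc.
have wpos k t : N t <= 1 -> 0 <= Re (w k * (z k - t)^*).
  move=> Nt; have -> : w k * (z k - t)^* = ((z k - t)^* * (z k.+1 - z k)) / twopii R.
    by rewrite /w mulrAC [(_ - _) * _^*]mulrC.
  rewrite Re_div_twopii divr_ge0 ?mulr_ge0 ?(ltW p0)//.
  apply: (chord_support gN la1 (loop_N L k) (loop_N L k.+1) _ _ Nt).
    (* Consecutive vertices are turned by 2 pi / m < pi, so their cross product is positive. *)
    rewrite /z /vertex /gcis angleS; set t1 := angle R m k.
    set A := Ncis N _; set B := Ncis N _.
    have A0 : 0 < A by exact: Ncis_gt0 gN _.
    have B0 : 0 < B by exact: Ncis_gt0 gN _.
    rewrite crossE !(cRe_mull, cIm_mull) /=.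
    have -> : la * (A^-1 * cos t1) * (la * (B^-1 * sin (t1 + 2 * pi / m%:R))) -
      la * (A^-1 * sin t1) * (la * (B^-1 * cos (t1 + 2 * pi / m%:R))) =
      la ^+ 2 * (A^-1 * B^-1) * sin (2 * pi / m%:R).
      have -> : sin (2 * pi / m%:R) = sin (t1 + 2 * pi / m%:R - t1).
        by rewrite addrAC subrr add0r.
      by rewrite [sin (_ - t1)]sinB; ring.
    have la0 : 0 < la ^+ 2 by rewrite exprn_gt0// (lt_trans ltr01).
    have AB0 : 0 < A^-1 * B^-1 by rewrite mulr_gt0 ?invr_gt0.
    apply: mulr_gt0; first exact: mulr_gt0.
    apply: sin_gt0_pi; rewrite divr_gt0 ?mulr_gt0//=.
    by rewrite ltr_pdivrMr// mulrC ltr_pM2l// ltr_nat (leq_trans _ m3).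
  by apply: le_trans cDm; rewrite ler_wpM2l ?(ltW c10)// (loop_mesh L).
have fzk k : normc (f.[z k]) <= 1 + e1.
  have vG : G (gcis N (angle R m k)) by exact: (N_gcis gN).
  rewrite -(subrK f.[gcis N (angle R m k)] f.[z k]) addrC.
  apply: le_trans (ler_normcD _ _) _; apply: lerD; first exact: fu.
  have gc : normc (gcis N (angle R m k)) <= 1 / c0.
    by rewrite -(N_gcis gN (angle R m k)); exact: normc_le_gauge gN _.
  apply: le_trans (HLf _ _ _ _) _.
  - apply: le_trans (normc_le_gauge gN _) _; rewrite (loop_N L).
    by rewrite ler_wpM2r ?invr_ge0 ?(ltW c00)//; case/andP: la02.
  - by apply: le_trans gc _; rewrite ler_wpM2r ?invr_ge0 ?(ltW c00)// ler1n.
  - apply: le_trans sgL; rewrite ler_wpM2l//.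
    have -> : z k - gcis N (angle R m k) = sg%:C * gcis N (angle R m k).
      by rewrite /z /vertex /la rmorphD/= mulrDl mul1r addrC addKr.
    by rewrite normcM normc_real gtr0_norm// ler_wpM2l ?(ltW sg0)// -div1r.
(* The size is left free: it is used for T and for the 1 x 1 matrix x, with h = f and with h = 1. *)
have normalize n' (T' : 'M[C]_n'.+1) (h : {poly C}) B : below N 1 T' -> opbound T' r ->
    (forall m z n (T : 'M[C]_n.+1), loop N la D m z -> below N 1 T -> opbound T r ->
      opbound (\sum_(k < m) (z k.+1 - z k) *: (h.[z k] *: rsv T (z k)) -
             twopii R *: horner_mx T h) (B / m%:R)) -> B / m%:R <= e1 ->
    opbound (\sum_(k < m) h.[z k] *: (w k *: rsv T' (z k)) - horner_mx T' h) e1.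
  move=> T'1 T'r HB Bm.
  have -> : \sum_(k < m) h.[z k] *: (w k *: rsv T' (z k)) - horner_mx T' h =
    (twopii R)^-1 *: (\sum_(k < m) (z k.+1 - z k) *: (h.[z k] *: rsv T' (z k)) -
      twopii R *: horner_mx T' h).
    rewrite scalerBr scalerA mulVf// scale1r; congr (_ - _).
    rewrite scaler_sumr; apply: eq_bigr => k _; rewrite !scalerA /w.
    by congr (_ *: _); rewrite mulrCA mulrC; ring.
  apply: opbound_le (opboundZ _ (HB _ _ _ _ L T'1 T'r)) _.
  have := HB _ _ _ _ L T'1 T'r => /opbound_ge0 B0.
  apply: (@le_trans _ _ (1 * e1)); last by rewrite mul1r.
  apply: ler_pM; rewrite ?normc_ge0//.
  by apply: le_trans t2n _; clear; lra.
have T1 : below N 1 T.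
  by move=> x; apply: le_trans (Tmu x) _; rewrite ler_wpM2r ?sqr_ge0// ltW.
pose A k := w k *: rsv T (z k).
have Aacc k : accretive (A k).
  by apply: (accretive_rsv gN ler01 la1 L T1) => t; exact: wpos.
pose Ft := \sum_(k < m) f.[z k] *: A k.
pose Gt := \sum_(k < m) (f.[z k])^* *: A k.
have fFt : opbound (horner_mx T f - Ft) e1.
  by rewrite -opprB; apply: opboundN; exact: normalize HBf Bfm.
have SA : opbound (\sum_(k < m) A k) (1 + e1).
  have := normalize _ _ _ _ T1 Tr HB1 B1m; rewrite rmorph1.
  under eq_bigr do rewrite hornerC scale1r.
  move=> h; rewrite -[\sum_(k < m) A k](subrK 1) addrC.
  by apply: opboundD => //; exact: opbound1.
have FG : Ft + adjmx Gt = \sum_(k < m) f.[z k] *: (A k + adjmx (A k)).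
  have adjS I (s : seq I) (B : I -> 'M[C]_n.+1) :
      adjmx (\sum_(i <- s) B i) = \sum_(i <- s) adjmx (B i).
    elim/big_rec2: _ => [|i X Y _ <-]; last exact: adjmxD.
    by apply/matrixP => i j; rewrite !mxE rmorph0.
  rewrite adjS -big_split/=; apply: eq_bigr => k _; rewrite scalerDr.
  by congr (_ + _); apply/matrixP => i j; rewrite !mxE rmorphM/= conjcK.
have FGb : opbound (Ft + adjmx Gt) ((1 + e1) * (2 * (1 + e1))).
  rewrite FG; apply: (accretive_sum_opbound (f := fun k => f.[z k])) => //.
  by rewrite addr_ge0// ltW.
pose gf (x : C) := \sum_(k < m) (f.[z k])^* * w k * (z k - x)^-1.
have Gr x : G x -> normc x <= r.
  by move=> Gx; apply: le_trans c0r; rewrite -Gx; exact: normc_le_gauge gN _.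
have gapp : appr G T gf Gt.
  rewrite /gf /Gt; apply: (appr_sum (index_enum _)
    (phi := fun (k : 'I_m) x => (f.[z k])^* * w k * (z k - x)^-1)
    (Phi := fun k : 'I_m => (f.[z k])^* *: A k)) => k.
  rewrite /A scalerA; apply: (apprZ Gr).
  have la1' : 1 < N (z k) by rewrite (loop_N L).
  have [u [u0 _] [sep [uN uz]]] := below_separated gN la1' ler01 T1.
  apply: (appr_inv Gr _ u0 Tr sep); first by rewrite divr_gt0// subr_gt0.
  move=> x Gx; have := uN x; rewrite Gx mulrBr cReB -/(dotR u x) -/(dotR u (z k)).
  by move: uz; clear; lra.
have gfb x : G x -> normc (gf x) <= 1 + 20 * e1.
  move=> Gx; have [t t0 xt] := gcis_surj gN Gx.
  have d0 : 0 < 2 * pi / m%:R :> R by rewrite divr_gt0 ?mulr_gt0.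
  have [k0 tk0] := index_of_angle t0 d0.
  pose s := (k0 + l.+1)%N; pose nn := (m - 2 * l.+1)%N.
  pose a k := w k * (z k - x)^-1.
  have zm k : z (k + m)%N = z k by rewrite /z vertexDm.
  have am k : a (k + m)%N = a k by rewrite /a /w -addSn !zm.
  (* Renumbers the vertices cyclically so that the far arc comes first, as [kernel_bound]
     expects. *)
  have shift (F : nat -> C) : (forall k, F (k + m)%N = F k) ->
      \sum_(k < m) F k = \sum_(k < m) F (s + k)%N by move=> /(sum_period s) ->.
  have -> : gf x = \sum_(k < m) (f.[z (s + k)%N])^* * a (s + k)%N.
    rewrite -(shift (fun k => (f.[z k])^* * a k)); last by move=> k; rewrite zm am.
    by rewrite /gf; apply: eq_bigr => k _; rewrite /a [RHS]mulrA.
  have xr := Gr x Gx.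
  have x1 : below N 1 (x%:M : 'M[C]_1) by apply: (below_scalar gN); rewrite Gx.
  have xo : opbound (x%:M : 'M[C]_1) r := opbound_le (@opboundM_scalar _ 1 x) xr.
  have rsv1 k : rsv (x%:M : 'M[C]_1) (z k) = (z k - x)^-1%:M.
    by rewrite /rsv -raddfB/= -[_^-1]/(invmx _) invmx_scalar.
  have scal (h : {poly C}) : \sum_(k < m) h.[z k] *: (w k *: rsv (x%:M : 'M[C]_1) (z k))
      = (\sum_(k < m) h.[z k] * a k)%:M.
    rewrite raddf_sum/=; apply: eq_bigr => k _.
    by rewrite rsv1 scalerA scale_scalar_mx /a [in RHS]mulrA.
  have apos k : 0 <= Re (a k).
    have zx : z k - x != 0.
      apply/eqP => /subr0_eq zx; have := loop_N L k; rewrite -/z zx Gx.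
      by move=> la_eq; move: la1; rewrite -la_eq ltxx.
    have nzx : 0 < normc (z k - x) by rewrite normc_gt0.
    have -> : a k = w k * (z k - x)^* * (normc (z k - x) ^- 2)%:C.
      rewrite /a fmorphV/= -mul_conjc; have zxc : (z k - x)^* != 0 by rewrite conjc_eq0.
      move: zx zxc; move: (z k - x) (w k) => v w' v0 v0'.
      by field; apply/andP; split; [exact: v0' | exact: v0].
    by rewrite cRe_mulr mulr_ge0 ?invr_ge0 ?sqr_ge0// wpos// Gx.
  (* F exceeds 1 since the vertices lie at level 1 + sg; [om] adds the errors from level and angle
     in [near_vertex]; [e3] collects the two error terms of [far_mass]. The total is 1 + 12 e1 + 6
     e1^2. *)
  apply: le_trans (kernel_bound (F := 1 + e1) (om := 2 * e1) (e1 := e1) (e3 := 2 * e1)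
    (w := f.[x]) (n := nn) (a := fun k => a (s + k)%N)
    (f := fun k => f.[z (s + k)%N]) _ _ _ _ _ _ _ _ _ _ _) _ => //.
  - exact: leq_subr.
  - exact: fu.
  - by rewrite lerDl ltW.
  - rewrite -shift//; apply: opbound_scalar1; rewrite raddfB/=.
    have := normalize _ _ _ _ x1 xo HB1 B1m; rewrite scal rmorph1.
    have -> : \sum_(k < m) (1 : {poly C}).[z k] * a k = \sum_(k < m) a k.
      by apply: eq_bigr => k _; rewrite hornerC mul1r.
    by [].
  - rewrite -(shift (fun k => f.[z k] * a k)); last by move=> k; rewrite zm am.
    apply: opbound_scalar1; rewrite raddfB/= -horner_mx_scalar1 -scal.
    exact: normalize _ _ _ _ x1 xo HBf Bfm.
  - by rewrite mulr_ge0// ltW.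
  - by rewrite mulr_ge0// ltW.
  - have := far_mass gN q3 l0 tk0 (_ : 0 < sg <= 1) L.
    rewrite sg0 sg1 -/m -/z -xt -/s -/nn => /(_ isT) far.
    have -> : \sum_(k < nn) 2 * Re (a (s + k)%N) = pi^-1 * \sum_(i < nn)
        Im ((z (s + i).+1 - z (s + i)%N) / (z (s + i)%N - x)).
      rewrite mulr_sumr; apply: eq_bigr => k _.
      have -> : a (s + k)%N =
          (z (s + k).+1 - z (s + k)%N) / (z (s + k)%N - x) / twopii R.
        by rewrite /a /w mulrAC.
      by rewrite Re_div_twopii invfM mulrCA mulVKf ?pnatr_eq0// mulrC.
    rewrite mulrC ler_pdivrMr//; apply: le_trans far _.
    rewrite -/KK [(1 + _) * pi]mulrDl mul1r -[leLHS]addrA lerD2l.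
    have : 2 * e1 * 2 <= 2 * e1 * pi by rewrite ler_wpM2l// mulr_ge0// ltW.
    by move: KKm sgD e10; clear; lra.
  - move=> k nk; have nv := near_vertex gN q3 l0 tk0 nk (ltW sg0).
    rewrite -/m -/la -/z -/s -/H -xt in nv.
    apply: le_trans (HLf _ _ _ _) _.
    + apply: le_trans (normc_le_gauge gN _) _; rewrite (loop_N L).
      by rewrite ler_wpM2r ?invr_ge0 ?(ltW c00)//; case/andP: la02.
    + apply: le_trans (normc_le_gauge gN _) _; rewrite Gx.
      by rewrite ler_wpM2r ?invr_ge0 ?(ltW c00)// ler1n.
    + apply: le_trans (ler_wpM2l Lf0 nv) _; rewrite mulrDr.
      by move: sgL Hq; clear; lra.
  have : e1 * e1 <= e1 * (1 / 40) by rewrite ler_wpM2l ?(ltW e10).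
  by move: e10; clear; lra.
have [g [gG gT]] := gapp _ e10; exists g; split.
  move=> x Gx; rewrite -(subrK (gf x) g.[x]).
  apply: le_trans (ler_normcD _ _) _.
  by move: (gG x Gx) (gfb x Gx) e1e e10; clear; lra.
have -> : horner_mx T f + adjmx (horner_mx T g) = (horner_mx T f - Ft) +
    (Ft + adjmx Gt) + adjmx (horner_mx T g - Gt).
  have adjB (X Y : 'M[C]_n.+1) : adjmx (X - Y) = adjmx X - adjmx Y.
    by apply/matrixP => i j; rewrite !mxE rmorphB.
  by rewrite adjB [_ - Ft + _]addrA subrK -addrA [adjmx Gt + _]addrC subrK.
apply: opbound_le (opboundD (opboundD fFt FGb) (opbound_adj _ gT)) _.
  exact: ltW.
have : e1 * e1 <= e1 * (1 / 40) by rewrite ler_wpM2l ?(ltW e10).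
by move: e1e e10; clear; lra.
Qed.

Lemma gauge_spectral_constant (N : C -> R) (c0 c1 : R) (n : nat)
    (T : 'M[C]_n.+1) (mu0 : R) (phi : C -> C) (Phi : 'M[C]_n.+1) (M : R) :
  gauge N c0 c1 -> 0 <= mu0 -> mu0 < 1 -> below N mu0 T ->
  appr [set z | N z = 1] T phi Phi ->
  (forall z, N z = 1 -> normc (phi z) <= M) -> 0 <= M ->
  opbound Phi ((1 + Num.sqrt 2) * M).
Proof.
move=> gN mu00 mu01 Tmu; apply: spectral_constant_appr.
  exact: (gauge_finite_constant gN mu00 mu01 Tmu).
by move=> f fu e e0; exact: (gauge_companion gN mu01 Tmu fu e0).
Qed.

End GaugeCompanion.

(** * Rational functions on a convex set *)

Section ConvexGauge.
Variable R : realType.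
Local Notation C := R[i].
Local Notation Re := complex.Re.
Local Notation Im := complex.Im.

Definition segment_closed (S : set C) : Prop :=
  forall x y (t : R), S x -> S y -> 0 <= t <= 1 ->
    S (t%:C * x + (1 - t)%:C * y).

Variables (S : set C) (rho de : R).
Hypothesis (S_conv : segment_closed S).
Hypotheses (S0 : S 0) (Srho : forall s, S s -> normc s <= rho) (de0 : 0 < de).

Let rho0 : 0 <= rho.
Proof. exact: le_trans (normc_ge0 _) (Srho S0). Qed.

Definition support_fun (u : C) : R := sup [set dotR u s | s in S].
(* The gauge of [S] enlarged by a disc of radius [de], through support functions. *)
Definition thick_gauge (v : C) : R :=
  sup [set dotR u v / (support_fun u + de) | u in [set u | normc u = 1]].

Let H := support_fun.
Let N := thick_gauge.

Lemma support_fun_ubound u : normc u = 1 -> has_ubound [set dotR u s | s in S].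
Proof.
move=> u1; exists rho => _ [s Ss <-]; apply: le_trans (dotR_le _ _) _.
by rewrite u1 mul1r Srho.
Qed.

Lemma dotR_support u s : normc u = 1 -> S s -> dotR u s <= H u.
Proof. by move=> u1 Ss; apply: ub_le_sup; [exact: support_fun_ubound | exists s]. Qed.

Lemma support_fun_ge0 u : normc u = 1 -> 0 <= H u.
Proof. by move=> u1; have := dotR_support u1 S0; rewrite /dotR mulr0. Qed.

Lemma support_fun_le u (b : R) : (forall s, S s -> dotR u s <= b) -> H u <= b.
Proof.
move=> Sb; apply: ge_sup; first by exists (dotR u 0), 0.
by move=> _ [s Ss <-]; exact: Sb.
Qed.

Lemma support_fun_le_rho u : normc u = 1 -> H u <= rho.
Proof.
move=> u1; apply: support_fun_le => s Ss; apply: le_trans (dotR_le _ _) _.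
by rewrite u1 mul1r Srho.
Qed.

Lemma thick_gauge_ubound v :
  has_ubound [set dotR u v / (H u + de) | u in [set u | normc u = 1]].
Proof.
exists (normc v / de) => _ [u u1 <-]; have h0 := support_fun_ge0 u1.
rewrite ler_pdivrMr ?ltr_wpDl//; apply: le_trans (dotR_le _ _) _.
rewrite u1 mul1r mulrAC -mulrA ler_peMr ?normc_ge0// ler_pdivlMr//.
by rewrite mul1r lerDr.
Qed.

Lemma thick_gauge_ge u v : normc u = 1 -> dotR u v / (H u + de) <= N v.
Proof.
by move=> u1; apply: ub_le_sup; [exact: thick_gauge_ubound | exists u].
Qed.

Lemma thick_gauge_le v (b : R) :
  (forall u, normc u = 1 -> dotR u v / (H u + de) <= b) -> N v <= b.
Proof.
move=> vb; apply: ge_sup => [|_ [u u1 <-]]; last exact: vb.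
by exists (dotR 1 v / (H 1 + de)), 1 => //=; exact: normc1.
Qed.

Lemma dotRDr (u v w : C) : dotR u (v + w) = dotR u v + dotR u w.
Proof. by rewrite /dotR mulrDr cReD. Qed.

Lemma dotRZr (u : C) (t : R) (v : C) : dotR u (t%:C * v) = t * dotR u v.
Proof. by rewrite /dotR mulrCA cRe_mull. Qed.

Lemma dotRZl (u : C) (t : R) (v : C) : dotR (t%:C * u) v = t * dotR u v.
Proof.
rewrite /dotR !cReM !cReJ !cImJ cRe_mull cIm_mull; ring.
Qed.

Lemma dotRxx (u : C) : dotR u u = normc u ^+ 2.
Proof. by rewrite /dotR mulrC mul_conjc. Qed.

Let Hde u : normc u = 1 -> 0 < H u + de.
Proof. by move=> u1; rewrite ltr_wpDl// support_fun_ge0. Qed.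

Lemma normalizeR (v : C) : v != 0 -> normc ((normc v)^-1%:C * v) = 1.
Proof.
by move=> v0; rewrite normcM normc_real ger0_norm ?invr_ge0 ?normc_ge0// mulVf ?normc0P.
Qed.

Lemma thick_gauge_gauge : gauge N (rho + de)^-1 de^-1.
Proof.
have Zle t v : 0 < t -> N (t%:C * v) <= t * N v.
  move=> t0; apply: thick_gauge_le => u u1.
  by rewrite dotRZr -mulrA ler_wpM2l ?(ltW t0)// thick_gauge_ge.
split.
- by rewrite invr_gt0 ltr_wpDl.
- move=> v w; apply: thick_gauge_le => u u1; rewrite dotRDr mulrDl.
  by apply: lerD; exact: thick_gauge_ge.
- move=> t v; rewrite le_eqVlt => /orP[/eqP<-|t0].
    rewrite !mul0r; apply/eqP; rewrite eq_le; apply/andP; split.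
      by apply: thick_gauge_le => u u1; rewrite /dotR mulr0 mul0r.
    by have := thick_gauge_ge 0 (@normc1 R); rewrite /dotR mulr0 mul0r.
  apply/eqP; rewrite eq_le Zle//= -ler_pdivlMl//.
  have := Zle t^-1 (t%:C * v); rewrite invr_gt0 => /(_ t0).
  by rewrite mulrA -rmorphM/= mulVf ?gt_eqF// mul1r.
- move=> v; have [->|v0] := eqVneq v 0.
    by rewrite normc0 mulr0; have := thick_gauge_ge 0 (@normc1 R); rewrite /dotR mulr0 mul0r.
  have u1 := normalizeR v0; apply: le_trans (thick_gauge_ge v u1).
  rewrite dotRZl dotRxx expr2 mulKf ?normc0P// mulrC ler_wpM2l ?normc_ge0//.
  by rewrite lef_pV2 ?posrE ?Hde ?lerD2r ?support_fun_le_rho// ltr_wpDl.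
- move=> v; apply: thick_gauge_le => u u1; have h0 := support_fun_ge0 u1.
  rewrite ler_pdivrMr ?Hde//; apply: le_trans (dotR_le _ _) _.
  rewrite u1 mul1r [leRHS]mulrAC ler_peMl ?normc_ge0//.
  by rewrite mulrC ler_pdivlMr// mul1r lerDr.
- move=> v e e0.
  have hs : has_sup [set dotR u v / (H u + de) | u in [set u | normc u = 1]].
    split; last exact: thick_gauge_ubound.
    by exists (dotR 1 v / (H 1 + de)), 1 => //=; exact: normc1.
  have [_ [u u1 <-] h] := sup_adherent e0 hs.
  exists ((H u + de)^-1%:C * u) => [w|]; rewrite dotRZl mulrC.
    exact: thick_gauge_ge.
  exact: ltW.
Qed.

(** On S each quotient in the gauge is at most H u / (H u + de) with H u <= rho. The level is
    strictly below 1, so resolvents stay bounded on the curve N = 1. *)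
Lemma thick_gauge_below n (T : 'M[C]_n) :
  (forall x, vnorm2 x = 1 -> S (dotc x (T *m x))) ->
  below N (rho / (rho + de)) T.
Proof.
move=> TS x; have gN := thick_gauge_gauge.
have [->|x0] := eqVneq x 0.
  rewrite mulmx0 vnorm2_0 expr0n mulr0 dotcE big1 ?(gauge0 gN)// => i _.
  by rewrite [X in _ * X]mxE mulr0.
have nx : 0 < vnorm2 x by rewrite vnorm2_gt0.
have := TS _ (vnorm2_normalize x0).
rewrite -scalemxAr dotcZr dotcZl mulrA.
have -> : (vnorm2 x)^-1%:C * ((vnorm2 x)^-1%:C)^* = ((vnorm2 x)^-1 ^+ 2)%:C.
  by rewrite mul_conjc normc_real ger0_norm// invr_ge0 ltW.
set y := dotc x (T *m x) => Sy.
have -> : y = (vnorm2 x ^+ 2)%:C * (((vnorm2 x)^-1 ^+ 2)%:C * y).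
  by rewrite mulrA -rmorphM/= -exprMn mulfV ?gt_eqF// expr1n mul1r.
rewrite (gaugeZ gN) ?sqr_ge0// mulrC ler_wpM2r ?sqr_ge0//.
apply: thick_gauge_le => u u1; have h0 := support_fun_ge0 u1.
have h1 := support_fun_le_rho u1; have h2 := dotR_support u1 Sy.
have rd : 0 < rho + de by rewrite ltr_wpDl.
rewrite ler_pdivrMr ?Hde// mulrAC ler_pdivlMr//.
apply: le_trans (ler_wpM2r (ltW rd) h2) _.
by rewrite !mulrDr [rho * _]mulrC lerD2l ler_wpM2r// ltW.
Qed.

(* Almost-nearest points replace the projection on the closure of [S]. *)
Lemma thick_gauge_near v (eta : R) : N v <= 1 -> 0 < eta ->
  exists2 s, S s & normc (v - s) <= de + eta.
Proof.
move=> Nv eta0; pose A := [set normc (v - s) | s in S].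
have Ai : has_inf A.
  split; first by exists (normc (v - 0)), 0.
  by exists 0 => _ [s _ <-]; exact: normc_ge0.
have [d dE] : exists d, d = inf A by eexists.
have dle s : S s -> d <= normc (v - s).
  by move=> Ss; rewrite dE; apply: ge_inf; [case: Ai | exists s].
have [dde|ded] := leP d de.
  have [_ [s Ss <-] h] := inf_adherent eta0 Ai.
  exists s => //; by apply: le_trans (ltW h) _; rewrite -dE lerD2r.
(* If d > de, an almost nearest point p, with g = |v - p| and the direction of v - p in the gauge,
   yields g (g - de) <= 3/4 B, against B <= g (g - de). *)
exfalso; pose B := d * (d - de).
have d0 : 0 < d by exact: lt_trans de0 ded.
have B0 : 0 < B by rewrite mulr_gt0// subr_gt0.
(* The point at fraction t from p to s is in S, hence at distance at least d from v. So the inner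
   product of v - p and s - p is at most half of (g^2 - d^2) / t + t |s - p|^2; t makes the last
   term at most B, and k below makes the first at most B / 2. *)
pose t := Num.min 1 (B / (4 * rho ^+ 2 + 1)).
have r20 : 0 < 4 * rho ^+ 2 + 1 by rewrite ltr_wpDl// mulr_ge0 ?sqr_ge0.
have t0 : 0 < t by rewrite lt_min ltr01 divr_gt0.
have t1 : t <= 1 by rewrite ge_min lexx.
have tB : t * (4 * rho ^+ 2) <= B.
  have : t * (4 * rho ^+ 2 + 1) <= B by rewrite -ler_pdivlMr// ge_min lexx orbT.
  lra.
pose k := Num.min 1 (t * B / (2 * d + 1) / 2).
have d21 : 0 < 2 * d + 1 by lra.
have k0 : 0 < k by rewrite lt_min ltr01 divr_gt0// divr_gt0// mulr_gt0.
have k1 : k <= 1 by rewrite ge_min lexx.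
have kB : k * (2 * d + 1) <= t * B / 2.
  by rewrite -ler_pdivlMr// mulrAC ge_min lexx orbT.
have [_ [p Sp <-] gk] := inf_adherent k0 Ai; rewrite -dE in gk.
set g := normc (v - p) in gk.
have dg : d <= g by exact: dle.
have g0 : 0 < g by lra.
have vp : v - p != 0 by rewrite -normc_gt0.
have g2 : g ^+ 2 - d ^+ 2 <= t * B / 2.
  apply: le_trans kB; have -> : g ^+ 2 - d ^+ 2 = (g - d) * (g + d) by ring.
  by apply: ler_pM; lra.
have Sineq s : S s -> dotR (v - p) (s - p) <= 3 / 4 * B.
  move=> Ss; have Sq : S (t%:C * s + (1 - t)%:C * p).
    by apply: S_conv => //; rewrite (ltW t0).
  have := dle _ Sq.
  have -> : v - (t%:C * s + (1 - t)%:C * p) = (v - p) - t%:C * (s - p).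
    by rewrite rmorphB/= rmorph1; ring.
  rewrite -(ler_pXn2r (_ : 0 < 2)%N)// ?nnegrE ?normc_ge0 ?(ltW d0)//.
  rewrite normc_sqr !cReB !cImB !cRe_mull !cIm_mull !cReB !cImB.
  have spr : normc (s - p) <= 2 * rho.
    apply: le_trans (ler_normcB _ _) _; have := Srho Ss; have := Srho Sp; lra.
  have : normc (s - p) ^+ 2 <= (2 * rho) ^+ 2.
    by rewrite ler_pXn2r ?nnegrE ?normc_ge0// mulr_ge0.
  have := normc_sqr (v - p); rewrite -/g normc_sqr.
  rewrite /dotR cReM cReJ cImJ !cReB !cImB.
  set a := Re v - Re p; set b := Im v - Im p.
  set x := Re s - Re p; set y := Im s - Im p.
  move=> gE xyr h.
  have h1 : t * (2 * (a * x + b * y)) <= t * (B / 2 + t * (4 * rho ^+ 2)).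
    have : t ^+ 2 * (x ^+ 2 + y ^+ 2) <= t ^+ 2 * (2 * rho) ^+ 2.
      by rewrite ler_wpM2l ?sqr_ge0.
    move: h g2; rewrite gE; lra.
  move: h1; rewrite ler_pM2l//; lra.
have u1 := normalizeR vp; rewrite -/g in u1.
have := le_trans (thick_gauge_ge v u1) Nv.
rewrite ler_pdivrMr ?Hde// mul1r.
have Hle : H (g^-1%:C * (v - p)) <= dotR (g^-1%:C * (v - p)) p + g^-1 * (3 / 4 * B).
  apply: support_fun_le => s Ss.
  rewrite -lerBlDl -dotRBr dotRZl ler_wpM2l ?invr_ge0 ?(ltW g0)//.
  exact: Sineq.
have gE : dotR (g^-1%:C * (v - p)) v = g + dotR (g^-1%:C * (v - p)) p.
  have -> : dotR (g^-1%:C * (v - p)) v = dotR (g^-1%:C * (v - p)) ((v - p) + p).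
    by rewrite subrK.
  rewrite dotRDr; congr (_ + _).
  by rewrite dotRZl dotRxx -/g expr2 mulKf ?gt_eqF.
rewrite gE => h.
have h2 : (g - de) * g <= 3 / 4 * B.
  by rewrite -ler_pdivlMr// [_ / g]mulrC; move: h Hle; set X := dotR _ p; lra.
have h3 : B <= (g - de) * g by rewrite /B mulrC; apply: ler_pM; lra.
lra.
Qed.

End ConvexGauge.

(** * From polynomials to rational functions *)

Section RationalCalculus.
Variable R : realType.
Local Notation C := R[i].

Lemma horner_mx_comp_shift n (T : 'M[C]_n.+1) (p : {poly C}) c :
  horner_mx T (p \Po ('X + c%:P)) = horner_mx (T + c%:M) p.
Proof.
elim/poly_ind: p => [|p b IH]; first by rewrite comp_poly0 !rmorph0.
rewrite comp_polyD comp_polyM comp_polyX comp_polyC !rmorphD !rmorphM/= IH.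
by rewrite rmorphD/= !horner_mx_X !horner_mx_C.
Qed.

(** Each linear factor has its root outside the level set N <= 1, so its inverse is a limit of
    polynomials by [appr_inv]; products preserve this. *)
Lemma appr_inv_roots (N : C -> R) c0 c1 n (T : 'M[C]_n.+1) (rs : seq C) :
  gauge N c0 c1 -> below N 1 T -> (forall a, a \in rs -> 1 < N a) ->
  let q := \prod_(a <- rs) ('X - a%:P) in
  horner_mx T q \is a GRing.unit /\
  appr [set z | N z = 1] T (fun z => q.[z]^-1) (horner_mx T q)^-1.
Proof.
move=> gN T1; have c00 := gauge_gt0 gN; have [rT rT0 TrT] := opbound_exists T.
pose r := rT + c0^-1.
have Tr : opbound T r by apply: opbound_le TrT _; rewrite lerDl invr_ge0 ltW.
have Gr z : [set z | N z = 1] z -> normc z <= r.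
  move=> z1; apply: le_trans (normc_le_gauge gN z) _.
  by rewrite z1 div1r /r lerDr.
elim: rs => [|a rs IH] rsN /=.
  rewrite big_nil rmorph1 unitr1 invr1; split=> //.
  have := appr_const [set z | N z = 1] T 1; apply: eq_appr => z _.
  by rewrite hornerC invr1.
rewrite big_cons; have [|uq aq] := IH.
  by move=> b brs; apply: rsN; rewrite inE brs orbT.
have a1 : 1 < N a by apply: rsN; rewrite inE eqxx.
have [u [u0 _] [sep [uN ua]]] := below_separated gN a1 ler01 T1.
have d0 : 0 < (N a - 1) / 2 by rewrite divr_gt0// subr_gt0.
have ua' := separated_unit d0 sep.
rewrite rmorphM/= rmorphB/= horner_mx_X horner_mx_C.
have Ta : T - a%:M = - (a%:M - T) by rewrite opprB.
have uTa : T - a%:M \is a GRing.unit by rewrite Ta unitrN.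
split; first by rewrite unitrMl.
rewrite (invrM uTa uq) Ta invrN.
have inva : appr [set z | N z = 1] T (fun z => (a - z)^-1) (invmx (a%:M - T)).
  apply: (appr_inv Gr d0 u0 Tr sep) => z /= z1.
  have := uN z; rewrite z1 mulrBr cReB -/(dotR u z) -/(dotR u a); lra.
have := apprM Gr aq (apprZ Gr (-1) inva).
rewrite scaleN1r -mulmxE; apply: eq_appr => z _.
by rewrite hornerM hornerXsubC invfM mulN1r -invrN opprB mulrC.
Qed.

Lemma closed_roots (q : {poly C}) : q != 0 ->
  exists2 rs : seq C, q = lead_coef q *: \prod_(a <- rs) ('X - a%:P) &
    forall a, a \in rs -> q.[a] = 0.
Proof.
move=> q0; have [rs qE] := closed_field_poly_normal q; exists rs => // a ars.
by apply/rootP; rewrite qE rootZ ?lead_coef_eq0// root_prod_XsubC.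
Qed.

Lemma crouzeix_palencia_at0 n (T : 'M[C]_n.+1) (S : set C) (rho : R)
    (p q : {poly C}) (M : R) :
  segment_closed S -> S 0 -> (forall s, S s -> normc s <= rho) ->
  (forall x, vnorm2 x = 1 -> S (dotc x (T *m x))) ->
  coprimep p q -> 0 <= M -> (forall s, S s -> normc p.[s] <= M * normc q.[s]) ->
  horner_mx T q \is a GRing.unit /\
  opbound (horner_mx T p * (horner_mx T q)^-1) ((1 + Num.sqrt 2) * M).
Proof.
move=> Sconv S0 Srho TS pq M0 pMq.
have rho0 : 0 <= rho by exact: le_trans (normc_ge0 _) (Srho _ S0).
(* A Bezout relation a p + b q = 1 with |p| <= M |q| gives 1 <= (A M + B) |q| on S, so q is bounded
   away from 0 there. *)
have [k k0 qk] : exists2 k, 0 < k & forall s, S s -> k <= normc q.[s].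
  have /Bezout_eq1_coprimepP[[a b] /= ab] := pq.
  have [A A0 aA] := horner_bounded a rho; have [B B0 bB] := horner_bounded b rho.
  have AB0 : 0 < A * M + B + 1 by rewrite ltr_wpDl// addr_ge0// mulr_ge0.
  exists (A * M + B + 1)^-1 => [|s Ss]; first by rewrite invr_gt0.
  have ab1 : 1 <= normc (a.[s] * p.[s] + b.[s] * q.[s]).
    by rewrite -!hornerM -hornerD ab hornerC normc1.
  rewrite -div1r ler_pdivrMr//; apply: le_trans ab1 _.
  apply: le_trans (ler_normcD _ _) _; rewrite !normcM; have sr := Srho _ Ss.
  apply: (@le_trans _ _ (A * (M * normc q.[s]) + B * normc q.[s])).
    by apply: lerD; apply: ler_pM; rewrite ?normc_ge0 ?aA ?bB ?pMq.
  have := normc_ge0 q.[s]; lra.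
have q0 : q != 0.
  apply/eqP => q0; have := qk _ S0; rewrite q0 horner0 normc0; lra.
have [Lp Lp0 HLp] := horner_lipschitz p (rho + 2).
have [Lq Lq0 HLq] := horner_lipschitz q (rho + 2).
have [rs qE rsq] := closed_roots q0.
pose c := 1 + Num.sqrt 2 : R.
suff key e : 0 < e -> horner_mx T q \is a GRing.unit /\
    opbound (horner_mx T p * (horner_mx T q)^-1) (c * (M + e)).
  split; first by have [] := key 1 ltr01.
  move=> x; apply: (@ler_eps _ _ _ (c * vnorm2 x)).
    by rewrite mulr_ge0 ?vnorm2_ge0 ?addr_ge0 ?sqrtr_ge0.
  move=> e e0; have [_ /(_ x)] := key e e0; rewrite -/c; lra.
move=> e0.
(* Points with N <= 1 are within 2 de of S. The first summand keeps |q| >= k / 2 at them, the second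
   keeps |p| <= (M + e) |q|; the 1 ensures de <= 1, whence the radius rho + 2 of the Lipschitz
   bounds. *)
pose X := Lq / k + (M * Lq + Lp) / k / e + 1.
have X1 : 0 <= Lq / k := divr_ge0 Lq0 (ltW k0).
have X2 : 0 <= (M * Lq + Lp) / k / e :=
  divr_ge0 (divr_ge0 (addr_ge0 (mulr_ge0 M0 Lq0) Lp0) (ltW k0)) (ltW e0).
have X0 : 1 <= X by rewrite /X; lra.
pose de := (4 * X)^-1.
have de0 : 0 < de by rewrite invr_gt0; lra.
have de1 : de <= 1 by rewrite invf_le1; lra.
have deq : 4 * de * Lq <= k.
  have : Lq <= k * X by rewrite mulrC -ler_pdivrMr// /X; lra.
  have X40 : X != 0 by rewrite gt_eqF//; lra.
  have -> : 4 * de * Lq = Lq / X by rewrite /de; field.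
  by rewrite ler_pdivrMr//; lra.
have deM : 4 * de * (M * Lq + Lp) <= k * e.
  have : (M * Lq + Lp) <= k * e * X.
    by rewrite [_ * X]mulrC -ler_pdivrMr ?mulr_gt0// invfM mulrA /X; lra.
  have X40 : X != 0 by rewrite gt_eqF//; lra.
  have -> : 4 * de * (M * Lq + Lp) = (M * Lq + Lp) / X by rewrite /de; field.
  by rewrite ler_pdivrMr//; lra.
pose N := thick_gauge S de.
have gN := thick_gauge_gauge S0 Srho de0; rewrite -/N in gN.
have TN := thick_gauge_below S0 Srho de0 TS; rewrite -/N in TN.
pose mu := rho / (rho + de).
have rd : 0 < rho + de by rewrite ltr_wpDl.
have mu0 : 0 <= mu by rewrite divr_ge0// ltW.
have mu1 : mu < 1 by rewrite ltr_pdivrMr// mul1r ltrDl.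
have T1 : below N 1 T.
  by move=> x; apply: le_trans (TN x) _; rewrite ler_wpM2r ?sqr_ge0// ltW.
have near z : N z <= 1 -> exists2 s, S s & normc (z - s) <= 2 * de.
  move=> /(thick_gauge_near Sconv S0 Srho de0)/(_ de0)[s Ss zs]; exists s => //.
  by move: zs; lra.
have bnd z s : S s -> normc (z - s) <= 2 * de -> normc z <= rho + 2 /\ normc s <= rho + 2.
  move=> Ss zs; have sr := Srho _ Ss; split; last by lra.
  rewrite -(subrK s z); apply: le_trans (ler_normcD _ _) _; lra.
have qz z : N z <= 1 -> k / 2 <= normc q.[z].
  move=> /near[s Ss zs]; have [zr sr] := bnd _ _ Ss zs.
  have := HLq _ _ sr zr; have := ler_dist_normc q.[s] q.[z]; have := qk _ Ss.
  have : Lq * normc (s - z) <= Lq * (2 * de) by rewrite ler_wpM2l// normc_distC.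
  lra.
have pz z : N z <= 1 -> normc p.[z] <= (M + e) * normc q.[z].
  move=> Nz; have [s Ss zs] := near _ Nz; have [zr sr] := bnd _ _ Ss zs.
  have h1 := HLq _ _ sr zr; have h2 := ler_dist_normc q.[s] q.[z].
  have h3 := HLp _ _ zr sr; have h4 := ler_dist_normc p.[z] p.[s].
  have h5 := pMq _ Ss; have h6 := qz _ Nz.
  have h7 : Lq * normc (s - z) <= Lq * (2 * de) by rewrite ler_wpM2l// normc_distC.
  have h8 : Lp * normc (z - s) <= Lp * (2 * de) by rewrite ler_wpM2l.
  have h9 : M * normc q.[s] <= M * (normc q.[z] + Lq * (2 * de)).
    by rewrite ler_wpM2l//; lra.
  have h10 : e * (k / 2) <= e * normc q.[z] by rewrite ler_wpM2l// ltW.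
  lra.
have rsN a : a \in rs -> 1 < N a.
  move=> ars; rewrite ltNge; apply/negP => /qz.
  by rewrite rsq// normc0; lra.
have [uq aq] := appr_inv_roots gN T1 rsN.
set Q := \prod_(a <- rs) _ in qE uq aq.
have lq0 : lead_coef q != 0 by rewrite lead_coef_eq0.
have uq' : horner_mx T q \is a GRing.unit.
  by rewrite qE horner_mxZ scaler_unit// unitfE.
split=> //.
have Gr z : [set z | N z = 1] z -> normc z <= (rho + de).
  move=> z1; apply: le_trans (normc_le_gauge gN z) _.
  by rewrite z1 div1r invrK.
have ap := apprM Gr (appr_poly [set z | N z = 1] T p) (apprZ Gr (lead_coef q)^-1 aq).
have E : (horner_mx T q)^-1 = (lead_coef q)^-1 *: (horner_mx T Q)^-1.
  by rewrite {1}qE horner_mxZ invrZ// unitfE.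
rewrite E -mulmxE.
apply: (gauge_spectral_constant gN mu0 mu1 TN ap) => [z z1|]; last by rewrite addr_ge0// ltW.
have q0z : 0 < normc q.[z] by apply: lt_le_trans (qz z _); rewrite ?z1//; lra.
have -> : p.[z] * ((lead_coef q)^-1 * Q.[z]^-1) = p.[z] / q.[z].
  by rewrite {2}qE hornerZ invfM.
by rewrite normcM normcV ler_pdivrMr// pz// z1.
Qed.

End RationalCalculus.

Section ShiftedCalculus.
Variable R : realType.
Local Notation C := R[i].

(** The gauge needs a bounded set containing 0. A point c of the numerical range is moved to 0 and S
    is cut by a disc of radius a norm bound of T - c, which still contains the shifted numerical
    range. *)
Theorem crouzeix_palencia n (T : 'M[C]_n.+1) (S : set C) (p q : {poly C}) (M : R) :
  segment_closed S -> (forall x, vnorm2 x = 1 -> S (dotc x (T *m x))) ->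
  coprimep p q -> 0 <= M -> (forall s, S s -> normc p.[s] <= M * normc q.[s]) ->
  horner_mx T q \is a GRing.unit /\
  opbound (horner_mx T p * (horner_mx T q)^-1) ((1 + Num.sqrt 2) * M).
Proof.
move=> Sconv TS pq M0 pMq.
pose e : 'cV[C]_n.+1 := delta_mx 0 0.
have e0 : e != 0.
  by apply/eqP => /matrixP/(_ 0 0); rewrite !mxE eqxx => /eqP; rewrite oner_eq0.
have Se := TS _ (vnorm2_normalize e0); set c := dotc _ _ in Se.
pose T' := T - c%:M; have [rho rho0 T'rho] := opbound_exists T'.
pose S' := [set s | S (s + c) /\ normc s <= rho].
have TE (r : {poly C}) : horner_mx T' (r \Po ('X + c%:P)) = horner_mx T r.
  by rewrite horner_mx_comp_shift subrK.
have rE (r : {poly C}) s : (r \Po ('X + c%:P)).[s] = r.[s + c].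
  by rewrite horner_comp !hornerE.
rewrite -!TE; apply: (@crouzeix_palencia_at0 _ _ _ S' rho) => //.
- move=> x y t [Sx xr] [Sy yr] /[dup] t01 /andP[t0 t1]; split.
    have -> : t%:C * x + (1 - t)%:C * y + c = t%:C * (x + c) + (1 - t)%:C * (y + c).
      by rewrite rmorphB/= rmorph1; ring.
    exact: Sconv.
  apply: le_trans (ler_normcD _ _) _; rewrite !normcM !normc_real !ger0_norm ?subr_ge0//.
  have -> : rho = t * rho + (1 - t) * rho by ring.
  by apply: lerD; rewrite ler_wpM2l ?subr_ge0.
- by split; rewrite ?add0r ?normc0.
- by move=> s [].
- move=> x x1; split.
    by rewrite mulmxBl mul_scalar_mx dotcDr dotcNr dotcZr dotcxx x1 expr1n mulr1
      subrK; exact: TS.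
  apply: le_trans (dotc_le _ _) _; rewrite x1 mul1r.
  by apply: le_trans (T'rho x) _; rewrite x1 mulr1.
- have /Bezout_eq1_coprimepP[[a b] /= ab] := pq.
  apply/Bezout_eq1_coprimepP; exists (a \Po ('X + c%:P), b \Po ('X + c%:P)) => /=.
  by rewrite -!comp_polyM -comp_polyD ab comp_polyC.
- by move=> s [Ss _]; rewrite !rE; exact: pMq.
Qed.

End ShiftedCalculus.

(** * Sylvester and Riccati equations *)

Section Sylvester.
Variable R : realType.
Local Notation C := R[i].

Lemma horner_mx_wide n (T : 'M[C]_n.+1) (p : {poly C}) k : (size p <= k)%N ->
  horner_mx T p = \sum_(i < k) p`_i *: T ^+ i.
Proof.
move=> pk; have {1}-> : p = \sum_(i < k) p`_i *: 'X^i.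
  rewrite -poly_def; apply/polyP => i; rewrite coef_poly.
  by case: ltnP => // ki; rewrite nth_default// (leq_trans pk).
rewrite rmorph_sum; apply: eq_bigr => i _.
by rewrite /= horner_mxZ rmorphXn/= horner_mx_X.
Qed.

Section Rank.
Variables (m n h : nat) (B : 'M[C]_m.+1) (G : 'M[C]_n.+1) (Y : 'M[C]_(m.+1, n.+1)).
Let D := B *m Y - Y *m G.

(** The columns of Z lie in the block Krylov space of B and D of length h. Unlike a bound on the
    rank, this is stable under linear combinations. *)
Definition krylov (Z : 'M[C]_(m.+1, n.+1)) : Prop :=
  exists F : nat -> 'M[C]_n.+1, Z = \sum_(i < h) (B ^+ i *m D) *m F i.

Lemma krylov0 : krylov 0.
Proof. by exists (fun=> 0); rewrite big1// => i _; rewrite mulmx0. Qed.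

Lemma krylovD Z1 Z2 : krylov Z1 -> krylov Z2 -> krylov (Z1 + Z2).
Proof.
move=> [F1 ->] [F2 ->]; exists (fun i => F1 i + F2 i).
by rewrite -big_split/=; apply: eq_bigr => i _; rewrite [RHS]mulmxDr.
Qed.

Lemma krylovZ c Z : krylov Z -> krylov (c *: Z).
Proof.
move=> [F ->]; exists (fun i => c *: F i); rewrite scaler_sumr.
by apply: eq_bigr => i _; rewrite scalemxAr.
Qed.

Lemma krylov_sum I (r : seq I) (Z : I -> 'M[C]_(m.+1, n.+1)) :
  (forall i, krylov (Z i)) -> krylov (\sum_(i <- r) Z i).
Proof.
move=> H; elim/big_rec: _ => [|i X _]; first exact: krylov0.
exact: krylovD.
Qed.

Lemma krylov_power i F : (i < h)%N -> krylov (B ^+ i *m D *m F).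
Proof.
move=> ih; exists (fun j => if j == i then F else 0).
rewrite (bigD1 (Ordinal ih))//= eqxx big1 ?addr0// => j ji.
by move: ji; rewrite -val_eqE /= => /negPf ->; rewrite mulmx0.
Qed.

Lemma krylov_rank Z : krylov Z -> (\rank Z <= h * \rank D)%N.
Proof.
move=> [F ->]; elim: h => [|k IH]; first by rewrite big_ord0 mxrank0.
rewrite big_ord_recr/= mulSn addnC; apply: leq_trans (mxrank_add _ _) _.
apply: leq_add => //; apply: leq_trans (mxrankM_maxl _ _) _; exact: mxrankM_maxr.
Qed.

(** Powers of B are traded for powers of G one at a time; each trade produces one D, behind a power
    of B with exponent below a <= h. *)
Lemma krylov_exchange a b : (a <= h)%N -> (b <= h)%N ->
  krylov (B ^+ a *m Y *m G ^+ b - B ^+ b *m Y *m G ^+ a).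
Proof.
wlog ab : a b / (b <= a)%N => [H|ah _].
  have [/H//|/ltnW ab ah bh] := leqP b a.
  by rewrite -opprB -scaleN1r; apply: krylovZ; exact: H.
pose W j := B ^+ (b + j) *m Y *m G ^+ (a - j).
have -> : B ^+ a *m Y *m G ^+ b - B ^+ b *m Y *m G ^+ a =
    \sum_(j < a - b) (W j.+1 - W j).
  rewrite -(big_mkord xpredT (fun j => W j.+1 - W j)) telescope_sumr//.
  by rewrite /W addn0 subn0 subnKC// subKn.
apply: krylov_sum => j.
have ja : (j < a)%N by apply: leq_trans (leq_subr b a).
have jh : (b + j < h)%N.
  by apply: leq_trans ah; rewrite -ltn_subRL.
have -> : W j.+1 - W j = B ^+ (b + j) *m D *m G ^+ (a - j.+1).
  rewrite /W /D mulmxBr mulmxBl addnS exprSr -mulmxE !mulmxA; congr (_ - _).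
  by rewrite -(subnSK ja) exprS -mulmxE !mulmxA.
exact: krylov_power.
Qed.

(** Exchanging the summation indices in the second product pairs its monomials with those of the
    first under the same coefficient; each pair is a [krylov_exchange]. *)
Lemma rank_exchange (p q : {poly C}) : (size p <= h.+1)%N -> (size q <= h.+1)%N ->
  (\rank (horner_mx B q *m Y *m horner_mx G p - horner_mx B p *m Y *m horner_mx G q)%R
    <= h * \rank D)%N.
Proof.
move=> ph qh; apply: krylov_rank.
have expand (u v : {poly C}) : (size u <= h.+1)%N -> (size v <= h.+1)%N ->
    horner_mx B u *m Y *m horner_mx G v =
    \sum_(a < h.+1) \sum_(b < h.+1) (u`_a * v`_b) *: (B ^+ a *m Y *m G ^+ b).
  move=> uh vh; rewrite (horner_mx_wide B uh) (horner_mx_wide G vh).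
  rewrite !mulmx_suml; apply: eq_bigr => a _; rewrite mulmx_sumr.
  by apply: eq_bigr => b _; rewrite -!scalemxAl -scalemxAr scalerA mulrC.
rewrite (expand q p)// (expand p q)// [X in _ - X]exchange_big -sumrB.
apply: krylov_sum => a; rewrite -sumrB; apply: krylov_sum => b.
rewrite [p`_b * _]mulrC -scalerBr; apply: krylovZ.
by apply: krylov_exchange; rewrite -ltnS.
Qed.

Lemma singval_sylvester (p q : {poly C}) (al be y : R) (k : nat) :
  (h * \rank D <= k)%N ->
  (size p <= h.+1)%N -> (size q <= h.+1)%N ->
  horner_mx B q \is a GRing.unit -> horner_mx G p \is a GRing.unit ->
  opbound (horner_mx B p * (horner_mx B q)^-1) al ->
  opbound (horner_mx G q * (horner_mx G p)^-1) be -> opbound Y y ->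
  singval Y k.+1 <= al * y * be.
Proof.
move=> rk ph qh uB uG Bal Gbe Yy.
have al0 := opbound_ge0 Bal; have be0 := opbound_ge0 Gbe; have y0 := opbound_ge0 Yy.
pose E := (horner_mx B p * (horner_mx B q)^-1) *m Y *m
  (horner_mx G q * (horner_mx G p)^-1).
have Eb : opbound E (al * y * be).
  by apply: opboundM; rewrite ?mulr_ge0//; exact: opboundM.
apply: (@singval_le _ _ _ Y (Y - E)); first by rewrite !mulr_ge0.
  have -> : Y - E = (horner_mx B q)^-1 *m (horner_mx B q *m Y *m horner_mx G p -
      horner_mx B p *m Y *m horner_mx G q) *m (horner_mx G p)^-1.
    have com : (horner_mx B q)^-1 *m horner_mx B p =
        horner_mx B p *m (horner_mx B q)^-1.
      by apply/esym/commrV; rewrite /GRing.comm -!rmorphM mulrC.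
    rewrite mulmxBr mulmxBl !mulmxA com mulVmx// mul1mx.
    by rewrite -[Y *m _ *m _]mulmxA mulmxV// mulmx1 /E -!mulmxE !mulmxA.
  apply: leq_trans (mxrankM_maxl _ _) _; apply: leq_trans (mxrankM_maxr _ _) _.
  exact: leq_trans (rank_exchange _ _) rk.
by rewrite opprB addrC subrK.
Qed.

End Rank.

End Sylvester.

(** * The closed loop matrix and uniqueness for the Riccati equation *)

Section Riccati.
Variable R : realType.
Local Notation C := R[i].
Local Notation Re := complex.Re.
Local Notation Im := complex.Im.

Lemma conjr_real (x : R) : (x%:C)^*%R = x%:C :> C.
Proof. by apply: eq_complexP; rewrite ?cReJ ?cImJ //= oppr0. Qed.

Lemma adjmx_cmx m n (M : 'M[R]_(m, n)) : adjmx (cmx M) = cmx M^T.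
Proof. by apply/matrixP => i j; rewrite !mxE; apply: eq_complexP; rewrite ?cReJ ?cImJ //= oppr0. Qed.

Lemma numrange_dotc n (T : 'M[C]_n) x : vnorm2 x = 1 -> numrange T (dotc x (T *m x)).
Proof. by move=> x1; exists x => //; rewrite dotc_mx mulmxA. Qed.

Lemma psd_Re_ge0 n (M : 'M[R]_n) (v : 'cV[C]_n) : psd M ->
  0 <= Re (dotc v (cmx M *m v)).
Proof.
move=> [_ Mpos]; pose a := map_mx (@complex.Re R) v; pose b := map_mx (@complex.Im R) v.
have -> : Re (dotc v (cmx M *m v)) = (a^T *m M *m a) 0 0 + (b^T *m M *m b) 0 0.
  rewrite dotcE Re_sum -!mulmxA [(a^T *m _) 0 0]mxE [(b^T *m _) 0 0]mxE.
  rewrite -big_split/=; apply: eq_bigr => i _.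
  rewrite [(cmx M *m v) i 0]mxE mulr_sumr Re_sum.
  rewrite [(M *m a) i 0]mxE [(M *m b) i 0]mxE !mulr_sumr -big_split/=.
  apply: eq_bigr => j _.
  by rewrite !mxE cReM cReJ cImJ cRe_mull cIm_mull; ring.
by rewrite addr_ge0.
Qed.

(** With y = M v, the form at v - s y is at most -2 s |y|^2 + s^2 Re <y, M y>; it is nonnegative for
    every s > 0, which forces y = 0. *)
Lemma psd_Re_eq0 n (M : 'M[R]_n) (v : 'cV[C]_n) : psd M ->
  Re (dotc v (cmx M *m v)) <= 0 -> cmx M *m v = 0.
Proof.
move=> pM v0; have [MT _] := pM; set y := cmx M *m v.
apply/eqP; rewrite -vnorm2_eq0 -sqrf_eq0 eq_le sqr_ge0 andbT.
apply: (@ler_eps _ _ _ (Re (dotc y (cmx M *m y)))); first exact: psd_Re_ge0.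
move=> s s0; rewrite add0r; have := psd_Re_ge0 (v - s%:C *: y) pM.
rewrite mulmxBr -scalemxAr -/y !(dotcDl, dotcDr, dotcNl, dotcNr, dotcZl, dotcZr).
have -> : dotc v (cmx M *m y) = dotc y y.
  by rewrite -adjmxE adjmx_cmx MT.
rewrite dotcxx !conjr_real !(cReD, cReB, cReN, cRe_mull) /=.
move: v0; rewrite -/y; set Y := vnorm2 y ^+ 2; set Z := Re (dotc y _).
move=> v0 h; have : s * (2 * Y) <= s * (s * Z) by lra.
by rewrite ler_pM2l//; have := sqr_ge0 (vnorm2 y); rewrite -/Y; lra.
Qed.

(** Testing the equation on v gives 2 Re la <v, X v> + <X v, F X v> + <v, Q v> = 0. If Re la >= 0
    then F X v = 0, so v is an eigenvector of A for la, against the numerical range of A. The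
    inequality is strict, as [sylvester_unique] demands and [stable] does not provide. *)
Lemma riccati_eigenvalue_lt0 n (A F Q X : 'M[R]_n) (la : C) (v : 'cV[C]_n) :
  numrange (cmx A) `<=` @Cminus R -> psd F -> psd Q -> psd X ->
  A^T *m X + X *m A - X *m F *m X + Q = 0 ->
  v != 0 -> cmx (A - F *m X) *m v = la *: v -> Re la < 0.
Proof.
move=> WA pF pQ pX Ric v0 Tv; rewrite ltNge; apply/negP => la0.
have [XT _] := pX; have [FT _] := pF.
set T := A - F *m X in Tv.
have Ric' : T^T *m X + X *m T + X *m F *m X + Q = 0.
  rewrite -Ric /T linearB/= trmx_mul XT FT mulmxBl mulmxBr mulmxA.
  move: (A^T *m X) (X *m A) (X *m F *m X) => a b c.
  by apply/matrixP => i j; rewrite !mxE; ring.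
have E : la^* * dotc v (cmx X *m v) + la * dotc v (cmx X *m v) +
    dotc (cmx X *m v) (cmx F *m (cmx X *m v)) + dotc v (cmx Q *m v) = 0.
  have : dotc v (cmx (T^T *m X + X *m T + X *m F *m X + Q) *m v) = 0.
    rewrite Ric' map_mx0 mul0mx dotcE big1// => i _.
    by rewrite [X in _ * X]mxE mulr0.
  rewrite !map_mxD !map_mxM !mulmxDl !dotcDr -!mulmxA Tv => <-.
  congr (_ + _ + _ + _).
  - by rewrite -adjmx_cmx -(adjmxE (adjmx (cmx T))) adjmxK Tv dotcZl.
  - by rewrite -scalemxAr dotcZr.
  - by rewrite -(adjmxE (cmx X)) adjmx_cmx XT.
have := congr1 (@complex.Re R) E; rewrite !cReD.
have XR : Im (dotc v (cmx X *m v)) = 0.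
  have : dotc v (cmx X *m v) = (dotc v (cmx X *m v))^*.
    by rewrite dotcJ -{2}XT -adjmx_cmx adjmxE.
  by move=> /(congr1 (@complex.Im R)); rewrite cImJ; lra.
rewrite !cReM cReJ XR !mulr0 !subr0.
have h1 := psd_Re_ge0 v pX; have h2 := psd_Re_ge0 (cmx X *m v) pF.
have h3 := psd_Re_ge0 v pQ; have h4 := mulr_ge0 la0 h1 => h.
have FX0 : cmx F *m (cmx X *m v) = 0.
  by apply: (psd_Re_eq0 pF); move: h h2 h3 h4; clear; rewrite /=; lra.
have Av : cmx A *m v = la *: v.
  by rewrite -Tv /T map_mxB map_mxM mulmxBl -mulmxA FX0 subr0.
have := WA _ (numrange_dotc (cmx A) (vnorm2_normalize v0)).
rewrite /Cminus /= -scalemxAr Av !dotcZr dotcZl dotcxx.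
set t := vnorm2 v ^+ 2; have t0 : 0 < t by rewrite exprn_gt0// vnorm2_gt0.
set s := (vnorm2 v)^-1; have s0 : 0 < s by rewrite invr_gt0 vnorm2_gt0.
have -> : s%:C * (la * ((s%:C)^* * t%:C)) = la * (s ^+ 2 * t)%:C.
  have -> : (s ^+ 2 * t)%:C = s%:C * s%:C * t%:C by rewrite -!rmorphM.
  by rewrite conjr_real; ring.
by rewrite cRe_mulr ltNge mulr_ge0// mulr_ge0 ?sqr_ge0 ?ltW.
Qed.

Lemma eigenvalue_cV n (M : 'M[C]_n) a : a%:M - M \notin unitmx ->
  exists2 v : 'cV[C]_n, v != 0 & M *m v = a *: v.
Proof.
rewrite unitmxE unitfE negbK -det_tr => /det0P[v v0 vM]; exists v^T.
  by apply: contra v0 => /eqP/(congr1 trmx); rewrite trmxK trmx0 => ->.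
apply/esym/eqP; rewrite -subr_eq0 -mul_scalar_mx -mulmxBl.
by rewrite -[a%:M - M]trmxK -trmx_mul vM trmx0.
Qed.

(** Z intertwines N and -L, so p(-L) Z = Z p(N) = 0 for the characteristic polynomial p of N. The
    roots of p have negative real part and the eigenvalues of -L positive real part, so p(-L) is
    invertible. *)
Lemma sylvester_unique n (L N Z : 'M[C]_n.+1) :
  (forall a (v : 'cV[C]_n.+1), v != 0 -> L^T *m v = a *: v -> Re a < 0) ->
  (forall a (v : 'cV[C]_n.+1), v != 0 -> N *m v = a *: v -> Re a < 0) ->
  L *m Z + Z *m N = 0 -> Z = 0.
Proof.
move=> HL HN LZN; pose p := char_poly N.
have comm q : Z *m horner_mx N q = horner_mx (- L) q *m Z.
  elim/poly_ind: q => [|q c IH]; first by rewrite !rmorph0 mulmx0 mul0mx.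
  have ZN : Z *m N = - L *m Z by rewrite mulNmx; apply/eqP; rewrite -addr_eq0 addrC LZN.
  rewrite !rmorphD !rmorphM/= !horner_mx_X !horner_mx_C mulmxDr mulmxDl.
  rewrite -!mulmxE mulmxA IH -[_ *m Z *m N]mulmxA ZN mulmxA; congr (_ + _).
  by rewrite scalar_mxC.
have p0 : p != 0 by exact/monic_neq0/char_poly_monic.
have [rs pE rsp] := closed_roots p0.
have : horner_mx (- L) p *m Z = 0 by rewrite -comm Cayley_Hamilton mulmx0.
suff u : horner_mx (- L) p \in unitmx.
  by move=> /(congr1 (mulmx (invmx (horner_mx (- L) p)))); rewrite mulKmx// mulmx0.
have rsu a : a \in rs -> - L - a%:M \in unitmx.
  move=> /rsp pa.
  have [v v0 Nv] : exists2 v : 'cV[C]_n.+1, v != 0 & N *m v = a *: v.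
    have : eigenvalue N^T a.
      rewrite eigenvalue_root_char (_ : char_poly N^T = p); first exact/rootP.
      rewrite /p /char_poly -det_tr; congr (\det _).
      by apply/matrixP => i j; rewrite !mxE eq_sym.
    case/eigenvalueP => v vN v0; exists v^T; first by rewrite trmx_eq0.
    by rewrite -[N]trmxK -trmx_mul vN linearZ.
  have a0 := HN _ _ v0 Nv.
  have -> : - L - a%:M = ((- a)%:M - L^T)^T.
    by rewrite linearB/= trmxK tr_scalar_mx raddfN/= addrC.
  rewrite unitmx_tr; apply: contraT => /eigenvalue_cV[w w0 Lw].
  have := HL _ _ w0 Lw; rewrite cReN; lra.
rewrite pE horner_mxZ -[_ \in unitmx]/(_ \is a GRing.unit) scaler_unit ?unitfE ?lead_coef_eq0//.
rewrite rmorph_prod/=; elim: rs rsu {pE rsp} => [|a rs IH] rsu; first by rewrite big_nil unitr1.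
rewrite big_cons unitrMl; last first.
  by apply: IH => b brs; apply: rsu; rewrite inE brs orbT.
by rewrite rmorphB/= horner_mx_X horner_mx_C; apply: rsu; rewrite inE eqxx.
Qed.

Lemma stabilizing_sol_unique n (A F Q X Y : 'M[R]_n) :
  numrange (cmx A) `<=` @Cminus R -> psd F -> psd Q ->
  stabilizing_sol A F Q X -> stabilizing_sol A F Q Y -> X = Y.
Proof.
move=> WA pF pQ [pX RX _] [pY RY _].
case: n A F Q X Y WA pF pQ pX RX pY RY => [|n] A F Q X Y WA pF pQ pX RX pY RY.
  by apply/matrixP => [[]].
have [XT _] := pX; have [FT _] := pF.
(* In the difference of the two equations the quadratic terms factor with X on the left and Y on the
   right; the cross term X F Y cancels. *)
have syl : (A - F *m X)^T *m (X - Y) + (X - Y) *m (A - F *m Y) = 0.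
  have : (A^T *m X + X *m A - X *m F *m X + Q) - (A^T *m Y + Y *m A - Y *m F *m Y + Q) = 0.
    by rewrite RX RY subrr.
  have -> : (A - F *m X)^T = A^T - X *m F by rewrite linearB/= trmx_mul XT FT.
  move=> <-; rewrite !mulmxBl !mulmxBr !mulmxA.
  move: (A^T *m X) (A^T *m Y) (X *m F *m X) (X *m F *m Y) (X *m A) (Y *m A)
    (Y *m F *m Y) => a b c d e f g.
  by apply/matrixP => i j; rewrite !mxE; ring.
apply/eqP; rewrite -subr_eq0 -(map_mx_eq0 (real_complex R)); apply/eqP.
apply: (@sylvester_unique _ (cmx (A - F *m X)^T) (cmx (A - F *m Y))).
- by move=> a v v0; rewrite map_trmx trmxK; exact: riccati_eigenvalue_lt0 RX v0.
- by move=> a v v0; exact: riccati_eigenvalue_lt0 RY v0.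
- by rewrite -!map_mxM -map_mxD syl map_mx0.
Qed.

End Riccati.

(** * Off-diagonal blocks of the Riccati equation *)

Section Blocks.
Variable R : realType.

(** f and g together enumerate the indices once each, in the form that block multiplication
    consumes; symmetric in f and g, so one argument covers both kinds of blocks in [Off]. *)
Definition complementary (n p q : nat) (f : 'I_p -> 'I_n) (g : 'I_q -> 'I_n) :=
  forall F : 'I_n -> R, \sum_i F i = \sum_j F (f j) + \sum_k F (g k).

Lemma complementaryC n p q (f : 'I_p -> 'I_n) (g : 'I_q -> 'I_n) :
  complementary f g -> complementary g f.
Proof. by move=> fg F; rewrite fg addrC. Qed.

Lemma mxsub_mul n p q a b (f : 'I_p -> 'I_n) (g : 'I_q -> 'I_n)
    (h : 'I_a -> 'I_n) (k : 'I_b -> 'I_n) (P Q : 'M[R]_n) : complementary f g ->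
  mxsub h k (P *m Q) =
    mxsub h f P *m mxsub f k Q + mxsub h g P *m mxsub g k Q.
Proof.
move=> fg; apply/matrixP => i j; rewrite !mxE fg.
by congr (_ + _); apply: eq_bigr => l _; rewrite !mxE.
Qed.

Lemma riccati_block_rank n p q (f : 'I_p -> 'I_n) (g : 'I_q -> 'I_n)
    (A F Q X : 'M[R]_n) (ra rf rq : nat) : complementary f g ->
  F^T = F -> X^T = X -> A^T *m X + X *m A - X *m F *m X + Q = 0 ->
  (\rank (mxsub f g A) <= ra)%N -> (\rank (mxsub g f A) <= ra)%N ->
  (\rank (mxsub f g F) <= rf)%N -> (\rank (mxsub g f F) <= rf)%N ->
  (\rank (mxsub g f Q) <= rq)%N ->
  (\rank ((mxsub g g (A - F *m X))^T *m mxsub g f X +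
      mxsub g f X *m mxsub f f (A - F *m X))%R <= 4 * ra + 2 * rf + 2 * rq)%N.
Proof.
move=> fg FT XT Ric rA1 rA2 rF1 rF2 rQ.
set M := mxsub g f X.
have TT : (A - F *m X)^T = A^T - X *m F by rewrite linearB/= trmx_mul XT FT.
(* Products of M with diagonal blocks of A and F are absorbed by the closed loop blocks. M F_fg M
   occurs in both of these and once in X F X, so one copy remains. *)
have -> : (mxsub g g (A - F *m X))^T *m M + M *m mxsub f f (A - F *m X) =
    (mxsub g g X *m mxsub g f F) *m mxsub f f X - (M *m mxsub f g F) *m M
    - mxsub g f A^T *m mxsub f f X - mxsub g g X *m mxsub g f A - mxsub g f Q.
  have := congr1 (mxsub g f) Ric; rewrite trmx_mxsub TT.
  rewrite !linearD /= !linearN /= linear0 !(mxsub_mul _ _ _ _ fg) -/M.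
  rewrite !(mulmxDl, mulmxDr, mulmxN, mulNmx) !mulmxA.
  move: (mxsub g f A^T *m _) (mxsub g g A^T *m _) (M *m mxsub f f A)
     (mxsub g g X *m mxsub g f A) (mxsub g f Q) => a b c d e.
  move: (M *m mxsub f f F *m mxsub f f X) (mxsub g g X *m mxsub g f F *m mxsub f f X)
    (M *m mxsub f g F *m M) (mxsub g g X *m mxsub g g F *m M) => u v w z E.
  apply/eqP; rewrite -subr_eq0 -[X in _ == X]E; apply/eqP.
  by apply/matrixP => i j; rewrite !mxE; ring.
have tA : (\rank (mxsub g f A^T) <= ra)%N by rewrite -trmx_mxsub mxrank_tr.
have mull a b c d (U : 'M[R]_(a, b)) (V : 'M[R]_(b, c)) :
  (\rank V <= d)%N -> (\rank (U *m V)%R <= d)%N by exact/leq_trans/mxrankM_maxr.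
have mulr a b c d (U : 'M[R]_(a, b)) (V : 'M[R]_(b, c)) :
  (\rank U <= d)%N -> (\rank (U *m V)%R <= d)%N by exact/leq_trans/mxrankM_maxl.
have subm a b c d (U V : 'M[R]_(a, b)) :
    (\rank U <= c)%N -> (\rank V <= d)%N -> (\rank (U - V)%R <= c + d)%N.
  by move=> Uc Vd; apply: leq_trans (mxrank_add _ _) _; rewrite mxrank_opp leq_add.
(* The five summands contain two blocks of F, two of A and one of Q. *)
have le : (rf + rf + ra + ra + rq <= 4 * ra + 2 * rf + 2 * rq)%N.
  rewrite addnn -[(_ + ra + ra)%N]addnA addnn -!mul2n [(2 * rf + _)%N]addnC.
  by rewrite !leq_add// ?leq_mul2r ?orbT// leq_pmull.
apply: leq_trans le.
apply: (subm _ _ _ _ _ _ _ rQ); apply: (subm); last exact: mull.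
by apply: (subm); [apply: (subm); exact/mulr/mull|exact: mulr].
Qed.

Lemma head_tail_complementary n (s : 'I_n.+1) :
  complementary (@head_ord n s) (@tail_ord n s).
Proof.
move=> F; rewrite (reindex (cast_ord (subnKC (leq_ord s)))) /=.
  rewrite big_split_ord/=; congr (_ + _); apply: eq_bigr => i _; congr F.
  exact: val_inj.
by exists (cast_ord (esym (subnKC (leq_ord s)))) => i _; rewrite ?cast_ordK ?cast_ordKV.
Qed.

Lemma head_ord_inj n (s : 'I_n.+1) : injective (@head_ord n s).
Proof. by move=> i j /(congr1 val) /= ij; apply: val_inj. Qed.

Lemma tail_ord_inj n (s : 'I_n.+1) : injective (@tail_ord n s).
Proof. by move=> i j /(congr1 val) /= /addnI ij; apply: val_inj. Qed.

Lemma OffP n (M : 'M[R]_n) (B : block R) : B \in Off M ->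
  exists2 s : 'I_n.+1, (0 < s < n)%N &
    B = pack (mxsub (@tail_ord n s) (@head_ord n s) M) \/
    B = pack (mxsub (@head_ord n s) (@tail_ord n s) M).
Proof.
rewrite mem_cat => /orP[] /mapP[s]; rewrite mem_filter => /andP[sn _] ->.
  by exists s => //; left.
by exists s => //; right.
Qed.

Lemma quasiseparable_rank n r (M : 'M[R]_n) (s : 'I_n.+1) :
  quasiseparable r M -> (0 < s < n)%N ->
  (\rank (mxsub (@tail_ord n s) (@head_ord n s) M) <= r)%N /\
  (\rank (mxsub (@head_ord n s) (@tail_ord n s) M) <= r)%N.
Proof.
move=> <- sn; have ss : s \in [seq s : 'I_n.+1 <- enum 'I_n.+1 | (0 < s < n)%N].
  by rewrite mem_filter sn mem_enum.
split.
  apply: (@leq_bigmax_seq _ _ xpredT (fun B : block R => \rank (tagged B))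
    (pack (mxsub (@tail_ord n s) (@head_ord n s) M))) => //.
  by rewrite mem_cat (map_f (fun s => pack (mxsub (@tail_ord n s) (@head_ord n s) M))).
apply: (@leq_bigmax_seq _ _ xpredT (fun B : block R => \rank (tagged B))
    (pack (mxsub (@head_ord n s) (@tail_ord n s) M))) => //.
by rewrite mem_cat (map_f (fun s => pack (mxsub (@head_ord n s) (@tail_ord n s) M))) ?orbT.
Qed.

End Blocks.

Section Compression.
Variable R : realType.
Local Notation C := R[i].

Lemma dotc_mxsub n p (f : 'I_p -> 'I_n) (T : 'M[C]_n) (x : 'cV[C]_p) :
  injective f -> vnorm2 x = 1 ->
  exists2 y : 'cV[C]_n, vnorm2 y = 1 & dotc x (mxsub f f T *m x) = dotc y (T *m y).
Proof.
move=> finj x1; pose e : 'M[C]_(p, n) := rowsub f 1%:M.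
have eT : mxsub f f T = e *m T *m adjmx e.
  apply/matrixP => i j; rewrite !mxE (bigD1 (f j))//= big1 => [|k kj].
    rewrite addr0 mxE (bigD1 (f i))//= big1 => [|k ki].
      by rewrite !mxE !eqxx mul1r conjc1 mulr1 addr0.
    by rewrite !mxE eq_sym (negbTE ki) mul0r.
  by rewrite !mxE eq_sym (negbTE kj) conjc0 mulr0.
have ee : e *m adjmx e = 1%:M.
  apply/matrixP => i j; rewrite !mxE (bigD1 (f i))//= big1 => [|k ki].
    by rewrite !mxE eqxx mul1r addr0 conjc_nat (inj_eq finj) eq_sym.
  by rewrite !mxE eq_sym (negbTE ki) mul0r.
exists (adjmx e *m x); last by rewrite adjmxE eT -!mulmxA.
apply: (@pexpIrn _ 2) => //; rewrite ?nnegrE ?vnorm2_ge0 ?expr1n//.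
by rewrite -Re_dotcxx adjmxE mulmxA ee mul1mx Re_dotcxx x1 expr1n.
Qed.

(** The conjugate of x is the witness. Needed because the left coefficient of the Sylvester equation
    is a transpose. *)
Lemma dotc_tr n (T : 'M[C]_n) (x : 'cV[C]_n) : vnorm2 x = 1 ->
  exists2 y : 'cV[C]_n, vnorm2 y = 1 & dotc x (T^T *m x) = dotc y (T *m y).
Proof.
move=> x1; exists (map_mx (@conjc R) x).
  rewrite -x1; congr Num.sqrt; apply: eq_bigr => i _; rewrite mxE.
  by congr (_ ^+ 2); exact: normc_conj.
rewrite !dotcE.
under eq_bigr => i _ do rewrite mxE mulr_sumr.
under [RHS]eq_bigr => i _ do rewrite !mxE mulr_sumr.
rewrite exchange_big; apply: eq_bigr => i _; apply: eq_bigr => j _.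
rewrite !mxE (conjcK (x i 0) : (conjc (x i 0))^*%R = _); ring.
Qed.

End Compression.

Section ConvexHull.
Variable R : realType.
Local Notation C := R[i].

Lemma convex_hull_segment (S : set C) : segment_closed (convex_hull S).
Proof.
move=> x y t Sx Sy /andP[t0 t1] D [Dc SD].
have := Dc x y (Itv01 t0 t1); rewrite !inE.
move=> /(_ (Sx D (conj Dc SD)) (Sy D (conj Dc SD))).
suff -> : conv (Itv01 t0 t1) (x : convex_lmodType (Rcomplex R)) y =
  t%:C * x + (1 - t)%:C * y by [].
have sE (a : R) (z : C) : (a *: (z : Rcomplex R)) = a%:C * z :> C.
  by case: z => u v; apply: eq_complexP; rewrite ?cRe_mull ?cIm_mull.
by rewrite /conv /= !sE.
Qed.

Lemma convex_hull_sub (S : set C) : S `<=` convex_hull S.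
Proof. exact: sub_smallest. Qed.

End ConvexHull.

(** * Zolotarev quotients and the final estimate *)

Section Zolotarev.
Variable R : realType.
Local Notation C := R[i].

Lemma sylvester_block_singval n a b (f : 'I_a -> 'I_n) (g : 'I_b -> 'I_n)
    (T X : 'M[R]_n) (t h : nat) (S : set C) (p q : {poly C}) (al be : R) :
  (0 < a)%N -> (0 < b)%N -> injective f -> injective g ->
  (\rank ((mxsub g g T)^T *m mxsub g f X + mxsub g f X *m mxsub f f T)%R <= t)%N ->
  segment_closed S -> numrange (cmx T) `<=` S ->
  ratfun h p q -> 0 <= al -> 0 <= be ->
  (forall z, S z -> normc p.[z] <= al * normc q.[z]) ->
  (forall z, S z -> normc q.[- z] <= be * normc p.[- z]) ->
  singval (cmx (mxsub g f X)) (h * t + 1) <=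
    (1 + Num.sqrt 2) ^+ 2 * (al * be) * mxnorm2 (cmx X).
Proof.
case: a f => // a f; case: b g => // b g _ _ finj ginj rk Sconv WS [_ pq ph qh].
move=> al0 be0 pal qbe.
pose B := (cmx (mxsub g g T))^T; pose G := - cmx (mxsub f f T).
have [uB Bb] : horner_mx B q \is a GRing.unit /\
    opbound (horner_mx B p * (horner_mx B q)^-1) ((1 + Num.sqrt 2) * al).
  apply: (@crouzeix_palencia _ _ B S) => // x.
  move=> /(dotc_tr (cmx (mxsub g g T)))[y y1 ->]; rewrite map_mxsub.
  by have [z z1 ->] := dotc_mxsub (cmx T) ginj y1; exact/WS/numrange_dotc.
have [uG Gb] : horner_mx G p \is a GRing.unit /\
    opbound (horner_mx G q * (horner_mx G p)^-1) ((1 + Num.sqrt 2) * be).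
  apply: (@crouzeix_palencia _ _ G [set z | S (- z)]) => //.
  - move=> x y s Sx Sy s01; have := Sconv _ _ _ Sx Sy s01.
    by rewrite /= !mulrN opprD.
  - move=> x; rewrite /G map_mxsub mulNmx dotcNr /= opprK.
    by move=> /(dotc_mxsub (cmx T) finj)[z z1 ->]; exact/WS/numrange_dotc.
  - by rewrite coprimep_sym.
  - by move=> z Sz; have := qbe _ Sz; rewrite opprK.
have Xb : opbound (cmx (mxsub g f X)) (mxnorm2 (cmx X)).
  by rewrite map_mxsub; apply: opbound_mxsub; rewrite ?mxnorm2_ge0//; exact: opbound_mxnorm2.
have rk' : (h * \rank (B *m cmx (mxsub g f X) - cmx (mxsub g f X) *m G)%R <= h * t)%N.
  rewrite leq_mul2l /B /G mulmxN opprK map_trmx -!map_mxM -map_mxD mxrank_map rk orbT//.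
rewrite addn1; apply: le_trans (singval_sylvester rk' ph qh uB uG Bb Gb Xb) _.
rewrite le_eqVlt; apply/orP; left; apply/eqP; ring.
Qed.

(** Written without division, the inequalities remain meaningful at zeros and poles of p / q and
    have the form that [crouzeix_palencia] takes. A point of E keeps the supremum from being -oo. *)
Lemma zolotarev_bounds h (E : set C) (v : \bar R) : E !=set0 ->
  (exists p q : {poly C},
    let M := ereal_sup [set absrat p q z | z in E] in
    let m := ereal_inf [set absrat p q z | z in [set (- z)%R | z in E]] in
    [/\ ratfun h p q, (M < +oo)%E, (0 < m)%E & v = (M * m^-1)%E]) ->
  exists p q (al be : R), [/\ ratfun h p q, 0 <= al, 0 <= be, v = (al * be)%:E &
    (forall z, E z -> normc p.[z] <= al * normc q.[z]) /\
    (forall z, E z -> normc q.[- z] <= be * normc p.[- z])].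
Proof.
move=> [z0 Ez0] [p [q [pq]]].
set M := ereal_sup _; set m := ereal_inf _ => Moo m0 ->.
have leM z : E z -> (absrat p q z <= M)%E.
  by move=> Ez; apply: ereal_sup_ubound; exists z.
have lem z : E z -> (m <= absrat p q (- z)%R)%E.
  by move=> Ez; apply: ereal_inf_lbound; exists (- z) => //; exists z.
have abs0 z : (0 <= absrat p q z)%E.
  by rewrite /absrat; case: ifP => // _; rewrite lee_fin normc_ge0.
have M0 : (0 <= M)%E := le_trans (abs0 z0) (leM z0 Ez0).
case: M leM Moo M0 => // al leM _; rewrite lee_fin => al0.
have pal z : E z -> normc p.[z] <= al * normc q.[z].
  move=> /leM; rewrite /absrat; case: eqP => // /eqP qz.
  by rewrite lee_fin normcM normcV -ler_pdivrMr ?normc_gt0// => ->.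
case: m lem m0 => // [m lem|lem _].
  rewrite lte_fin => m0; exists p, q, al, m^-1; split => //.
  - by rewrite invr_ge0 ltW.
  - by rewrite inver gt_eqF// -EFinM.
  split=> // z /lem; rewrite /absrat; case: eqP => [-> _|/eqP qz].
    by rewrite normc0 mulr_ge0 ?normc_ge0 ?invr_ge0 ?(ltW m0).
  rewrite lee_fin normcM normcV ler_pdivlMr ?normc_gt0//.
  by rewrite ler_pdivlMl.
(* Here m = +oo: its inverse is 0, and q vanishes on all of -E. *)
exists p, q, al, 0; split => //.
split=> // z /lem; rewrite /absrat; case: eqP => // ->.
by rewrite normc0 mul0r.
Qed.

End Zolotarev.

Section Statement.
Variable R : realType.

Lemma lead_mx_max n (M : 'M[R]_n) : lead_mx M ord_max = M.
Proof. by apply/matrixP => i j; rewrite mxE; congr (M _ _); exact: val_inj. Qed.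

Lemma numrange_nonempty n (T : 'M[R[i]]_n) : (0 < n)%N -> numrange T !=set0.
Proof.
case: n T => // n T _.
have d0 : delta_mx 0 0 != 0 :> 'cV[R[i]]_n.+1.
  by apply/eqP => /matrixP/(_ 0 0); rewrite !mxE eqxx => /eqP; rewrite oner_eq0.
by eexists; exact/numrange_dotc/(vnorm2_normalize d0).
Qed.

Lemma convex_hull_mono (S T : set R[i]) : S `<=` T -> convex_hull S `<=` convex_hull T.
Proof. by move=> ST z Sz D [Dc TD]; apply: Sz; split=> // w /ST/TD. Qed.

End Statement.

Unset Implicit Arguments.

Theorem theorem2p4 (R : realType) (n ra rf rq : nat) (A F Q X : 'M[R]_n)
  (quasiA : quasiseparable ra A)
  (rangeA : numrange (cmx A) `<=` @Cminus R)
  (psdF : psd F) (quasiF : quasiseparable rf F)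
  (psdQ : psd Q) (quasiQ : quasiseparable rq Q)
  (solX : stabilizing_sol A F Q X)
  (Xlead : forall j : 'I_n.+1, 'M[R]_j)
  (Xtrail : forall j : 'I_n.+1, 'M[R]_(n - j))
  (solXlead : forall j : 'I_n.+1, (0 < j)%N ->
     stabilizing_sol (lead_mx A j) (lead_mx F j) (lead_mx Q j) (Xlead j))
  (solXtrail : forall j : 'I_n.+1, (0 < j < n)%N ->
     stabilizing_sol (trail_mx A j) (trail_mx F j) (trail_mx Q j) (Xtrail j))
  (E : set R[i]) (EC : E `<=` @Cminus R)
  (hullE : convex_hull
     ((\bigcup_(j in [set j : 'I_n.+1 | (0 < j)%N])
         numrange (cmx (lead_mx A j - lead_mx F j *m Xlead j))) `|`
      (\bigcup_(j in [set j : 'I_n.+1 | (0 < j < n)%N])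
         numrange (cmx (trail_mx A j - trail_mx F j *m Xtrail j))))
     `<=` E) :
  let t := (4 * ra + 2 * rf + 2 * rq)%N in
  forall M : block R, M \in Off X ->
  forall h : nat, (0 < h)%N ->
    ((singval (cmx (tagged M)) (h * t + 1) / mxnorm2 (cmx X))%:E <=
      ((1 + Num.sqrt 2) ^+ 2)%:E * zolotarev h E [set (- z)%R | z in E])%E.
Proof.
move=> t M MX h _.
have [[XT Xpsd] Ric _] := solX; have [FT _] := psdF.
have [s sn Ms] := OffP MX; have /andP[s0 s_lt_n] := sn.
have n0 : (0 < n)%N by exact: leq_ltn_trans s_lt_n.
pose S := convex_hull (numrange (cmx (A - F *m X))).
have SE : S `<=` E.
  move=> w Sw; apply: hullE; apply: (@convex_hull_mono _ _ _ _ w Sw) => z Wz; left.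
  exists ord_max => //.
  (* The value of [ord_max] computes to n, so the leading submatrix of this index has the type of
     the full matrix. *)
  have := solXlead ord_max n0; rewrite !lead_mx_max => solX'.
  by rewrite -(stabilizing_sol_unique rangeA psdF psdQ solX solX').
have [z0 Wz0] := numrange_nonempty (cmx (A - F *m X)) n0.
have E0 : E !=set0 by exists z0; exact: (SE _ (convex_hull_sub Wz0)).
have c0 : 0 < (1 + Num.sqrt 2) ^+ 2 :> R by rewrite exprn_gt0// ltr_wpDr ?sqrtr_ge0.
(* With the constant moved to the left the infimum stands alone, and it suffices to stay below each
   admissible quotient. *)
rewrite -lee_pdivrMl//; apply: le_ereal_inf_tmp => v.
move=> /(zolotarev_bounds E0)[p [q [al [be [pq al0 be0 -> [pal qbe]]]]]].
rewrite lee_pdivrMl// -EFinM lee_fin.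
(* If X has norm 0, the quotient on the left is 0, the value of division by 0. *)
have [->|X0] := eqVneq (mxnorm2 (cmx X)) 0.
  by rewrite invr0 mulr0 !mulr_ge0// ltW.
rewrite ler_pdivrMr ?lt_def ?X0 ?mxnorm2_ge0//.
have [A1 A2] := quasiseparable_rank quasiA sn.
have [F1 F2] := quasiseparable_rank quasiF sn.
have [Q1 Q2] := quasiseparable_rank quasiQ sn.
have comp := @head_tail_complementary R n s.
have WS : numrange (cmx (A - F *m X)) `<=` S by exact: convex_hull_sub.
have Spal z : S z -> normc p.[z] <= al * normc q.[z] by move=> /SE/pal.
have Sqbe z : S z -> normc q.[(- z)%R] <= be * normc p.[(- z)%R] by move=> /SE/qbe.
have ns : (0 < n - s)%N by rewrite subn_gt0.
have [hI tI] := (@head_ord_inj _ s, @tail_ord_inj _ s).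
case: Ms => ->.
  apply: (@sylvester_block_singval _ _ _ _ (@head_ord n s) (@tail_ord n s)
    (A - F *m X) X t h S p q) => //; first by apply: (riccati_block_rank comp FT XT Ric).
  exact: convex_hull_segment.
apply: (@sylvester_block_singval _ _ _ _ (@tail_ord n s) (@head_ord n s)
  (A - F *m X) X t h S p q) => //; first by apply: (riccati_block_rank (complementaryC comp) FT XT Ric).
exact: convex_hull_segment.
Qed.
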